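(* Let $l>0$, let $X^{(0,l,0)}=\{X^{(0,l,0)}_t:t\ge0\}$ be the excursion bridge of length $l$, from $0$ to $0$, of the diffusion $X$ (as defined in the context), and let $U$ be a random variable uniformly distributed on $(0,l)$ and independent of $X^{(0,l,0)}$. Let $$I^{(l,+)}:=\int_0^l\mathbf{1}_{\{X^{(0,l,0)}_s>X^{(0,l,0)}_U\}}\,ds\qquad\text{and}\qquad I^{(l,-)}:=\int_0^l\mathbf{1}_{\{X^{(0,l,0)}_s<X^{(0,l,0)}_U\}}\,ds.$$ Then $I^{(l,+)}$ and $I^{(l,-)}$ are identically distributed, each uniformly on $(0,l)$.
   Context: Setting. $X^\circ=\{X^\circ_t:t\ge0\}$ is a one-dimensional recurrent conservative diffusion living in an interval $I$, where $I=[0,b]$ with $b<+\infty$, or $I=[0,b)$ with $b\le+\infty$; $0$ is a reflecting boundary and $b$ is either reflecting, or natural, or entrance-not-exit. $S(x)$ is its scale function and $m(dx)$ its speed measure; $X^\circ$ is positively recurrent, i.e. $M:=m\{I\}<\infty$. The infinitesimal generator is $\mathcal{G}=\frac{d}{dm}\frac{d}{dS}$. It is assumed that $m(dx)=m(x)\,dx$ and $S(dx)=S'(x)\,dx$ with $m(x)$ and $S'(x)$ continuous and positive. $X=\{X_t:t\in\mathbb{R}\}$ is the corresponding stationary diffusion in stationary state: take two copies $X^{(1)},X^{(2)}$ of $X^\circ$ with common starting point of law $m(dx)/M$, otherwise independent, and put $X_t:=X^{(1)}_t$ for $t\ge0$, $X_t:=X^{(2)}_{-t}$ for $t\le0$.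 Excursion space. $E$ is the space of continuous functions $e:\mathbb{R}_+\to\mathbb{R}_+$ with $e(0)=0$ for which there exists $\zeta=\zeta(e)>0$ with $e(t)>0$ for $0<t<\zeta$ and $e(t)=0$ for $t\ge\zeta$; it is equipped with the $\sigma$-algebra generated by the cylinder sets. Excursion bridge. The excursion bridge $X^{(0,l,0)}$ of $X$ from $0$ to $0$ of length $l$ is the process obtained from $\{X_t: t\ge 0\}$ with $X_0=x>0$, conditioned to hit $0$ for the first time at time $l$, by letting $x\to0$ (limit in law), with $X^{(0,l,0)}_t:=0$ for $t\ge l$; thus $X^{(0,l,0)}\in E$. (For reflecting Brownian motion it is the 3-dimensional Bessel bridge from $0$ to $0$ of length $l$.) *)

(* Defs.v *)
From HB Require Import structures.
From mathcomp Require Import all_boot all_order all_algebra.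
From mathcomp Require Import all_classical all_reals all_analysis.

Set Implicit Arguments.
Unset Strict Implicit.
Unset Printing Implicit Defensive.

Import Order.TTheory GRing.Theory Num.Theory.
Import numFieldNormedType.Exports.

Local Open Scope classical_set_scope.
Local Open Scope ring_scope.

(* The space C(R_+, R).  A path is encoded as its unique extension to a
   continuous function on R which is constant on ]-oo, 0]. *)
Record cpath (R : realType) := CPath {
  path_fun :> R -> R;
  path_cont : continuous path_fun;
  path_neg : forall t, t <= 0 -> path_fun t = path_fun 0 }.

Section path_space.
Context {R : realType}.

HB.instance Definition _ := gen_eqMixin (cpath R).
HB.instance Definition _ := gen_choiceMixin (cpath R).

Definition cst_path (x : R) : cpath R :=
  @CPath R (fun=> x) (fun _ => cvg_cst _) (fun _ _ => erefl).

HB.instance Definition _ := isPointed.Build (cpath R) (cst_path 0).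

(* The compact-open topology, i.e. that of locally uniform convergence. *)
HB.instance Definition _ := Topological.copy (cpath R)
  (initial_topology (@path_fun R : cpath R -> {compact-open, R -> R})).

Definition coordinate_events (D : set R) : set (set (cpath R)) :=
  [set A | exists2 t, D t & exists2 B : set R, measurable B &
    A = [set w : cpath R | B (w t)]].

Definition cylinders : set (set (cpath R)) := coordinate_events `[0, +oo[.

HB.instance Definition _ := @isMeasurable.Build (sigma_display cylinders)
  (cpath R) <<s cylinders >> (@sigma_algebra0 _ setT cylinders)
  (@sigma_algebraC _ cylinders) (@sigma_algebra_bigcup _ setT cylinders).

Lemma shift_path_cont (t : R) (w : cpath R) :
  continuous (fun s : R => w (t + Num.max s 0)).
Proof.
move=> s; apply: (@continuous_comp _ _ _ (fun u : R => t + Num.max u 0) w).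
  apply: cvgD; first exact: cvg_cst.
  by apply: (@continuous_max _ _ id (fun=> 0)); [exact: cvg_id|exact: cvg_cst].
exact: path_cont.
Qed.

Lemma shift_path_neg (t : R) (w : cpath R) (s : R) : s <= 0 ->
  w (t + Num.max s 0) = w (t + Num.max 0 0).
Proof. by move=> s0; rewrite maxxx max_r. Qed.

Definition shift_path (t : R) (w : cpath R) : cpath R :=
  CPath (@shift_path_cont t w) (@shift_path_neg t w).

Lemma stop_path_cont (t : R) (w : cpath R) :
  continuous (fun s : R => w (Num.min s t)).
Proof.
move=> s; apply: (@continuous_comp _ _ _ (fun u : R => Num.min u t) w).
  by apply: (@continuous_min _ _ id (fun=> t)); [exact: cvg_id|exact: cvg_cst].
exact: path_cont.
Qed.

Lemma stop_path_neg (t : R) (w : cpath R) (s : R) : s <= 0 ->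
  w (Num.min s t) = w (Num.min 0 t).
Proof.
move=> s0; rewrite path_neg; last by rewrite ge_min s0.
by rewrite [RHS]path_neg// ge_min lexx.
Qed.

Definition stop_path (t : R) (w : cpath R) : cpath R :=
  CPath (@stop_path_cont t w) (@stop_path_neg t w).

Lemma measurable_stop_path (t : R) : measurable_fun setT (stop_path t).
Proof.
apply: (@measurability _ _ _ _ _ _ cylinders) => //.
move=> _ [_ [s s0 [B mB ->]] <-]; rewrite setTI.
apply: sub_sigma_algebra; exists (Num.max (Num.min s t) 0).
  by rewrite /= in_itv/= andbT le_max lexx orbT.
exists B => //; rewrite predeqE => w /=.
have [m0|m0] := leP (Num.min s t) 0; last by [].
by rewrite path_neg.
Qed.

(* The measure pushforward mu (stop_path t). *)
Definition stopped_law (t : R) (mu : {measure set (cpath R) -> \bar R}) :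
  {measure set (cpath R) -> \bar R}.
Proof.
refine (pushforward mu (stop_path t) : {measure set _ -> \bar R}).
exact: measurable_stop_path.
Defined.

(* The infimum of the empty set is +oo. *)
Definition hitting_time (y : R) (w : cpath R) : \bar R :=
  ereal_inf [set t%:E | t in [set t | 0 <= t /\ w t = y]].

Definition natural_filtration (t : R) : set (set (cpath R)) :=
  <<s coordinate_events `[0, t] >>.

Definition stopping_time (tau : cpath R -> \bar R) : Prop :=
  (forall w, (0 <= tau w)%E) /\
  (forall t, 0 <= t -> natural_filtration t [set w | (tau w <= t%:E)%E]).

Definition stopped_events (tau : cpath R -> \bar R) : set (set (cpath R)) :=
  [set A | measurable A /\ forall t, 0 <= t ->
    natural_filtration t (A `&` [set w | (tau w <= t%:E)%E])].

Definition is_excursion (e : cpath R) : Prop :=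
  e 0 = 0 /\ exists zeta, [/\ 0 < zeta,
    (forall t, 0 < t < zeta -> 0 < e t) &
    (forall t, zeta <= t -> e t = 0)].

Definition cvg_in_law (T : Type)
    (mu_ : T -> {measure set (cpath R) -> \bar R}) (F : set_system T)
    (mu : {measure set (cpath R) -> \bar R}) : Prop :=
  forall phi : cpath R -> R, continuous phi ->
    (exists C, forall w, `|phi w| <= C) ->
    \int[mu_ i]_w phi w @[i --> F] --> \int[mu]_w phi w.

End path_space.

Inductive boundary := Reflecting | Natural | EntranceNotExit.

Section diffusion.
Context {R : realType}.
Variables (b : \bar R) (k : boundary).
Local Notation leb := (@lebesgue_measure R).

Definition state_interior : set R := [set x | 0 < x /\ (x%:E < b)%E].

Definition state_space : set R :=
  [set x | 0 <= x /\ if k is Reflecting then (x%:E <= b)%E else (x%:E < b)%E].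

Section scale_speed.
(* S is the scale function and m the density of the speed measure; they are
   normalized by generator = d/dm d/dS (Brownian motion: S x = x, m x = 2).
   Densities are only required to be regular inside the interval, which allows
   for instance reflecting Bessel processes. *)
Variables (S m : R -> R).

Definition exit_integral (z : R) : \bar R :=
  (\int[leb]_(x in [set x | (z < x)%R /\ x%:E < b])
     ((\int[leb]_(y in `]z, x[) (m y)%:E) * (derive1 S x)%:E))%E.

Definition entrance_integral (z : R) : \bar R :=
  (\int[leb]_(x in [set x | (z < x)%R /\ x%:E < b]) ((S x - S z) * m x)%R%:E)%E.

Definition is_exit : Prop :=
  exists2 z, state_interior z & (exit_integral z < +oo)%E.

Definition is_entrance : Prop :=
  exists2 z, state_interior z & (entrance_integral z < +oo)%E.

Definition boundary_kind : Prop :=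
  match k with
  | Reflecting => is_exit /\ is_entrance
  | Natural => ~ is_exit /\ ~ is_entrance
  | EntranceNotExit => ~ is_exit /\ is_entrance
  end.

Record scale_and_speed : Prop := {
  ss_b_gt0 : (0 < b)%E;
  ss_b_fin : k = Reflecting -> (b < +oo)%E;
  ss_S_cont : {within state_space, continuous S};
  ss_S_derivable : forall x, state_interior x -> derivable S x 1;
  ss_dS_cont : forall x, state_interior x -> {for x, continuous (derive1 S)};
  ss_dS_gt0 : forall x, state_interior x -> 0 < derive1 S x;
  ss_m_cont : forall x, state_interior x -> {for x, continuous m};
  ss_m_gt0 : forall x, state_interior x -> 0 < m x;
  ss_mass : (\int[leb]_(x in state_interior) (m x)%:E < +oo)%E;
  ss_boundary : boundary_kind }.

(* x |-> m([0, x]) *)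
Definition speed_cdf (x : R) : R := \int[leb]_(y in `]0, x]) m y.

Definition deriv_wrt (G f : R -> R) (x : R) (F : set_system R) (a : R) : Prop :=
  (f y - f x) / (G y - G x) @[y --> F] --> a.

Definition bounded_continuous (f : R -> R) : Prop :=
  {within state_space, continuous f} /\
  exists C, forall x, state_space x -> `|f x| <= C.

(* g = d/dm d/dS f, with zero scale derivative at the reflecting end points. *)
Definition dm_dS (f g : R -> R) : Prop :=
  [/\ bounded_continuous f, bounded_continuous g &
    exists h : R -> R,
    [/\ (forall x, state_interior x -> deriv_wrt S f x x^' (h x)),
        (forall x, state_interior x -> deriv_wrt speed_cdf h x x^' (g x)),
        deriv_wrt S f 0 0^'+ 0 &
        (k = Reflecting -> deriv_wrt S f (fine b) (fine b)^'- 0)]].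

End scale_speed.

(* P x is the law on C(R_+, R) of the diffusion started at x; only the values
   P x with x in the state space are relevant. *)
Variable P : R.-pker (measurableTypeR R) ~> cpath R.

Definition semigroup (t : R) (f : R -> R) (x : R) : R :=
  \int[P x]_(w in [set w | state_space (w t)]) f (w t).

(* The infinitesimal generator on bounded continuous functions, in the sense of
   bounded pointwise convergence. *)
Definition generator (f g : R -> R) : Prop :=
  [/\ bounded_continuous f, bounded_continuous g,
    (forall x, state_space x ->
      (semigroup t f x - f x) / t @[t --> 0^'+] --> g x) &
    exists C, forall t x, 0 < t -> state_space x ->
      `|(semigroup t f x - f x) / t| <= C].

Definition strong_markov : Prop :=
  forall x, state_space x -> forall tau, stopping_time tau ->
  forall A, stopped_events tau A -> forall B : set (cpath R), measurable B ->
    P x (A `&` [set w | (tau w < +oo)%E /\ B (shift_path (fine (tau w)) w)]) =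
    (\int[P x]_(w in A `&` [set w | tau w < +oo]) P (w (fine (tau w))) B)%E.

Record recurrent_diffusion (S m : R -> R) : Prop := {
  diff_start : forall x, state_space x -> \forall w \ae P x, (w : cpath R) 0 = x;
  diff_state : forall x, state_space x ->
    \forall w \ae P x, forall t, 0 <= t -> state_space ((w : cpath R) t);
  diff_strong_markov : strong_markov;
  diff_generator : forall f g, generator f g <-> dm_dS S m f g;
  diff_recurrent : forall x y, state_space x -> state_space y ->
    P x [set w | (hitting_time y w < +oo)%E] = 1%E }.

(* Q l is the law of the diffusion started at x and conditioned to hit 0 for
   the first time at l: the regular conditional distribution given the hitting
   time of 0, in its version that is weakly continuous in l. *)
Definition conditioned_hitting (x : R)
    (Q : R.-pker (measurableTypeR R) ~> cpath R) : Prop :=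
  (forall (A : set (cpath R)) (B : set R), measurable A -> measurable B ->
    let H_B := [set w | exists2 l, B l & hitting_time 0 w = l%:E] in
    P x (A `&` H_B) = (\int[P x]_(w in H_B) Q (fine (hitting_time 0 w)) A)%E) /\
  (forall l : R, 0 < l -> cvg_in_law (fun l' : R => Q l') (nbhs l) (Q l)).

(* The law of the excursion bridge of length l from 0 to 0: stop_path l does not
   change a conditioned path before l, and makes it vanish after l. *)
Definition excursion_bridge_law (l : R) (mu : probability (cpath R) R) : Prop :=
  (exists Q : R -> R.-pker (measurableTypeR R) ~> cpath R,
    (forall x, state_interior x -> conditioned_hitting x (Q x)) /\
    cvg_in_law (fun x => stopped_law l (Q x l)) 0^'+ mu) /\
  (\forall w \ae mu, is_excursion w /\ forall t, l <= t -> (w : cpath R) t = 0).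

End diffusion.

Definition independent_RV d d1 d2 (T : measurableType d)
    (T1 : measurableType d1) (T2 : measurableType d2) (R : realType)
    (Pr : probability T R) (X : {RV Pr >-> T1}) (Y : {RV Pr >-> T2}) : Prop :=
  forall A B, measurable A -> measurable B ->
    Pr (X @^-1` A `&` Y @^-1` B) = (Pr (X @^-1` A) * Pr (Y @^-1` B))%E.

Definition uniformly_distributed d (T : measurableType d) (R : realType)
    (Pr : probability T R) (l : R) (l_gt0 : 0 < l) (Z : T -> R) : Prop :=
  measurable_fun setT Z /\
  forall A : set R, measurable A -> Pr (Z @^-1` A) = uniform_prob l_gt0 A.

(* Main.v *)
(* Let F(y) be the time an excursion e spends below the level y. If every level
   set of e is Lebesgue-null, then F(e_U) is uniform on (0, l) for uniform U, and
   the same applied to -e handles the time above. So all that is needed is that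
   almost every bridge has no ties, i.e. that {(u, v) : e_u = e_v} is null.
   Starting from an ordinary point y there are no ties, because the diffusion
   spends no time at a given point: apply Dynkin's formula to a function whose
   generator is a narrow bump minus a small multiple of a fixed one. This has to
   survive conditioning on a null event and a weak limit x -> 0, so it is made
   quantitative. A path from x < y which is above y at time u0 and dies near
   time l goes through y; by the strong Markov property and a Harnack inequality
   for the extinction time, conditioning on the latter costs only a constant
   which does not depend on x. Hence the law of the bridge gives to a continuous
   functional measuring approximate ties at most a constant times what P_y gives
   to it. The Harnack inequality follows by letting two independent copies meet,
   as two continuous paths cannot cross without meeting. *)

From HB Require Import structures.
Require Import Defs.
From mathcomp Require Import all_boot all_order all_algebra.
From mathcomp Require Import all_classical all_reals all_analysis.
From mathcomp Require Import measurable_realfun ring lra.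

Set Implicit Arguments.
Unset Strict Implicit.
Unset Printing Implicit Defensive.
Import Order.TTheory GRing.Theory Num.Theory.
Import numFieldNormedType.Exports.

Local Open Scope classical_set_scope.
Local Open Scope ring_scope.

(** * Path space and first passage times *)

(** The hypotheses speak of the generator and of the strong Markov property: neither transition
    densities nor a density of the extinction time are at hand. So conditioning on extinction at
    time [l] is treated as a ratio of probabilities of extinction in a window around [l], and the
    Harnack inequality compares extinction events for all Borel sets of times at once. Its constant
    must depend neither on the window, nor on the starting point, nor on the functional, because
    four limits are taken in a fixed order: the window shrinks to [l], the start tends to 0, the
    functional sharpens to exact ties, and the error threshold tends to 0. The first two are weak
    limits, hence the continuous relaxation of ties. The coupling needs two positivity facts,
    survival from below a level and quick extinction from above it. Both come from the generator
    applied to powers of a quadratic in the scale variable: a lower bound of the generator by a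
    multiple of the function becomes, by a Gronwall argument for the killed semigroup, a lower bound
    on probabilities. These functions vanish near 0 and do not see the last stretch down to 0; there
    recurrence takes over. *)

Section path_measurability.
Context {R : realType}.

(** Time is rounded down to the grid of mesh $1/(n+1)$. Preimages under each approximation are
    countable unions of rectangles, and continuity in time gives pointwise convergence. *)
Lemma measurable_caratheodory d (T : measurableType d) (f : R -> T -> R) :
  (forall t, measurable_fun setT (f t)) -> (forall x, continuous (f ^~ x)) ->
  measurable_fun setT (fun p : R * T => f p.1 p.2).
Proof.
move=> mf cf.
pose g n (p : R * T) := f ((Num.floor (n.+1%:R * p.1))%:~R / n.+1%:R) p.2.
apply: (@measurable_fun_cvg _ _ _ _ g) => [n|[t x] _ /=].
  move=> _ B mB; rewrite setTI.
  rewrite (_ : _ @^-1` B = \bigcup_(k : int)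
    ([set t : R | Num.floor (n.+1%:R * t) = k] `*` (f (k%:~R / n.+1%:R) @^-1` B))); last first.
    apply/seteqP; split => [[t x] /= gB|[t x] [k _ [/= tk]]]; last first.
      by rewrite /g /= tk.
    by exists (Num.floor (n.+1%:R * t)).
  apply: countable_bigcupT_measurable => [//|k]; apply: measurableX; last first.
    by rewrite -[X in measurable X]setTI; exact: mf.
  rewrite (_ : [set _ | _] = `[k%:~R / n.+1%:R, (k + 1)%:~R / n.+1%:R[%classic); first exact: measurable_itv.
  apply/seteqP; split => t /=; rewrite in_itv/=.
    move=> <-; rewrite ler_pdivrMr// ltr_pdivlMr// ![t * _]mulrC.
    by rewrite floor_le_tmp floorD1_gt.
  rewrite ler_pdivrMr// ltr_pdivlMr// ![t * _]mulrC => /andP[? ?].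
  by apply: Num.Theory.floor_def; apply/andP.
suff tt : (Num.floor (n.+1%:R * t))%:~R / n.+1%:R @[n --> \oo] --> t.
  exact: (continuous_cvg _ (cf x t) tt).
apply/cvgrPdist_le => e e0; near=> n.
have n0 : (0 : R) < n.+1%:R by [].
rewrite -[t in t - _](mulfK (lt0r_neq0 n0)) -mulrBl normrM normfV [`|_.+1%:R|]ger0_norm//.
rewrite ler_pdivrMr// (@le_trans _ _ 1)//.
  rewrite mulrC ger0_norm ?subr_ge0 ?floor_le_tmp// lerBlDl.
  by rewrite ltW// (lt_le_trans (floorD1_gt _))// intrD addrC.
rewrite -ler_pdivrMl// mulr1.
near: n; exists (Num.truncn e^-1) => // n /= en.
by rewrite ltW// (lt_le_trans (truncnS_gt _))// ler_nat.
Unshelve. all: by end_near. Qed.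

Lemma measurable_eval (t : R) : measurable_fun setT (fun w : cpath R => w t).
Proof.
have h s : 0 <= s -> measurable_fun setT (fun w : cpath R => w s).
  move=> s0 _ B mB; rewrite setTI; apply: sub_sigma_algebra.
  by exists s; [rewrite /= in_itv/= s0|exists B].
have [t0|t0] := leP 0 t; first exact: h.
rewrite (_ : (fun w => _) = (fun w : cpath R => w 0)); first exact: h.
by apply/funext => w; rewrite path_neg// ltW.
Qed.

Lemma measurable_fun_cpath d (T : measurableType d) (f : T -> cpath R) :
  (forall t, 0 <= t -> measurable_fun setT (fun x => f x t)) ->
  measurable_fun setT f.
Proof.
move=> mf; apply: (@measurability _ _ _ _ _ _ cylinders) => //.
move=> _ [_ [t t0 [B mB ->]] <-].
by apply: mf => //; move: t0; rewrite /= in_itv/= andbT.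
Qed.

Lemma measurable_eval2 : measurable_fun setT (fun p : R * cpath R => p.2 p.1).
Proof.
apply: (@measurable_caratheodory _ _ (fun t (w : cpath R) => w t)).
  exact: measurable_eval.
by move=> w; exact: path_cont.
Qed.

Lemma measurable_eval_comp d (T : measurableType d) (f : T -> R) (g : T -> cpath R) :
  measurable_fun setT f -> measurable_fun setT g ->
  measurable_fun setT (fun x => g x (f x)).
Proof.
move=> mf mg.
exact: (measurableT_comp measurable_eval2 (measurable_fun_pair mf mg)).
Qed.

Lemma measurable_shift_comp d (T : measurableType d) (f : T -> R) (g : T -> cpath R) :
  measurable_fun setT f -> measurable_fun setT g ->
  measurable_fun setT (fun x => shift_path (f x) (g x)).
Proof.
move=> mf mg; apply: measurable_fun_cpath => t t0 /=.
by apply: measurable_eval_comp => //; apply: measurable_funD.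
Qed.

Lemma measurable_shift_path (t : R) : measurable_fun setT (shift_path t : cpath R -> cpath R).
Proof. exact: measurable_shift_comp. Qed.

(** Stopping at [t] reads only coordinates in $[0,t]$, so it is measurable from the sigma-algebra of
    these coordinates to the whole path space. *)
Lemma natural_filtration_stop (t : R) (A : set (cpath R)) : 0 <= t ->
  measurable A -> natural_filtration t (stop_path t @^-1` A).
Proof.
move=> t0 mA.
pose T := g_sigma_algebraType (@coordinate_events R `[0, t]).
have : measurable_fun [set: T] (stop_path t : T -> cpath R).
  apply: (@measurability _ _ _ _ _ _ cylinders) => //.
  move=> _ [_ [s s0 [B mB ->]] <-]; rewrite setTI.
  apply: sub_sigma_algebra; exists (Num.min s t); last by exists B.
  move: s0; rewrite /= !in_itv/= andbT => s0.
  by rewrite le_min s0 t0 ge_min lexx orbT.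
by move=> /(_ measurableT _ mA); rewrite setTI.
Qed.

(** The sufficient half of Galmarini's test: an event that cannot distinguish a path from its
    stopped version is its own preimage under stopping. *)
Lemma natural_filtration_invariant (t : R) (A : set (cpath R)) : 0 <= t ->
  measurable A -> (forall w, A (stop_path t w) <-> A w) -> natural_filtration t A.
Proof.
move=> t0 mA Ainv; rewrite (_ : A = stop_path t @^-1` A).
  exact: natural_filtration_stop.
by apply/seteqP; split => w /=; rewrite Ainv.
Qed.

Lemma natural_filtrationS (s t : R) (A : set (cpath R)) : s <= t ->
  natural_filtration s A -> natural_filtration t A.
Proof.
move=> st; apply: sub_smallest2r.
  exact: smallest_sigma_algebra.
move=> _ [u us [B mB ->]].
exists u; last by exists B.
by move: us; rewrite /= !in_itv/= => /andP[-> /le_trans]; apply.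
Qed.

Lemma natural_filtration_measurable (t : R) (A : set (cpath R)) :
  natural_filtration t A -> measurable A.
Proof.
apply: sub_smallest2r; first exact: smallest_sigma_algebra.
move=> _ [u us [B mB ->]].
exists u; last by exists B.
by move: us; rewrite /= !in_itv/= => /andP[->].
Qed.

Lemma stop_pathE (t s : R) (w : cpath R) : s <= t -> stop_path t w s = w s.
Proof. by move=> st /=; rewrite min_l. Qed.

Lemma shift_pathE (t s : R) (w : cpath R) : 0 <= s -> shift_path t w s = w (t + s).
Proof. by move=> s0 /=; rewrite max_l. Qed.

End path_measurability.

Section first_zero.
Context {R : realType}.
Implicit Types psi : R -> R.

(** Zeros of a general function rather than visits to a point: this also covers the meeting time of
    two paths and the first visit to the pair $\{0,y\}$. *)
Definition first_zero psi : \bar R :=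
  ereal_inf [set t%:E | t in [set t | 0 <= t /\ psi t = 0]].

Lemma first_zero_ge0 psi : (0 <= first_zero psi)%E.
Proof. by apply: le_ereal_inf_tmp => _ [t [t0 _] <-]; rewrite lee_fin. Qed.

Lemma hitting_timeE y (w : cpath R) : hitting_time y w = first_zero (fun t => w t - y).
Proof.
rewrite /hitting_time /first_zero; congr (ereal_inf _); congr (image _ _).
by apply/seteqP; split => t /= [t0 /eqP h]; split => //; apply/eqP;
  rewrite ?subr_eq0// -subr_eq0.
Qed.

Lemma first_zeroP psi t : continuous psi ->
  (first_zero psi <= t%:E)%E <-> exists s, [/\ 0 <= s, s <= t & psi s = 0].
Proof.
move=> cpsi; split; last first.
  move=> [s [s0 st ps]]; apply: (@le_trans _ _ s%:E); last by rewrite lee_fin.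
  by apply: ereal_inf_lbound; exists s.
move=> le_t; apply: contrapT => noz.
have [t0|t0] := ltP t 0.
  have := le_trans (first_zero_ge0 psi) le_t.
  by rewrite lee_fin leNgt t0.
have pt : psi t != 0 by apply/eqP => pt; apply: noz; exists t.
have : \forall s \near t, 0 < `|psi s|.
  by apply: (cvgr_gt _ (cvg_norm (cpsi t))); rewrite normr_gt0.
move=> [e /= e0 he].
have : ((t + e)%:E <= first_zero psi)%E.
  apply: le_ereal_inf_tmp => _ [s [s0 ps] <-]; rewrite lee_fin leNgt.
  apply/negP => se; have [st|ts] := leP s t; first by apply: noz; exists s.
  have : 0 < `|psi s|.
    by apply: he => /=; rewrite ltr_distlC; apply/andP; split; lra.
  by rewrite ps normr0 ltxx.
by move=> /le_trans /(_ le_t); rewrite lee_fin; lra.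
Qed.

Lemma first_zero_finP psi t : continuous psi ->
  first_zero psi = t%:E <->
  [/\ 0 <= t, psi t = 0 & forall s, 0 <= s -> s < t -> psi s != 0].
Proof.
move=> cpsi; split.
  move=> zt; have t0 : 0 <= t by rewrite -lee_fin -zt first_zero_ge0.
  have [s [s0 st ps]] : exists s, [/\ 0 <= s, s <= t & psi s = 0].
    by apply/first_zeroP => //; rewrite zt.
  have zmin u : 0 <= u -> u < t -> psi u != 0.
    move=> u0 ut; apply/eqP => pu.
    have : (first_zero psi <= u%:E)%E by apply/first_zeroP => //; exists u.
    by rewrite zt lee_fin leNgt ut.
  split => //; move: st; rewrite le_eqVlt => /predU1P[<-//|/(zmin _ s0)].
  by rewrite ps eqxx.
move=> [t0 pt tmin]; apply/eqP; rewrite eq_le; apply/andP; split.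
  by apply/first_zeroP => //; exists t.
apply: le_ereal_inf_tmp => _ [s [s0 ps] <-]; rewrite lee_fin leNgt.
by apply/negP => /(tmin _ s0); rewrite ps eqxx.
Qed.

Lemma first_zero_gtP psi t : continuous psi ->
  (t%:E < first_zero psi)%E <-> forall s, 0 <= s -> s <= t -> psi s != 0.
Proof.
move=> cpsi; split.
  move=> tz s s0 st; apply/eqP => ps.
  have : (first_zero psi <= t%:E)%E by apply/first_zeroP => //; exists s.
  by rewrite leNgt tz.
move=> h; rewrite ltNge; apply/negP => /first_zeroP => /(_ cpsi)[s [s0 st]] /eqP.
by rewrite (negbTE (h _ s0 st)).
Qed.

Let clamp (t r : R) := Num.max 0 (Num.min r t).

(** On a compact interval a continuous function vanishes somewhere as soon as its absolute value has
    infimum 0, and rational times suffice for the infimum. This makes the event a countable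
    combination of events at fixed times. [clamp] sends every rational into $[0,t]$, so that end
    points and degenerate intervals need no separate case. *)
Lemma first_zero_le_dense psi t : continuous psi -> 0 <= t ->
  (first_zero psi <= t%:E)%E <->
  forall n : nat, exists q : rat, `|psi (clamp t (ratr q))| < n.+1%:R^-1.
Proof.
move=> cpsi t0.
have cc : continuous (clamp t).
  move=> r; apply: (@continuous_max _ _ (fun=> 0) (fun r => Num.min r t)).
    exact: cvg_cst.
  by apply: (@continuous_min _ _ id (fun=> t)); [exact: cvg_id|exact: cvg_cst].
have cpc : continuous (fun r => `|psi (clamp t r)|).
  move=> r; apply: continuous_comp; last exact: norm_continuous.
  by apply: continuous_comp; [exact: cc|exact: cpsi].
have c01 r : 0 <= clamp t r <= t by rewrite /clamp le_max lexx/= ge_max t0 ge_min lexx orbT.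
split.
  move=> /first_zeroP => /(_ cpsi)[s [s0 st ps]] n.
  have : \forall r \near s, `|psi (clamp t r)| < n.+1%:R^-1.
    have cs : clamp t s = s by rewrite /clamp min_l// max_r.
    have := cpc s; rewrite /continuous_at /= cs ps normr0 => cps.
    by apply: (cvgr_lt _ cps); rewrite invr_gt0.
  move=> /nbhs_ballP[e e0 he].
  have [q sq] := @rat_in_itvoo _ (s - e) (s + e) ltac:(move: e0 => /=; lra).
  exists q; apply: he; rewrite /ball/= ltr_distlC; move: sq; rewrite in_itv/=; lra.
move=> hn; apply/first_zeroP => //.
have [c c0t cmin] : exists2 c, c \in `[0, t] & forall s, s \in `[0, t] -> `|psi c| <= `|psi s|.
  apply: EVT_min => //; apply: continuous_subspaceT => r.
  by apply: continuous_comp; [exact: cpsi|exact: norm_continuous].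
exists c; move: c0t; rewrite in_itv/= => /andP[c0 ct]; split => //.
apply/eqP; rewrite -normr_le0 leNgt; apply/negP => pc.
have [n nc] : exists n : nat, n.+1%:R^-1 < `|psi c|.
  exists (Num.truncn `|psi c|^-1); rewrite invf_plt ?posrE//.
  by rewrite truncnS_gt.
have [q hq] := hn n.
have := cmin (clamp t (ratr q)); rewrite in_itv/= => /(_ (c01 _)).
by move=> /le_lt_trans /(_ (lt_trans hq nc)); rewrite ltxx.
Qed.

Lemma measurable_first_zero d (T : measurableType d) (psi : T -> R -> R) :
  (forall t, measurable_fun setT (psi ^~ t)) -> (forall x, continuous (psi x)) ->
  measurable_fun setT (fun x => first_zero (psi x)).
Proof.
move=> mpsi cpsi.
apply: (@measurability _ _ _ _ _ _ (@ErealGenOInfty.G R)).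
  exact: ErealGenOInfty.measurableE.
move=> _ [_ [t ->] <-]; rewrite setTI.
rewrite (_ : _ @^-1` _ = ~` [set x | (first_zero (psi x) <= t%:E)%E]); last first.
  by apply/seteqP; split => x /=; rewrite in_itv/= andbT ltNge => /negP.
apply: measurableC.
have [t0|t0] := leP 0 t; last first.
  rewrite (_ : [set _ | _] = set0)//; apply/seteqP; split => x //=.
  move=> /(le_trans (first_zero_ge0 _)); rewrite lee_fin; lra.
rewrite (_ : [set _ | _] = \bigcap_(n : nat) \bigcup_(q : rat)
  [set x | `|psi x (clamp t (ratr q))| < n.+1%:R^-1]); last first.
  apply/seteqP; split => x.
    move=> /(first_zero_le_dense (cpsi x) t0) h n _.
    by have [q hq] := h n; exists q.
  move=> h; apply/(first_zero_le_dense (cpsi x) t0) => n.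
  by have [q _ hq] := h n I; exists q.
apply: bigcapT_measurable => n; apply: countable_bigcupT_measurable => [//|q].
rewrite -[X in measurable X]setTI.
have : measurable_fun setT (fun x => `|psi x (clamp t (ratr q))|).
  by apply: measurableT_comp => //; exact: mpsi.
move=> /(_ measurableT `]-oo, n.+1%:R^-1[%classic (measurable_itv _)).
by congr measurable; congr (_ `&` _); apply/seteqP; split => x /=; rewrite in_itv.
Qed.

End first_zero.

(** * Integrals against mixtures of measures *)

Section mixture.
Context d1 d2 (X : measurableType d1) (Y : measurableType d2) (R : realType).
Variables (mu : {measure set X -> \bar R}) (A : set X).
Variable K : X -> {measure set Y -> \bar R}.
Hypothesis mA : measurable A.
Hypothesis mK : forall U, measurable U -> measurable_fun setT (K ^~ U).
Local Open Scope ereal_scope.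

Definition mixture (U : set Y) : \bar R := \int[mu]_(x in A) K x U.

Let mixture0 : mixture set0 = 0.
Proof. by rewrite /mixture integral0_eq. Qed.

Let mixture_ge0 U : 0 <= mixture U.
Proof. exact: integral_ge0. Qed.

Let mixture_additive : semi_sigma_additive mixture.
Proof.
move=> U mU tU mUU; rewrite [X in _ --> X](_ : _ =
  \int[mu]_(x in A) (\sum_(n <oo) K x (U n))); last first.
  apply: eq_integral => x _.
  by apply/esym/cvg_lim => //; exact/measure_semi_sigma_additive.
apply/cvg_closeP; split.
  by apply: is_cvg_nneseries => n _ _; exact: mixture_ge0.
rewrite closeE// integral_nneseries// => n.
by apply: measurable_funTS; exact: mK.
Qed.

HB.instance Definition _ := isMeasure.Build _ _ _ mixture
  mixture0 mixture_ge0 mixture_additive.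

Definition mixture_measure : {measure set Y -> \bar R} := mixture.

Variable nu : {measure set Y -> \bar R}.
Hypothesis nuE : forall U, measurable U -> nu U = mixture U.

Import HBNNSimple.

Let integral_mixture_nnsfun (h : {nnsfun Y >-> R}) :
  \int[nu]_y (h y)%:E = \int[mu]_(x in A) \int[K x]_y (h y)%:E.
Proof.
rewrite integralT_nnsfun sintegralE.
under [in RHS]eq_integral do rewrite integralT_nnsfun sintegralE.
rewrite ge0_integral_fsum//; last 2 first.
- move=> r; apply: measurable_funTS; apply: measurable_funeM.
  exact: mK.
- by move=> r x _; exact: nnsfun_mulemu_ge0.
apply: eq_fsbigr => r /[!inE] -[y _ <-].
rewrite nuE// /mixture ge0_integralZl//; first by apply: measurable_funTS; exact: mK.
by rewrite lee_fin.
Qed.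

(** True for simple functions by definition of the mixture, then monotone convergence is applied
    under [K x] and under [mu]. [nu] is any measure with the values of the mixture, so that an
    identification obtained on a pi-system can be used. *)
Lemma integral_mixture (f : Y -> \bar R) : measurable_fun setT f ->
  (forall y, 0 <= f y) ->
  \int[nu]_y f y = \int[mu]_(x in A) \int[K x]_y f y.
Proof.
move=> mf f0; pose f_ := nnsfun_approx measurableT mf.
have fE (m : {measure set Y -> \bar R}) :
    \int[m]_y f y = limn (fun n => \int[m]_y (f_ n y)%:E).
  transitivity (\int[m]_z (lim ((f_ n z)%:E @[n --> \oo]))).
    by apply/eq_integral => z _; apply/esym/cvg_lim => //=; exact: cvg_nnsfun_approx.
  rewrite monotone_convergence//.
  - by move=> n; exact/measurable_EFinP.
  - by move=> n z _; rewrite lee_fin.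
  - by move=> z _ a b ab; rewrite lee_fin; exact/lefP/nd_nnsfun_approx.
have le_int (m : {measure set Y -> \bar R}) a b : (a <= b)%N ->
    \int[m]_y (f_ a y)%:E <= \int[m]_y (f_ b y)%:E.
  move=> ab; apply: ge0_le_integral => //.
  - by move=> y _; rewrite lee_fin.
  - exact/measurable_EFinP.
  - exact/measurable_EFinP.
  - by move=> y _; rewrite lee_fin; exact/lefP/nd_nnsfun_approx.
rewrite fE; under [RHS]eq_integral do rewrite fE.
rewrite monotone_convergence//.
- by congr (limn _); apply/funext => n; exact: integral_mixture_nnsfun.
- move=> n; apply: measurable_funTS; apply: measurable_fun_integral_kernel => //.
    by move=> y; rewrite lee_fin.
  exact/measurable_EFinP.
- by move=> n x _; apply: integral_ge0 => y _; rewrite lee_fin.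
- by move=> x _ a b ab; exact: le_int.
Qed.

End mixture.

Definition push_measure d1 d2 (X : measurableType d1) (Y : measurableType d2)
    (R : realType) (mu : {measure set X -> \bar R}) (f : X -> Y)
    (mf : measurable_fun setT f) : {measure set Y -> \bar R}.
Proof. by refine (pushforward mu f : {measure set _ -> \bar R}). Defined.

Section comp_kernel.
Context d d' d'' (X : measurableType d) (X' : measurableType d')
  (Y : measurableType d'') (R : realType).
Variables (k : R.-pker X' ~> Y) (f : X -> X') (mf : measurable_fun setT f).

Definition comp_kernel of measurable_fun setT f : X -> {measure set Y -> \bar R} :=
  fun x => k (f x).
Local Notation kf := (comp_kernel mf).

Let measurable_comp_kernel U : measurable U -> measurable_fun setT (kf ^~ U).
Proof. by move=> mU; exact: (measurableT_comp (measurable_kernel k U mU) mf). Qed.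

HB.instance Definition _ := isKernel.Build _ _ _ _ _ kf measurable_comp_kernel.

Let comp_kernel_setT x : kf x setT = 1%E.
Proof. exact: prob_kernel. Qed.

HB.instance Definition _ := Kernel_isProbability.Build _ _ _ _ _ kf comp_kernel_setT.

(** Used for events about a restarted path whose start is random and which also depend on the past,
    through the elapsed time or through a frozen second path. *)
Lemma measurable_comp_kernel_section (D : set (X * Y)) : measurable D ->
  measurable_fun setT (fun x => k (f x) [set y | D (x, y)]).
Proof.
move=> mD.
have := @measurable_fun_xsection_finite_kernel _ _ _ _ _ kf D.
rewrite inE => /(_ mD); congr (measurable_fun _ _).
apply/funext => x; congr (k (f x) _).
by apply/seteqP; split => y; rewrite /xsection/= inE.
Qed.

End comp_kernel.

(** * Random times decided by the stopped path *)

Section proper_time.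
Context {R : realType}.
Implicit Types T : cpath R -> \bar R.

(* The last field says that [T] can be decided by time [t] from the path
   stopped at [t] (Galmarini's test). *)
Record proper_time T : Prop := {
  proper_ge0 : forall w, (0 <= T w)%E;
  proper_measurable : measurable_fun setT T;
  proper_stop : forall t w u, 0 <= t -> u <= t ->
    (T (stop_path t w) <= u%:E)%E <-> (T w <= u%:E)%E }.

Lemma proper_time_stop T t w : proper_time T -> 0 <= t -> (T w <= t%:E)%E ->
  T (stop_path t w) = T w.
Proof.
move=> pT t0 Twt.
have : (T (stop_path t w) <= t%:E)%E by apply/(proper_stop pT).
have := proper_stop pT w t0; have := proper_ge0 pT w.
have := proper_ge0 pT (stop_path t w).
move: Twt; case: (T w) => [r| |]//; case: (T _) => [r'| |]//.
rewrite !lee_fin => rt r'0 r0 h r't; congr EFin; apply/eqP; rewrite eq_le.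
have := h _ rt; have := h _ r't; rewrite !lee_fin => h1 h2.
by rewrite h2.2 ?h1.1.
Qed.

Lemma measurable_fine_time T : measurable_fun setT T ->
  measurable_fun setT (fun w => fine (T w)).
Proof. by move=> mT; apply: measurableT_comp => //; exact: measurable_fine. Qed.

Lemma measurable_time_le T c : measurable_fun setT T ->
  measurable [set w | (T w <= c)%E].
Proof.
move=> mT; rewrite -[X in measurable X]setTI.
have := mT measurableT [set` `]-oo, c]] (emeasurable_itv _).
by congr (measurable (_ `&` _)); apply/seteqP; split => w /=; rewrite in_itv.
Qed.

Lemma measurable_time_lt T c : measurable_fun setT T ->
  measurable [set w | (T w < c)%E].
Proof.
move=> mT; rewrite -[X in measurable X]setTI.
have := mT measurableT [set` `]-oo, c[] (emeasurable_itv _).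
by congr (measurable (_ `&` _)); apply/seteqP; split => w /=; rewrite in_itv.
Qed.

Lemma measurable_time_gt T c : measurable_fun setT T ->
  measurable [set w | (c < T w)%E].
Proof.
move=> mT; rewrite (_ : [set _ | _] = ~` [set w | (T w <= c)%E]).
  by apply: measurableC; exact: measurable_time_le.
by apply/seteqP; split => w /=; rewrite ltNge => /negP.
Qed.

Lemma proper_stopping_time T : proper_time T -> stopping_time T.
Proof.
move=> pT; split; first exact: proper_ge0.
move=> t t0; apply: natural_filtration_invariant => //.
  by apply: measurable_time_le; exact: proper_measurable.
by move=> w /=; apply: proper_stop.
Qed.

Lemma stopped_eventsI T A B : stopped_events T A -> stopped_events T B ->
  stopped_events T (A `&` B).
Proof.
move=> [mA hA] [mB hB]; split; first exact: measurableI.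
move=> t t0; rewrite setIIl.
have : @measurable _ (g_sigma_algebraType (@coordinate_events R `[0, t]))
    ((A `&` [set w | (T w <= t%:E)%E]) `&` (B `&` [set w | (T w <= t%:E)%E])).
  by apply: measurableI; [exact: hA|exact: hB].
by [].
Qed.

Lemma stopped_events_time T (I : set R) : proper_time T -> measurable I ->
  stopped_events T [set w | (T w < +oo)%E /\ I (fine (T w))].
Proof.
move=> pT mI; have mA : measurable [set w | (T w < +oo)%E /\ I (fine (T w))].
  apply: measurableI; first by apply: measurable_time_lt; exact: proper_measurable.
  rewrite -[X in measurable X]setTI.
  by apply: measurable_fine_time => //; exact: proper_measurable.
split => // t t0; apply: natural_filtration_invariant => //.
  by apply: measurableI => //; apply: measurable_time_le; exact: proper_measurable.
move=> w; split => /= -[[h1 h2] /[dup] h3].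
  by move=> /(proper_stop pT _ t0 (lexx _)) h4; move: h1 h2; rewrite (proper_time_stop pT).
by move=> h4; rewrite (proper_time_stop pT).
Qed.

Lemma proper_cst (t : R) : 0 <= t -> proper_time (fun=> t%:E).
Proof. by move=> t0; split => //; exact: measurable_cst. Qed.

Lemma stopped_events_cst (t : R) A : 0 <= t ->
  natural_filtration t A -> stopped_events (fun=> t%:E) A.
Proof.
move=> t0 FA; split; first exact: natural_filtration_measurable FA.
move=> s s0; have [ts|st] := leP t s.
  rewrite (_ : [set _ | _] = setT) ?setIT; first exact: natural_filtrationS FA.
  by apply/seteqP; split => w //= _; rewrite lee_fin.
rewrite (_ : [set _ | _] = set0) ?setI0; last first.
  by apply/seteqP; split => w //=; rewrite lee_fin leNgt st.
by apply: natural_filtration_invariant.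
Qed.

(** [phi] may depend on time so that a second path, held fixed, can enter the condition. *)
Lemma proper_first_zero (phi : R -> R -> R) :
  (forall t, measurable_fun setT (phi t)) ->
  (forall w : cpath R, continuous (fun t => phi t (w t))) ->
  proper_time (fun w : cpath R => first_zero (fun t => phi t (w t))).
Proof.
move=> mphi cphi; split; first by move=> w; exact: first_zero_ge0.
  apply: measurable_first_zero => // t.
  by apply: measurableT_comp => //; exact: measurable_eval.
move=> t w u t0 ut.
split => /first_zeroP => /(_ (cphi _))[s [s0 su hs]]; apply/first_zeroP => //; exists s; split => //.
  by move: hs; rewrite stop_pathE// (le_trans su).
by rewrite stop_pathE// (le_trans su).
Qed.

Lemma proper_hitting_time (y : R) : proper_time (@hitting_time R y).
Proof.
rewrite (_ : hitting_time y = fun w => first_zero (fun t => (fun _ x => x - y) t (w t))).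
  apply: (@proper_first_zero (fun _ x => x - y)) => [t|w t].
    by apply: measurable_funB.
  by apply: cvgB; [exact: path_cont|exact: cvg_cst].
by apply/funext => w; rewrite hitting_timeE.
Qed.

End proper_time.

(** * One-sided derivatives and bumps *)

Section real_calculus.
Context {R : realType}.
Implicit Types (f : R -> R) (x a : R).

Lemma is_derive_quotient f x a : is_derive x 1 f a ->
  (f y - f x) / (y - x) @[y --> x^'] --> a.
Proof.
move=> [df <-]; have {}df : h^-1 * (f (h + x) - f x) @[h --> 0^'] --> 'D_1 f x.
  rewrite (_ : (fun h => _) = (fun h => h^-1 *: ((f \o shift x) (h *: 1) - f x))) //.
  by apply/funext => h /=; rewrite [h%:A]mulr1.
apply/cvgrPdist_lt => e e0; move/cvgrPdist_lt : df => /(_ e e0).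
rewrite !near_withinE !near_simpl => /nbhs_ballP[r /= r0 hr].
apply/nbhs_ballP; exists r => //= y; rewrite /ball/= => xy yx.
have := hr (y - x); rewrite /ball/= sub0r normrN distrC subrK => /(_ xy).
by rewrite subr_eq0 yx mulrC; apply.
Qed.

Lemma cvg_addr_harmonic x : x + n.+1%:R^-1 @[n --> \oo] --> x.
Proof.
rewrite -[X in _ --> X]addr0; apply: cvgD; first exact: cvg_cst.
exact: cvg_harmonic.
Qed.

(** Right derivatives are taken along the sequence $1/(n+1)$: this is the form in which dominated
    convergence delivers them for expectations. *)
Lemma is_derive_right_quotient f x a : is_derive x 1 f a ->
  (f (x + n.+1%:R^-1) - f x) / n.+1%:R^-1 @[n --> \oo] --> a.
Proof.
move=> df; have cn : x + n.+1%:R^-1 @[n --> \oo] --> x^'.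
  move=> A hA; have {}hA : \forall y \near x, y != x -> A y by exact: hA.
  have : \forall n \near \oo, x + n.+1%:R^-1 != x -> A (x + n.+1%:R^-1).
    by exact: cvg_addr_harmonic hA.
  apply: filterS => n; apply.
  by rewrite -subr_eq0 addrAC subrr add0r invr_eq0.
have h := cvg_comp _ _ cn (is_derive_quotient df).
rewrite (_ : (fun n : nat => _) = (fun y => (f y - f x) / (y - x)) \o (fun n : nat => x + n.+1%:R^-1)).
  exact: h.
by apply/funext => n /=; rewrite [x + _ - x]addrAC subrr add0r.
Qed.

Lemma is_derive_max0X x n :
  is_derive x (1 : R) (fun y : R => Num.max y 0 ^+ n.+2) (n.+2%:R * Num.max x 0 ^+ n.+1).
Proof.
have [x0|x0|->] := ltgtP x 0.
- rewrite expr0n/= mulr0.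
  have e : \forall y \near x, (fun=> 0) y = Num.max y 0 ^+ n.+2.
    near=> y; rewrite max_r ?expr0n//= ltW//; near: y; exact: lt_nbhsl.
  apply: DeriveDef; first by apply: near_eq_derivable e _; exact: derivable_cst.
  by rewrite -(near_eq_derive _ e) derive_cst.
- have e : \forall y \near x, (id ^+ n.+2 : R -> R) y = Num.max y 0 ^+ n.+2.
    near=> y; rewrite exprfctE max_l// ltW//; near: y; exact: lt_nbhsr.
  have := is_deriveX n.+2 (is_derive_id x (1 : R)) => -[d dE].
  apply: DeriveDef; first exact: near_eq_derivable e d.
  by rewrite -(near_eq_derive _ e) [LHS]dE /= [LHS]mulr1.
(* At the kink the quotient is at most $|h|^{n+1}$, which tends to 0. *)
- have h : (h^-1 *: (Num.max (h *: (1 : R) + 0) 0 ^+ n.+2 - Num.max 0 0 ^+ n.+2 : R) : R) @[h --> (0 : R)^'] --> (0 : R).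
    apply/cvgrPdist_le => e e0; rewrite near_withinE; near=> h => h0.
    rewrite [_ *: 1]mulr1 addr0 maxxx expr0n/= subr0 sub0r normrN normrM normfV.
    rewrite ler_pdivrMl ?normr_gt0// exprS normrM.
    have hh : `|Num.max h 0| <= `|h|.
      by rewrite ger0_norm ?le_max ?lexx ?orbT// ge_max normr_ge0 ler_norm.
    rewrite (@le_trans _ _ (`|h| * `|Num.max h 0 ^+ n.+1|)) ?ler_wpM2r// ler_wpM2l//.
    have h1 : `|h| <= Num.min 1 e.
      near: h; apply/nbhs_ballP; exists (Num.min 1 e) => /=; first by rewrite lt_min ltr01.
      by move=> y; rewrite /ball/= sub0r normrN => /ltW.
    rewrite normrX exprS -[e]mulr1 ler_pM ?exprn_ge0//.
      by rewrite (le_trans hh)// (le_trans h1)// ge_min lexx orbT.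
    by rewrite exprn_ile1// (le_trans hh)// (le_trans h1)// ge_min lexx.
  rewrite expr0n/= mulr0; apply: DeriveDef; first by apply/cvg_ex; exists 0.
  by apply/cvg_lim => //; exact: Rhausdorff.
Unshelve. all: by end_near. Qed.

(* Of class C^2 and supported by [[al, be]]. *)
Definition bump (al be : R) n (s : R) : R :=
  Num.max ((s - al) * (be - s)) 0 ^+ n.+3.

Definition bump1 (al be : R) n (s : R) : R :=
  n.+3%:R * Num.max ((s - al) * (be - s)) 0 ^+ n.+2 * (al + be - 2 * s).

Definition bump2 (al be : R) n (s : R) : R :=
  n.+3%:R * (n.+2%:R * Num.max ((s - al) * (be - s)) 0 ^+ n.+1 * (al + be - 2 * s) ^+ 2
    - 2 * Num.max ((s - al) * (be - s)) 0 ^+ n.+2).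

Let is_derive_quad (al be s : R) :
  is_derive s (1 : R) (fun s => (s - al) * (be - s)) (al + be - 2 * s).
Proof.
have h1 := is_deriveB (is_derive_id s (1 : R)) (is_derive_cst al s (1 : R)).
have h2 := is_deriveB (is_derive_cst be s (1 : R)) (is_derive_id s (1 : R)).
apply: (is_derive_eq (is_deriveM h1 h2)).
rewrite !fctE /cst /GRing.scale /=; ring.
Qed.

Lemma is_derive_bump (al be s : R) n : is_derive s 1 (bump al be n) (bump1 al be n s).
Proof.
have h1 := is_derive_max0X ((s - al) * (be - s)) n.+1.
exact: (@is_derive1_comp _ _ (fun s => (s - al) * (be - s)) _ _ _ h1 (is_derive_quad al be s)).
Qed.

Lemma is_derive_bump1 (al be s : R) n : is_derive s 1 (bump1 al be n) (bump2 al be n s).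
Proof.
have h1 := is_derive_max0X ((s - al) * (be - s)) n.
have h2 := @is_derive1_comp _ _ (fun s => (s - al) * (be - s)) _ _ _ h1 (is_derive_quad al be s).
have h3 := is_deriveM (is_derive_cst (n.+3%:R : R) s (1 : R)) h2.
have h4 := is_deriveB (is_derive_cst (al + be) s (1 : R))
  (is_deriveM (is_derive_cst (2 : R) s (1 : R)) (is_derive_id s (1 : R))).
apply: (is_derive_eq (is_deriveM h3 h4)).
rewrite /bump2 !fctE /cst /GRing.scale /=; ring.
Qed.

(** After adding a small slope [r], the maximum over $[0,eps]$ cannot be attained at some $c<eps$:
    the right quotients at [c] exceed [- r] eventually, so the function takes larger values just
    after [c]. Hence the maximum is at [eps], and [r] is let to 0. *)
Lemma right_derivative_nondecreasing (phi D : R -> R) eps : 0 <= eps ->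
  {within `[0, eps], continuous phi} ->
  (forall t, 0 <= t -> t < eps -> 0 <= D t /\
    (phi (t + n.+1%:R^-1) - phi t) / n.+1%:R^-1 @[n --> \oo] --> D t) ->
  phi 0 <= phi eps.
Proof.
move=> eps0 cphi hD; apply/ler_addgt0Pr => e e0.
have e1 : 0 < e / (eps + 1) by rewrite divr_gt0// ltr_wpDl.
suff : phi 0 <= phi eps + e / (eps + 1) * eps.
  move=> h; apply: (le_trans h); rewrite lerD2l -mulrA -[X in _ <= X]mulr1.
  by rewrite ler_wpM2l ?(ltW e0)// mulrC ler_pdivrMr ?ltr_wpDl// mul1r lerDl.
set r := e / (eps + 1) in e1 *.
pose psi t := phi t + r * t.
have cpsi : {within `[0, eps], continuous psi}.
  apply/subspace_continuousP => x xi.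
  apply: (@cvgD _ _ _ _ _ phi (fun t => r * t)).
    exact: (iffLR (subspace_continuousP _ _) cphi x xi).
  by apply: cvg_within_filter; apply: cvgM; [exact: cvg_cst|exact: cvg_id].
have [c c0e cmax] := EVT_max eps0 cpsi.
suff ce : c = eps.
  have := cmax 0; rewrite in_itv/= lexx eps0 /psi mulr0 addr0 -ce => h.
  exact: h.
move: c0e; rewrite in_itv/= => /andP[c0]; rewrite le_eqVlt => /predU1P[//|ce].
have [D0 cD] := hD c c0 ce.
have : \forall n \near \oo, - r < (phi (c + n.+1%:R^-1) - phi c) / n.+1%:R^-1.
  by apply: (cvgr_gt _ cD); rewrite (lt_le_trans _ D0)// oppr_lt0.
have : \forall n \near \oo, (n.+1%:R^-1 : R) < eps - c.
  have h : 0 < eps - c by rewrite subr_gt0.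
  exact: (cvgr_lt _ cvg_harmonic).
move=> h1 h2; have [n [h3 h4]] := filter_ex (filterI h1 h2).
have n0 : (0 : R) < n.+1%:R^-1 by rewrite invr_gt0.
have ci : c + n.+1%:R^-1 \in `[0, eps].
  by rewrite in_itv/= addr_ge0 ?(ltW n0)//= -lerBrDl ltW.
have := cmax _ ci.
rewrite /psi mulrDr leNgt => /negP[]; move: h4; rewrite ltr_pdivlMr// mulNr.
rewrite -subr_gt0 => h; rewrite -subr_gt0; apply: (lt_le_trans h).
by rewrite le_eqVlt; apply/orP; left; apply/eqP; ring.
Qed.

(** Gronwall's inequality for right derivatives: [v] times $e^{-lam\,t}$ has a nonnegative right
    derivative. The Lipschitz bound supplies the continuity. *)
Lemma right_derivative_growth (v D : R -> R) (L lam eps : R) : 0 <= eps ->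
  (forall s t, 0 <= s -> s <= t -> `|v t - v s| <= L * (t - s)) ->
  (forall t, 0 <= t -> t < eps -> lam * v t <= D t /\
    (v (t + n.+1%:R^-1) - v t) / n.+1%:R^-1 @[n --> \oo] --> D t) ->
  v 0 * expR (lam * eps) <= v eps.
Proof.
move=> eps0 Lv hD.
pose ex (t : R) : R := expR (- lam * t).
have dex (t : R) : is_derive t (1 : R) ex (- lam * ex t).
  have h1 := is_deriveM (is_derive_cst (- lam : R) t (1 : R)) (is_derive_id t (1 : R)).
  have h2 := @is_derive1_comp _ expR (fun t => - lam * t) t _ _ (is_derive_expR _) h1.
  apply: (is_derive_eq h2); rewrite /ex !fctE /cst /GRing.scale/=; ring.
have cex (t : R) : {for t, continuous ex}.
  by apply: differentiable_continuous; apply/derivable1_diffP; case: (dex t).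
have cv : {within `[0, eps], continuous v}.
  apply/subspace_continuousP => x; rewrite /= in_itv/= => /andP[x0 xe].
  apply/cvgrPdist_lt => e e0; have L1 : 0 < `|L| + 1 by rewrite ltr_wpDl.
  rewrite near_withinE; near=> y => /=; rewrite in_itv/= => /andP[y0 ye].
  have h : `|v x - v y| <= `|L| * `|x - y|.
    have [xy|yx] := leP x y.
      rewrite distrC (le_trans (Lv _ _ x0 xy))// (le_trans (ler_norm _))//.
      by rewrite normrM [X in _ <= _ * X]distrC.
    by rewrite (le_trans (Lv _ _ y0 (ltW yx)))// (le_trans (ler_norm _))// normrM.
  apply: (le_lt_trans h); rewrite (@le_lt_trans _ _ ((`|L| + 1) * `|x - y|))//.
    by rewrite ler_wpM2r// lerDl.
  rewrite -ltr_pdivlMl// mulrC; near: y; apply: nbhsx_ballx; exact: divr_gt0.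
have : v 0 * ex 0 <= v eps * ex eps.
  apply: (@right_derivative_nondecreasing (fun t => v t * ex t)
    (fun t => ex t * (D t - lam * v t))) => //.
    apply/subspace_continuousP => x xi; apply: (@cvgM _ _ _ _ v ex).
      exact: (iffLR (subspace_continuousP _ _) cv x xi).
    by apply: cvg_within_filter; exact: cex.
  move=> t t0 te; have [h1 h2] := hD _ t0 te; split.
    by rewrite mulr_ge0 ?expR_ge0// subr_ge0.
  have c1 : ex (t + n.+1%:R^-1) @[n --> \oo] --> ex t.
    by apply: continuous_cvg; [exact: cex|exact: cvg_addr_harmonic].
  have c2 := is_derive_right_quotient (dex t).
  rewrite (_ : (fun n => _) = (fun n => ex (t + n.+1%:R^-1) * ((v (t + n.+1%:R^-1) - v t) / n.+1%:R^-1)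
    + v t * ((ex (t + n.+1%:R^-1) - ex t) / n.+1%:R^-1))); last by apply/funext => n; ring.
  rewrite (_ : ex t * _ = ex t * D t + v t * (- lam * ex t)); last by ring.
  apply: cvgD; first exact: cvgM.
  by apply: cvgM => //; exact: cvg_cst.
rewrite /ex mulr0 expR0 mulr1 mulNr expRN => h.
by rewrite -ler_pdivlMr ?expR_gt0.
Unshelve. all: by end_near. Qed.

End real_calculus.

Section bump_bounds.
Context {R : realType}.
Implicit Types al be s : R.

(** With $q=(s-al)(be-s)$ and $L=(be-al)^2$ one has $(al+be-2s)^2=L-4q$, so where $q>0$ the
    difference of the two sides is $6q/L$ times $L^2-5Lq+25q^2$, a form of negative discriminant.
    The constant is $150=6\cdot25$. *)
Lemma bump2_ge al be s : al < be -> - (150 / (be - al) ^+ 2) * bump al be 0 s <= bump2 al be 0 s.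
Proof.
move=> ab; have L0 : be - al != 0 by rewrite subr_eq0 gt_eqF.
rewrite /bump /bump2; have [q0|q0] := leP ((s - al) * (be - s)) 0.
  by rewrite !expr0n/= !mulr0 ?mul0r ?mulr0 ?subr0 ?mulr0.
set q := (s - al) * (be - s) in q0 *.
rewrite -subr_ge0 (_ : _ - _ = 6 * q / (be - al) ^+ 2 *
  (((be - al) ^+ 2 - q *+ 2) ^+ 2 + 21 * q ^+ 2 - q * (be - al) ^+ 2)); last first.
  by rewrite /q; field.
apply: mulr_ge0; first by rewrite divr_ge0 ?sqr_ge0// mulr_ge0// ltW.
by move: ((be - al) ^+ 2) => L; nra.
Qed.

Lemma quad_le al be s : (s - al) * (be - s) <= (be - al) ^+ 2 / 4.
Proof. by have := sqr_ge0 (al + be - 2 * s); nra. Qed.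

Lemma bump_le al be n s : bump al be n s <= ((be - al) ^+ 2 / 4) ^+ n.+3.
Proof.
rewrite /bump ler_pXn2r ?nnegrE ?le_max ?lexx ?orbT ?divr_ge0 ?sqr_ge0//.
by rewrite ge_max quad_le divr_ge0 ?sqr_ge0.
Qed.

(** Beyond the midpoint by [eta], the squared slope of the quadratic is at least $4\,eta^2$. For
    large [n] half of the term it produces absorbs the negative term of [bump2], and the other half
    gives a growth rate of order $n^2$. *)
Lemma bump2_growth al be n s eta : al < s -> s < be -> 0 < eta ->
  eta <= s - (al + be) / 2 -> (be - al) ^+ 2 / 4 <= eta ^+ 2 * n.+2%:R ->
  n.+3%:R * n.+2%:R * (2 * eta ^+ 2 / ((be - al) ^+ 2 / 4) ^+ 2) * bump al be n s <= bump2 al be n s.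
Proof.
move=> als sbe eta0 etas hn; rewrite /bump /bump2.
set q := (s - al) * (be - s); set Q := (be - al) ^+ 2 / 4 in hn *.
have q0 : 0 < q by rewrite mulr_gt0// subr_gt0.
have qQ : q <= Q by exact: quad_le.
have Q0 : 0 < Q by exact: lt_le_trans qQ.
rewrite max_l ?(ltW q0)//.
have d2 : 4 * eta ^+ 2 <= (al + be - 2 * s) ^+ 2.
  have h : 0 <= s - (al + be) / 2 - eta by lra.
  have h' : 0 <= s - (al + be) / 2 + eta by lra.
  by have := mulr_ge0 h h'; nra.
rewrite (_ : _ * q ^+ n.+3 = n.+3%:R * q ^+ n.+1 * (n.+2%:R * (2 * eta ^+ 2) * (q / Q) ^+ 2)); last first.
  by rewrite !exprSr; field; rewrite gt_eqF.
rewrite (_ : n.+3%:R * (_ - _) = n.+3%:R * q ^+ n.+1 * (n.+2%:R * (al + be - 2 * s) ^+ 2 - 2 * q)); last first.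
  by rewrite !exprSr; ring.
apply: ler_wpM2l; first by rewrite mulr_ge0// exprn_ge0// ltW.
have h1 : (q / Q) ^+ 2 <= 1.
  by apply: exprn_ile1; [rewrite divr_ge0// ltW|rewrite ler_pdivrMr// mul1r].
have N0 : (0 : R) <= n.+2%:R by [].
have h2 : n.+2%:R * (2 * eta ^+ 2) * (q / Q) ^+ 2 <= n.+2%:R * (2 * eta ^+ 2).
  by rewrite ler_piMr// mulr_ge0// mulr_ge0// sqr_ge0.
apply: (le_trans h2).
have h3 := ler_wpM2l N0 d2.
move: hn qQ h3; move: (n.+2%:R) (eta ^+ 2) (_ ^+ 2) => N e D hn qQ h3; nra.
Qed.

End bump_bounds.

Section measurable_comparison.
Context d (T : measurableType d) (R : realType) (f g : T -> R).
Hypotheses (mf : measurable_fun setT f) (mg : measurable_fun setT g).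

Lemma measurable_lt_set : measurable [set x | f x < g x].
Proof.
by have := @measurable_fun_ltr _ _ _ _ _ _ mf mg measurableT [set true] Logic.I; rewrite setTI.
Qed.

Lemma measurable_le_set : measurable [set x | f x <= g x].
Proof.
by have := @measurable_fun_ler _ _ _ _ _ _ mf mg measurableT [set true] Logic.I; rewrite setTI.
Qed.

Lemma measurable_eq_set : measurable [set x | f x = g x].
Proof.
have := @measurable_fun_eqr _ _ _ _ _ _ mf mg measurableT [set true] Logic.I.
by rewrite setTI; congr (measurable _); apply/seteqP; split => x /eqP.
Qed.

End measurable_comparison.

Lemma measurable_ltoo_set d (T : measurableType d) (R : realType) (f : T -> \bar R) :
  measurable_fun setT f -> measurable [set x | (f x < +oo)%E].
Proof.
by move=> mf; have := measurable_lte measurableT mf (measurable_cst +oo%E); rewrite setTI.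
Qed.

(** * Ties of a path *)

Section section_swap.
Context d1 d2 (T1 : measurableType d1) (T2 : measurableType d2) (R : realType).
Variables (m1 : {sigma_finite_measure set T1 -> \bar R})
  (m2 : {sigma_finite_measure set T2 -> \bar R}).

Lemma measure_section_swap (A : set (T1 * T2)) : measurable A ->
  (\int[m1]_x m2 [set y | A (x, y)] = \int[m2]_y m1 [set x | A (x, y)])%E.
Proof.
move=> mA; transitivity ((m1 \x m2)%E A).
  by apply: eq_integral => x _; rewrite /= xsectionE.
rewrite (@product_measure_unique _ _ _ _ _ m1 m2 (m1 \x^ m2)%E)//; last first.
  by move=> B C mB mC; exact: product_measure2E.
by apply: eq_integral => y _; rewrite /= ysectionE.
Qed.

End section_swap.

Section translation.
Context {R : realType}.
Local Notation TR := (measurableTypeR R).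
Local Notation leb := (@lebesgue_measure R).
Local Open Scope ereal_scope.

Lemma lebesgue_translation (c : R) (A : set TR) : measurable A -> leb ((fun u : TR => (u + c)%R : TR) @^-1` A) = leb A.
Proof.
move=> mA; have mf : measurable_fun setT (fun u : TR => (u + c)%R : TR) by exact: measurable_funD.
rewrite -[LHS]/(push_measure leb mf A); apply/esym; apply: lebesgue_measure_unique => //.
move=> _ [[a b] _ <-] /=; rewrite /push_measure/= /pushforward.
rewrite (_ : _ @^-1` _ = `](a - c)%R, (b - c)%R]%classic); last first.
  by apply/seteqP; split => u /=; rewrite !in_itv/= ltrBlDr lerBrDr.
rewrite !lebesgue_measure_itv/= !lte_fin ltrD2r; case: ifP => // _.
by rewrite -!EFinB opprB addrA subrK.
Qed.

Lemma integral_translation (c : R) (A : set TR) (f : TR -> \bar R) : measurable A ->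
  measurable_fun setT f -> (forall u, 0 <= f u) ->
  \int[leb]_(u in (fun u : TR => (u + c)%R : TR) @^-1` A) f (u + c)%R = \int[leb]_(u in A) f u.
Proof.
move=> mA mf f0; have mc : measurable_fun setT (fun u : TR => (u + c)%R : TR) by exact: measurable_funD.
rewrite -(@ge0_integral_pushforward _ _ _ _ _ _ mc leb A f mA (measurable_funTS mf))//.
apply: eq_measure_integral => B mB _.
exact: lebesgue_translation.
Qed.

Lemma lebesgue2_translation (c : R) (A : set (TR * TR)) : measurable A ->
  (leb \x leb) ((fun p : TR * TR => ((p.1 + c)%R, (p.2 + c)%R) : TR * TR) @^-1` A) = (leb \x leb) A.
Proof.
move=> mA; have mf : measurable_fun setT (fun p : TR * TR => ((p.1 + c)%R, (p.2 + c)%R) : TR * TR).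
  by apply: measurable_fun_pair; apply: measurable_funD => //; (exact: measurable_fst || exact: measurable_snd).
rewrite -[LHS]/(push_measure (leb \x leb) mf A); apply/esym.
apply: product_measure_unique => // A1 A2 mA1 mA2.
rewrite /push_measure/= /pushforward.
rewrite (_ : _ @^-1` _ = ((fun u : TR => (u + c)%R : TR) @^-1` A1) `*` ((fun u : TR => (u + c)%R : TR) @^-1` A2))//.
rewrite product_measure1E//; first by congr (_ * _); exact: lebesgue_translation.
- by rewrite -[X in measurable X]setTI; apply: measurable_funD.
- by rewrite -[X in measurable X]setTI; apply: measurable_funD.
Qed.

Lemma lebesgue2_swap (A : set (TR * TR)) : measurable A ->
  (leb \x leb) ((fun p : TR * TR => (p.2, p.1) : TR * TR) @^-1` A) = (leb \x leb) A.
Proof.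
move=> mA; have mf : measurable_fun setT (fun p : TR * TR => (p.2, p.1) : TR * TR).
  by apply: measurable_fun_pair; [exact: measurable_snd|exact: measurable_fst].
rewrite -[LHS]/(push_measure (leb \x leb) mf A); apply/esym.
apply: product_measure_unique => // A1 A2 mA1 mA2.
rewrite /push_measure/= /pushforward.
rewrite (_ : _ @^-1` _ = A2 `*` A1); last first.
  by apply/seteqP; split => -[u v] [].
by rewrite product_measure1E// muleC.
Qed.

Lemma lebesgue2_diagonal : (leb \x leb) [set p | p.1 = p.2] = 0.
Proof.
rewrite /product_measure1/=; apply: integral0_eq => u _ /=.
rewrite (_ : xsection _ _ = [set u]) ?lebesgue_measure_set1//.
apply/seteqP; split => v; first by move=> /xsectionP /= ->.
by move=> /= ->; apply/xsectionP.
Qed.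

End translation.

Section ties.
Context {R : realType}.
Local Notation TR := (measurableTypeR R).
Local Notation leb := (@lebesgue_measure R).
Implicit Types (a b : R) (w : cpath R).

(** A named copy of the product, to which a structure of sigma-finite measure is attached. *)
Definition plane : set (TR * TR) -> \bar R := (leb \x leb)%E.

HB.instance Definition _ := Measure.copy plane (leb \x leb)%E.

Definition square a b : set (TR * TR) := `[a, b]%classic `*` `[a, b]%classic.

Lemma measurable_square a b : measurable (square a b).
Proof. by apply: measurableX; exact: measurable_itv. Qed.

Lemma square_ltoo a b : (plane (square a b) < +oo)%E.
Proof.
rewrite /square /plane product_measure1E; [|exact: measurable_itv..].
by rewrite lte_mul_pinfty// ?ge0_fin_numE//= lebesgue_measure_itv; case: ifP => _; rewrite ?ltry.
Qed.

Let plane_sigma_finite : sigma_finite setT plane.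
Proof.
exists (fun n => square (- n%:R) n%:R); last by move=> n; split; [exact: measurable_square|exact: square_ltoo].
apply/seteqP; split => // p _.
exists (Num.truncn (Num.max `|p.1| `|p.2|)).+1 => //.
have h : Num.max `|p.1| `|p.2| <= (Num.truncn (Num.max `|p.1| `|p.2|)).+1%:R by rewrite ltW// truncnS_gt.
move: h; rewrite ge_max => /andP[h1 h2].
by split; rewrite /= in_itv/= -ler_norml.
Qed.

HB.instance Definition _ := Measure_isSigmaFinite.Build _ _ _ plane plane_sigma_finite.

(** A hat of height 1 and slope [n], decreasing in [n] to the indicator of 0. *)
Definition cone n (r : R) : R := Num.max 0 (1 - n%:R * `|r|).

Lemma cone_ge0 n r : 0 <= cone n r. Proof. by rewrite le_max lexx. Qed.

Lemma cone_le1 n r : cone n r <= 1. Proof. by rewrite ge_max ler01/= gerBl mulr_ge0. Qed.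

Lemma cone0 n : cone n 0 = 1.
Proof. by rewrite /cone normr0 mulr0 subr0 max_r. Qed.

Lemma cone_lipschitz n r s : `|cone n r - cone n s| <= n%:R * `|r - s|.
Proof.
have h : `|n%:R * `|r| - n%:R * `|s| | <= n%:R * `|r - s|.
  by rewrite -mulrBr normrM [`|n%:R|]ger0_norm// ler_wpM2l// ler_dist_dist.
apply: le_trans h; rewrite /cone; move: (n%:R * `|r|) (n%:R * `|s|) => x y.
rewrite ler_norml; have [/andP[h1 h2] | ] : (- `|x - y| <= x - y <= `|x - y|) \/ False.
  by left; rewrite -ler_norml.
  move: h1 h2; move: `|x - y| => z h1 h2; rewrite !maxElt.
  by do !case: ifPn; rewrite -?leNgt => ? ?; apply/andP; split; lra.
by [].
Qed.

Lemma cone_continuous n : continuous (cone n).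
Proof.
move=> u; apply: (@continuous_max _ _ (fun=> 0) (fun u => 1 - n%:R * `|u|)); first exact: cvg_cst.
apply: cvgB; first exact: cvg_cst.
apply: cvgM; first exact: cvg_cst.
by apply: cvg_norm; exact: cvg_id.
Qed.

Lemma cone_cvg0 r : r != 0 -> cone n r @[n --> \oo] --> 0.
Proof.
move=> r0; apply: cvg_near_cst; near=> n.
have r1 : 0 < `|r| by rewrite normr_gt0.
rewrite /cone max_l// subr_le0 -ler_pdivrMr//.
have : (Num.truncn (1 / `|r|)).+1%:R <= n%:R :> R.
  by rewrite ler_nat; near: n; exact: nbhs_infty_ge.
by apply: le_trans; rewrite ltW// truncnS_gt.
Unshelve. all: by end_near. Qed.

Lemma measurable_cone_diff n :
  measurable_fun setT (fun p : cpath R * (TR * TR) => cone n (p.1 p.2.1 - p.1 p.2.2)).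
Proof.
apply: measurableT_comp; first exact: continuous_measurable_fun (@cone_continuous n).
by apply: measurable_funB; apply: measurable_eval_comp; (try exact: measurable_fst);
  apply: measurableT_comp (measurable_snd); [exact: measurable_fst|exact: measurable_snd].
Qed.

(* A relaxation of [ties] which is continuous in [w]. *)
Definition near_ties n a b w : R :=
  \int[plane]_(p in square a b) cone n (w p.1 - w p.2).

Definition ties a b w : \bar R := plane (square a b `&` [set p | w p.1 = w p.2]).

Let measurable_section w : measurable_fun setT (fun p : TR * TR => (w, p)).
Proof. exact: measurable_fun_pair. Qed.

Lemma measurable_tie_set : measurable [set p : cpath R * (TR * TR) | p.1 p.2.1 = p.1 p.2.2].
Proof.
by apply: measurable_eq_set; apply: measurable_eval_comp; (try exact: measurable_fst);
  apply: measurableT_comp (measurable_snd); (exact: measurable_fst || exact: measurable_snd).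
Qed.

Let measurable_cone_path n w : measurable_fun setT (fun p : TR * TR => cone n (w p.1 - w p.2)).
Proof. exact: (measurableT_comp (measurable_cone_diff n) (measurable_section w)). Qed.

Lemma cone_integrable n a b w :
  plane.-integrable (square a b) (EFin \o (fun p => cone n (w p.1 - w p.2))).
Proof.
apply: measurable_bounded_integrable.
- exact: measurable_square.
- exact: square_ltoo.
- exact: measurable_funTS.
exists 1; split; [exact: num_real|move=> r r1 p _].
by rewrite /= ger0_norm ?cone_ge0// (le_trans (cone_le1 _ _))// ltW.
Qed.

Lemma near_tiesE n a b w : (near_ties n a b w)%:E =
  (\int[plane]_(p in square a b) (cone n (w p.1 - w p.2))%:E)%E.
Proof.
rewrite /near_ties /Rintegral fineK//.
by apply: integrable_fin_num; [exact: measurable_square|exact: cone_integrable].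
Qed.

Lemma measurable_near_ties n a b : measurable_fun setT (near_ties n a b).
Proof.
rewrite (_ : near_ties n a b = fun w => fine (\int[plane]_p
   ((cone n (w p.1 - w p.2)) * \1_(square a b) p)%:E)%E); last first.
  apply/funext => w; rewrite /near_ties /Rintegral integral_mkcond; congr fine.
  apply: eq_integral => p _; rewrite patchE indicE.
  by case: ifPn => _; rewrite ?mulr1 ?mulr0.
apply: measurableT_comp => //.
apply: (@measurable_fun_fubini_tonelli_F _ _ _ _ _ plane
  (fun q : cpath R * (TR * TR) => (cone n (q.1 q.2.1 - q.1 q.2.2) * \1_(square a b) q.2)%:E)).
  apply/measurable_EFinP; apply: measurable_funM; first exact: measurable_cone_diff.
  apply: measurableT_comp measurable_snd; apply: measurable_indic; exact: measurable_square.
by move=> q; rewrite lee_fin mulr_ge0// cone_ge0.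
Qed.

Lemma measurable_ties a b : measurable_fun setT (ties a b).
Proof.
have := @measurable_fun_xsection _ _ _ (TR * TR)%type _ plane
  ((setT `*` square a b) `&` [set p : cpath R * (TR * TR) | p.1 p.2.1 = p.1 p.2.2]).
rewrite (_ : _ \o _ = ties a b); last first.
  apply/funext => w; rewrite /= xsectionE; congr (plane _).
  by apply/seteqP; split => p /=; [move=> [[_ ?] ?]|move=> [? ?]]; split.
apply; apply: measurableI; last exact: measurable_tie_set.
by apply: measurableX => //; exact: measurable_square.
Qed.

Lemma near_ties_ge0 n a b w : 0 <= near_ties n a b w.
Proof. by apply: Rintegral_ge0 => p _; exact: cone_ge0. Qed.

Definition area a b : R := fine (plane (square a b)).

Let cst_integrable a b c : plane.-integrable (square a b) (EFin \o (fun=> c)).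
Proof.
apply: measurable_bounded_integrable => //; [exact: measurable_square|exact: square_ltoo|].
by exists `|c|; split; [exact: num_real|move=> r r1 p _; exact: ltW].
Qed.

Lemma near_ties_le n a b w : near_ties n a b w <= area a b.
Proof.
rewrite -[area a b]mul1r -Rintegral_cst; last exact: measurable_square.
apply: le_Rintegral; [exact: measurable_square|exact: cone_integrable|exact: cst_integrable|].
by move=> p _; exact: cone_le1.
Qed.

Lemma ties_le n a b w : (ties a b w <= (near_ties n a b w)%:E)%E.
Proof.
have mS := measurable_square a b.
have mT : measurable [set p : TR * TR | w p.1 = w p.2].
  by have := measurable_section w measurableT measurable_tie_set; rewrite setTI.
rewrite near_tiesE /ties setIC -integral_indic//; apply: ge0_le_integral => //.
- by apply/measurable_EFinP; exact: measurable_indic.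
- by apply/measurable_EFinP; exact: measurable_funTS.
move=> p _; rewrite lee_fin indicE; have [e|e] := pselect (w p.1 = w p.2).
  by rewrite mem_set//= e subrr cone0.
by rewrite memNset// cone_ge0.
Qed.

Lemma near_ties_cvg0 a b w : ties a b w = 0 -> near_ties n a b w @[n --> \oo] --> 0.
Proof.
move=> t0; have mS := measurable_square a b.
have mT : measurable [set p : TR * TR | w p.1 = w p.2].
  by have := measurable_section w measurableT measurable_tie_set; rewrite setTI.
have [] := @dominated_convergence _ _ _ plane (square a b) mS
  (fun n => EFin \o (fun p => cone n (w p.1 - w p.2))) (EFin \o (fun=> 0)) (EFin \o (fun=> 1)).
- by move=> n; apply/measurable_EFinP; exact: measurable_funTS.
- by apply/measurable_EFinP.
- exists (square a b `&` [set p | w p.1 = w p.2]); split => //; first exact: measurableI.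
  move=> p /= h; apply: contrapT => nt; apply: h => sp; apply: cvg_EFin; first by near=> n.
  apply: cone_cvg0; rewrite subr_eq0; apply/eqP => e; apply: nt; split => //.
- exact: cst_integrable.
- by apply: aeW => p n _; rewrite /= lee_fin ger0_norm ?cone_ge0// cone_le1.
move=> _ _ h; apply: fine_cvg.
by move: h; rewrite [X in _ --> X -> _]integral0_eq.
Unshelve. all: by end_near. Qed.

Lemma near_ties_continuous n a b w w' e : (forall u, a <= u <= b -> `|w u - w' u| <= e) ->
  `|near_ties n a b w - near_ties n a b w'| <= n%:R * (2 * e) * area a b.
Proof.
move=> h; have mS := measurable_square a b.
rewrite /near_ties -RintegralB//; [|exact: cone_integrable..].
have ii := integrableB mS (cone_integrable n a b w) (cone_integrable n a b w').
apply: (le_trans (le_normr_Rintegral mS ii)).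
rewrite -Rintegral_cst//; apply: le_Rintegral => //.
- exact: integrable_norm ii.
move=> p [/=]; rewrite !in_itv/= => p1 p2; apply: (le_trans (cone_lipschitz _ _ _)).
apply: ler_wpM2l => //; rewrite (_ : _ - _ = (w p.1 - w' p.1) - (w p.2 - w' p.2)); last by ring.
by apply: (le_trans (ler_normB _ _)); have := h _ p1; have := h _ p2; lra.
Qed.

(** Plane measure is invariant under diagonal translations. To be used with [s] a time at which the
    path is at [y]: ties after [u0] are among the ties of the path restarted at [s <= u0]. *)
Lemma near_ties_shift n a b a' b' s w : 0 <= a' -> a' <= a - s -> b - s <= b' ->
  near_ties n a b w <= near_ties n a' b' (shift_path s w).
Proof.
move=> a'0 h1 h2; rewrite -lee_fin !near_tiesE.
have mc : measurable_fun setT (fun p : TR * TR => (p.1 + s, p.2 + s) : TR * TR).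
  by apply: measurable_fun_pair; apply: measurable_funD => //; (exact: measurable_fst || exact: measurable_snd).
pose f (p : TR * TR) := (cone n (w p.1 - w p.2))%:E.
have mf : measurable_fun setT f by apply/measurable_EFinP; exact: measurable_cone_path.
have := @ge0_integral_pushforward _ _ _ _ _ _ mc plane (square a b) f (measurable_square a b) (measurable_funTS mf).
pose sh (p : TR * TR) : TR * TR := (p.1 + s, p.2 + s).
have -> : (\int[pushforward plane sh]_(p in square a b) f p =
    \int[plane]_(p in square a b) f p)%E.
  by apply: eq_measure_integral => A mA _; exact: (lebesgue2_translation s mA).
move=> ->; last by move=> p _; rewrite lee_fin cone_ge0.
have sub : sh @^-1` square a b `<=` square a' b'.
  move=> p [/=]; rewrite !in_itv/= => /andP[p1 p2] /andP[p3 p4]; split; rewrite /= in_itv/=.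
    by apply/andP; split; lra.
  by apply/andP; split; lra.
have mp : measurable (sh @^-1` square a b).
  by rewrite -[X in measurable X]setTI; apply: mc => //; exact: measurable_square.
rewrite (@eq_integral _ _ _ plane (sh @^-1` square a b)
    (fun p => (cone n (shift_path s w p.1 - shift_path s w p.2))%:E)); last first.
  move=> p; rewrite inE => /sub[/=]; rewrite !in_itv/= => /andP[p1 _] /andP[p2 _].
  by rewrite /f /sh/= !max_l ?(le_trans a'0)// ![s + _]addrC.
apply: ge0_subset_integral => //.
- exact: measurable_square.
- by apply/measurable_EFinP; exact: measurable_funTS.
- by move=> p _; rewrite lee_fin cone_ge0.
Qed.

Lemma near_ties_stop n a b w : near_ties n a b (stop_path b w) = near_ties n a b w.
Proof.
apply: eq_Rintegral => p; rewrite inE => -[/=]; rewrite !in_itv/= => /andP[_ p1] /andP[_ p2].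
by rewrite !min_l.
Qed.

(** Only ordered pairs are kept, because the Markov property is applied at the earlier of the two
    times. *)
Definition forward_ties b w : set (TR * TR) :=
  [set p | [/\ 0 <= p.1, p.1 < p.2, p.2 <= b & w p.1 = w p.2]].

Lemma measurable_forward_ties b :
  measurable [set q : cpath R * (TR * TR) | forward_ties b q.1 q.2].
Proof.
have m1 : measurable_fun setT (fun q : cpath R * (TR * TR) => q.2.1).
  by apply: measurableT_comp measurable_snd; exact: measurable_fst.
have m2 : measurable_fun setT (fun q : cpath R * (TR * TR) => q.2.2).
  by apply: measurableT_comp measurable_snd; exact: measurable_snd.
rewrite (_ : mkset _ = [set q : cpath R * (TR * TR) | 0 <= q.2.1] `&`
  ([set q : cpath R * (TR * TR) | q.2.1 < q.2.2] `&`
  ([set q : cpath R * (TR * TR) | q.2.2 <= b] `&`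
  [set q : cpath R * (TR * TR) | q.1 q.2.1 = q.1 q.2.2]))); last first.
  by apply/seteqP; split => q /=; [case=> ? ? ? ?|case=> ? [? [? ?]]]; split.
apply: measurableI; last apply: measurableI; last apply: measurableI; last exact: measurable_tie_set.
- exact: measurable_le_set.
- exact: measurable_lt_set.
- exact: measurable_le_set.
Qed.

(** A tie is a forward one, or the mirror image of a forward one, or lies on the diagonal, and the
    diagonal is null. *)
Lemma ties_half b w : plane (forward_ties b w) = 0 -> ties 0 b w = 0.
Proof.
move=> H0; set H := forward_ties b w in H0.
have mH : measurable H.
  have h := measurable_section w measurableT (measurable_forward_ties b).
  by move: h; rewrite setTI.
have mH' : measurable ((fun p : TR * TR => (p.2, p.1) : TR * TR) @^-1` H).
  rewrite -[X in measurable X]setTI.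
  have ms : measurable_fun setT (fun p : TR * TR => (p.2, p.1) : TR * TR).
    by apply: measurable_fun_pair; [exact: measurable_snd|exact: measurable_fst].
  exact: ms.
have mD : measurable [set p : TR * TR | p.1 = p.2].
  by apply: measurable_eq_set; [exact: measurable_fst|exact: measurable_snd].
have nH : plane.-negligible H by exact/negligibleP.
have nH' : plane.-negligible ((fun p : TR * TR => (p.2, p.1) : TR * TR) @^-1` H).
  by apply/negligibleP => //; exact: etrans (lebesgue2_swap mH) H0.
have nD : plane.-negligible [set p : TR * TR | p.1 = p.2].
  by apply/negligibleP => //; exact: lebesgue2_diagonal.
have mT : measurable [set p : TR * TR | w p.1 = w p.2].
  by have := measurable_section w measurableT measurable_tie_set; rewrite setTI.
apply: measure_negligible; first by apply: measurableI => //; exact: measurable_square.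
apply: negligibleS (negligibleU (negligibleU nH nH') nD).
move=> p [[/=]]; rewrite !in_itv/= => /andP[p1 p2] /andP[p3 p4] e.
by have [lt|lt|eq] := ltgtP p.1 p.2; [left; left|left; right|right].
Qed.

End ties.

(** * Continuous functionals of a path *)

Section path_topology.
Context {R : realType}.
Implicit Types w : cpath R.

Lemma path_near w a c e : 0 < e ->
  \forall w' \near w, forall u, a <= u <= c -> `|w u - (w' : cpath R) u| < e.
Proof.
move=> e0; have FF : Filter (@path_fun R @ nbhs w) by exact: fmap_filter.
have h1 : {compact-open, (@path_fun R @ nbhs w) --> (w : R -> R)}.
  exact: (@initial_continuous _ _ (@path_fun R : cpath R -> {compact-open, R -> R})).
have h2 := iffLR (compact_open_fam_compactP (@path_cont R w) FF) h1.
have h3 := iffLR (fam_cvgP _ _ FF) h2 `[a, c]%classic (@segment_compact _ a c).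
apply: (h3 [set g : R -> R | forall u, a <= u <= c -> `|w u - g u| < e]).
apply/uniform_nbhs; exists [set p : R * R | ball p.1 e p.2]; split.
  by rewrite -entourage_ballE; exists e.
by move=> g /= hg u ui; apply: hg; rewrite /= in_itv.
Qed.

Lemma eval_path_continuous u : continuous (fun w => w u).
Proof.
move=> w; have FF : Filter (nbhs w) := nbhs_filter w.
apply/(@cvgrPdist_lt _ _ _ (nbhs w) FF) => e e0; have := path_near w u u e0.
by apply: filterS => w' /(_ u); apply; rewrite lexx.
Qed.

Lemma near_ties_path_continuous n a c : continuous (near_ties n a c : cpath R -> R).
Proof.
move=> w; have FF : Filter (nbhs w) := nbhs_filter w.
apply/(@cvgrPdist_le _ _ _ (nbhs w) FF) => e e0.
have A0 : 0 <= area a c :> R by rewrite fine_ge0.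
pose K : R := n%:R * 2 * area a c + 1.
have K0 : 0 < K by rewrite ltr_wpDl// !mulr_ge0.
have := path_near w a c (divr_gt0 e0 K0); apply: filterS => w' hw.
have := @near_ties_continuous _ n a c w w' (e / K).
move=> h; apply: (le_trans (h _)).
  by move=> u ui; rewrite ltW// hw.
have -> : n%:R * (2 * (e / K)) * area a c = e * (n%:R * 2 * area a c / K) by ring.
by rewrite ler_piMr ?(ltW e0)// ler_pdivrMr// mul1r lerDl.
Qed.

(** A continuous substitute for the indicator of the paths above [y] at time [u]; it is positive on
    exactly these paths. *)
Definition cutoff (y u : R) w : R := Num.min 1 (Num.max 0 (w u - y)).

Lemma cutoff_itv y u w : 0 <= cutoff y u w <= 1.
Proof. by rewrite /cutoff ge_min lexx andbT le_min ler01 le_max lexx. Qed.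

Lemma cutoff_eq0 y u w : w u <= y -> cutoff y u w = 0.
Proof. by move=> h; rewrite /cutoff [Num.max _ _]max_l ?subr_le0// min_r. Qed.

Lemma cutoff_gt0 y u w : y < w u -> 0 < cutoff y u w.
Proof. by move=> h; rewrite /cutoff lt_min ltr01 lt_max subr_gt0 h orbT. Qed.

Lemma cutoff_continuous y u : continuous (cutoff y u).
Proof.
move=> w; have FF : Filter (nbhs w) := nbhs_filter w.
apply: (@continuous_min _ _ (fun=> 1) (fun w : cpath R => Num.max 0 (w u - y))); first exact: cvg_cst.
apply: (@continuous_max _ _ (fun=> 0) (fun w : cpath R => w u - y)); first exact: cvg_cst.
by apply: cvgB; [exact: eval_path_continuous|exact: cvg_cst].
Qed.

Lemma measurable_cutoff y u : measurable_fun setT (cutoff y u).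
Proof.
apply: measurable_minr => //; apply: measurable_maxr => //.
by apply: measurable_funB => //; exact: measurable_eval.
Qed.

(* A bounded continuous functional dominating the ties of the paths that have
   left [0, y] by time [u]. *)
Definition weighted_ties n y u t w : R := cutoff y u w * near_ties n u t w.

Lemma weighted_ties_continuous n y u t : continuous (weighted_ties n y u t).
Proof.
move=> w; have FF : Filter (nbhs w) := nbhs_filter w.
by apply: (@cvgM _ _ (nbhs w) FF); [exact: cutoff_continuous|exact: near_ties_path_continuous]. Qed.

Lemma measurable_weighted_ties n y u t : measurable_fun setT (weighted_ties n y u t).
Proof. by apply: measurable_funM; [exact: measurable_cutoff|exact: measurable_near_ties]. Qed.

Lemma weighted_ties_ge0 n y u t w : 0 <= weighted_ties n y u t w.
Proof. by apply: mulr_ge0; [case/andP: (cutoff_itv y u w)|exact: near_ties_ge0]. Qed.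

Lemma weighted_ties_le n y u t w : weighted_ties n y u t w <= area u t.
Proof.
have /andP[h0 h1] := cutoff_itv y u w.
apply: (@le_trans _ _ (near_ties n u t w)); last exact: near_ties_le.
by rewrite ler_piMl// near_ties_ge0.
Qed.

(** Near ties up to the threshold [c] are given away; what exceeds it is charged to an event, to
    which the strong Markov property can be applied. *)
Lemma weighted_ties_split n y u t (c : R) w : 0 <= c ->
  weighted_ties n y u t w <= c + area u t * \1_[set w : cpath R | y < w u /\ c < near_ties n u t w] w.
Proof.
move=> c0; have A0 : 0 <= area u t :> R by rewrite fine_ge0.
rewrite indicE; have [h|h] := pselect (y < w u /\ c < near_ties n u t w).
  by rewrite mem_set// mulr1 (le_trans (weighted_ties_le _ _ _ _ _))// lerDr.
rewrite memNset// mulr0 addr0 /weighted_ties.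
have [yw|wy] := ltP y (w u); last by rewrite cutoff_eq0// mul0r.
have [cw|wc] := ltP c (near_ties n u t w); first by exfalso; apply: h.
have /andP[h0 h1] := cutoff_itv y u w.
by apply: le_trans wc; rewrite ler_piMl// near_ties_ge0.
Qed.

Lemma weighted_ties_stop n y u t l w : u <= l -> t <= l ->
  weighted_ties n y u t (stop_path l w) = weighted_ties n y u t w.
Proof.
move=> ul tl; rewrite /weighted_ties /cutoff stop_pathE//; congr (_ * _).
apply: eq_Rintegral => p; rewrite inE => -[/=]; rewrite !in_itv/= => /andP[_ p1] /andP[_ p2].
by rewrite !min_l// (le_trans _ tl).
Qed.

End path_topology.

(** * Ranks and level sets *)

Section rank.
Context {R : realType}.
Local Notation TR := (measurableTypeR R).
Local Notation leb := (@lebesgue_measure R).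
Variable l : R.
Local Notation D := (`[0, l]%classic : set TR).

Definition rank (g : TR -> R) (u : TR) : \bar R := leb (D `&` [set s | g u < g s]).

Lemma measurable_rank_comp d (T : measurableType d) (f : T * TR -> R) :
  measurable_fun setT f ->
  measurable_fun setT (fun q : T * TR => rank (fun s => f (q.1, s)) q.2).
Proof.
move=> mf; pose A := [set z : (T * TR) * TR | f z.1 < f (z.1.1, z.2)].
have mA : measurable A.
  apply: measurable_lt_set; first exact: measurableT_comp measurable_fst.
  apply: measurableT_comp => //; apply: measurable_fun_pair; last exact: measurable_snd.
  exact: measurableT_comp measurable_fst.
have mAD : measurable ((setT `*` D) `&` A).
  by apply: measurableI => //; apply: measurableX => //; exact: measurable_itv.
have := @measurable_fun_xsection _ _ _ _ R leb _ mAD.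
rewrite (_ : _ \o _ = (fun q : T * TR => rank (fun s => f (q.1, s)) q.2))//.
apply/funext => -[x u]; rewrite /= xsectionE; congr (leb _).
by apply/seteqP; split => s /=; [move=> [[_ ?] ?]|move=> [? ?]]; split.
Qed.

Section one_function.
Variable g : TR -> R.
Hypothesis mg : measurable_fun setT g.

Let mD : measurable D. Proof. exact: measurable_itv. Qed.

Lemma measurable_rank : measurable_fun setT (rank g).
Proof.
have mf : measurable_fun setT (fun q : unit * TR => g q.2) by exact: measurableT_comp measurable_snd.
have mp : measurable_fun setT (fun u : TR => (tt, u)) by exact: measurable_fun_pair.
exact: (measurableT_comp (measurable_rank_comp mf) mp).
Qed.

Let mrank x : measurable (D `&` [set u | (rank g u <= x)%E]).
Proof. by apply: emeasurable_fun_infty_c; [exact: measurable_itv|exact: measurable_funTS measurable_rank]. Qed.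

Let mgt c : measurable (D `&` [set u | c < g u]).
Proof. by apply: measurableI => //; apply: measurable_lt_set. Qed.

Let meq c : measurable (D `&` [set u | g u = c]).
Proof. by apply: measurableI => //; apply: measurable_eq_set. Qed.

Let mge c : measurable (D `&` [set u | c <= g u]).
Proof. by apply: measurableI => //; apply: measurable_le_set. Qed.

Lemma rank_fin_num u : rank g u \is a fin_num.
Proof.
rewrite ge0_fin_numE ?measure_ge0//; apply: (@le_lt_trans _ _ (leb D)).
  by apply: le_measure; rewrite ?inE.
by rewrite /= lebesgue_measure_itv/=; case: ifP => _; rewrite ltry.
Qed.

Lemma Rintegral_rank u :
  \int[leb]_(s in `[0, l]) \1_[set r | g u < g r] s = fine (rank g u).
Proof.
by rewrite /Rintegral integral_indic//; [rewrite setIC|exact: measurable_lt_set].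
Qed.

Hypothesis g_level : forall c, leb (D `&` [set s | g s = c]) = 0.

Let leb_ge c : leb (D `&` [set u | c <= g u]) = leb (D `&` [set u | c < g u]).
Proof.
rewrite (_ : D `&` _ = (D `&` [set u | c < g u]) `|` (D `&` [set s | g s = c])).
  rewrite measureU0//; exact: g_level.
apply/seteqP; split => u /=.
  by move=> [Du]; rewrite le_eqVlt => /orP[/eqP ->|]; [right|left].
by move=> [[Du /ltW]|[Du ->]].
Qed.

(** Let [c] be the infimum of [g] over the set [G] of points of rank at most [x]. If it is attained,
    [G] lies in the set where [g] is at least [c], which up to a null level set has the rank of the
    minimizer as its measure. *)
Lemma rank_le (C x : R) : (forall u, D u -> C <= g u) -> 0 <= x ->
  (leb (D `&` [set u | (rank g u <= x%:E)%E]) <= x%:E)%E.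
Proof.
move=> gC x0; set G := D `&` _.
have [->|/set0P G0] := eqVneq G set0; first by rewrite measure0.
pose c := inf (g @` G).
have lb : has_lbound (g @` G) by exists C => _ [u [Du _] <-]; exact: gC.
have im0 : (g @` G) !=set0 by case: G0 => u Gu; exists (g u), u.
have cle u : G u -> c <= g u by move=> Gu; apply: ge_inf => //; exists u.
have [[u0 Gu0 u0c]|ninf] := pselect ((g @` G) c).
  apply: (@le_trans _ _ (leb (D `&` [set u | c <= g u]))).
    apply: le_measure; rewrite ?inE//; first exact: mrank.
    by move=> u Gu; split; [case: Gu|exact: cle].
  by rewrite leb_ge -u0c; case: Gu0.
(* Unattained infimum: [G] lies where $g>c$. This set is exhausted by the sets $g>c+1/(n+1)$, each
   contained in $g>g(u)$ for some [u] of [G] close to the infimum, hence of measure at most [x]. *)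
have Ggt : G `<=` D `&` [set u | c < g u].
  move=> u Gu; split; first by case: Gu.
  rewrite /= lt_neqAle cle// andbT; apply/eqP => cu; apply: ninf.
  by rewrite cu; exists u.
apply: (@le_trans _ _ (leb (D `&` [set u | c < g u]))).
  by apply: le_measure; rewrite ?inE//; exact: mrank.
pose F n := D `&` [set u | c + n.+1%:R^-1 < g u].
have FE : D `&` [set u | c < g u] = \bigcup_n F n.
  apply/seteqP; split => u /=; last first.
    by move=> [n _ [Du h]]; split => //; apply: lt_trans h; rewrite ltrDl invr_gt0.
  move=> [Du cu]; have cu0 : 0 < g u - c by rewrite subr_gt0.
  pose n := Num.truncn (g u - c)^-1; exists n => //; split => //=.
  rewrite -ltrBrDl invf_plt ?posrE//; exact: truncnS_gt.
have cvF : leb \o F @ \oo --> leb (\bigcup_n F n).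
  apply: nondecreasing_cvg_mu.
  - by move=> n; exact: mgt.
  - by rewrite -FE; exact: mgt.
  - move=> i j ij; apply/subsetPset => u [Du h]; split => //=; apply: le_lt_trans h.
    by rewrite lerD2l lef_pV2 ?posrE// ler_nat.
rewrite FE -(cvg_lim _ cvF)//; apply: lime_le; first by apply/cvg_ex; exists (leb (\bigcup_n F n)).
near=> n; have n0 : (0 : R) < n.+1%:R^-1 by rewrite invr_gt0.
have [y [u Gu <-] cy] := inf_adherent n0 (conj im0 lb).
have Gu' := Gu; case: Gu' => [Du ux]; apply: le_trans ux.
apply: le_measure; rewrite ?inE; [exact: mgt|exact: mgt|].
by move=> s [Ds h]; split => //; apply: lt_trans h.
Unshelve. all: by end_near. Qed.

End one_function.

(* The lower bound is rank_le for - g. *)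
Lemma rank_lt (g : TR -> R) (C x : R) : 0 <= l -> measurable_fun setT g ->
  (forall c, leb (D `&` [set s | g s = c]) = 0) ->
  (forall u, D u -> `|g u| <= C) -> 0 <= x <= l ->
  leb (D `&` [set u | (rank g u < x%:E)%E]) = x%:E.
Proof.
move=> l0 mg level gC /andP[x0 xl].
have mD : measurable D by exact: measurable_itv.
have lebD : leb D = l%:E.
  by rewrite lebesgue_measure_itv/= lte_fin; case: ltP => l0'; rewrite ?sube0//; congr (_%:E); apply/eqP; rewrite eq_le l0.
have ml := emeasurable_fun_infty_o mD (measurable_funTS (measurable_rank mg)) (x%:E).
have mc := emeasurable_fun_infty_c mD (measurable_funTS (measurable_rank mg)) (x%:E).
apply/eqP; rewrite eq_le; apply/andP; split.
  apply: (@le_trans _ _ (leb (D `&` [set u | (rank g u <= x%:E)%E]))).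
    by apply: le_measure; rewrite ?inE// => u [Du ux]; split => //; exact: ltW.
  by apply: (@rank_le g mg level (- C)) => // u Du; have := gC u Du; rewrite ler_norml => /andP[].
pose h u := - g u.
have mh : measurable_fun setT h by exact: measurableT_comp.
have hlevel c : leb (D `&` [set s | h s = c]) = 0.
  rewrite -(level (- c)); congr (leb _); apply/seteqP; split => u /= [Du].
    by rewrite /h => <-; rewrite opprK.
  by rewrite /h => ->; rewrite opprK.
have hC u : D u -> - C <= h u.
  by move=> Du; have := gC u Du; rewrite ler_norml lerN2 => /andP[].
have lx0 : 0 <= l - x by rewrite subr_ge0.
have := rank_le mh hlevel hC lx0.
(* As the level of [u] is null, the points above it and those below it fill $[0,l]$, so a rank of
   [g] less than [x] means that the rank of [h] exceeds [l - x]. *)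
have sumr u : (rank g u + rank h u = l%:E)%E.
  rewrite /rank -measureU//; last 3 first.
  - by apply: measurableI => //; exact: measurable_lt_set.
  - by apply: measurableI => //; exact: measurable_lt_set.
  - apply/seteqP; split => s // [[_ /= h1] [_]] /=; rewrite /h ltrN2 => h2.
    by have := lt_trans h1 h2; rewrite ltxx.
  rewrite -lebD -[RHS](_ : leb ((D `&` [set s | g u < g s] `|` D `&` [set s | h u < h s]) `|` (D `&` [set s | g s = g u])) = _).
    rewrite measureU0//; first by apply: measurableU; apply: measurableI => //; exact: measurable_lt_set.
    + by apply: measurableI => //; exact: measurable_eq_set.
    + exact: level.
  congr (leb _); apply/seteqP; split => s /=; first by move=> [[[]|[]]|[]].
  move=> Ds; rewrite /h ltrN2; case: (ltgtP (g u) (g s)) => ?; first by left; left.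
    by left; right.
  by right.
have fg u := rank_fin_num mg u.
have eqv u : (rank h u <= (l - x)%:E)%E = ~~ (rank g u < x%:E)%E.
  have := sumr u; move: (rank g u) (rank h u) (fg u) => [y||] [z||]//= _ [yz].
  by rewrite lee_fin lte_fin -leNgt; apply/idP/idP; move: yz; lra.
set L := D `&` [set u | (rank g u < x%:E)%E] in ml *.
have -> : D `&` [set u | (rank h u <= (l - x)%:E)%E] = D `\` L.
  apply/seteqP; split => u /= [Du]; rewrite eqv; first by move=> ux; split => // -[_ /= ux']; rewrite ux' in ux.
  by move=> nL; split => //; apply/negP => ux; apply: nL.
have LD : L `<=` D by move=> u [].
have LDf : (leb L < +oo)%E.
  by apply: (@le_lt_trans _ _ l%:E); rewrite ?ltry// -lebD; apply: le_measure; rewrite ?inE.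
have Dfin : (leb D < +oo)%E by rewrite lebD ltry.
have DL : leb (D `\` L) = (l%:E - leb L)%E.
  by rewrite -lebD -[in RHS](setIidr LD); exact: measureD.
rewrite DL; have : leb L \is a fin_num by rewrite ge0_fin_numE.
move: (leb L) => [y||]//= _; rewrite !lee_fin; lra.
Qed.

End rank.

Section level_sets.
Context {R : realType}.
Local Notation TR := (measurableTypeR R).
Local Notation leb := (@lebesgue_measure R).
Implicit Types w : cpath R.

Lemma measurable_path w : measurable_fun setT (w : TR -> R).
Proof. exact: continuous_measurable_fun (@path_cont _ w). Qed.

(** The square of the level set consists of ties, and its plane measure is the square of the measure
    of the level set. *)
Lemma level_null_ties a b c w : ties a b w = 0 -> leb (`[a, b] `&` [set s | w s = c]) = 0.
Proof.
move=> t0; set A := _ `&` _.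
have mA : measurable A by apply: measurableI => //; apply: measurable_eq_set => //; exact: measurable_path.
have mf : measurable_fun setT (fun p : TR * TR => w p.1) by exact: measurableT_comp (measurable_path w) measurable_fst.
have mg : measurable_fun setT (fun p : TR * TR => w p.2) by exact: measurableT_comp (measurable_path w) measurable_snd.
have : (plane (A `*` A) <= ties a b w)%E.
  apply: le_measure; rewrite ?inE.
  - exact: measurableX.
  - by apply: measurableI; [exact: measurable_square|exact: measurable_eq_set].
  by move=> p [[/= ? pc] [/= ? pc']]; split => //=; rewrite pc.
rewrite t0 /plane product_measure1E// => h.
have : (leb A * leb A == 0)%E by rewrite eq_le h mule_ge0.
by rewrite mule_eq0 => /orP[] /eqP.
Qed.

Lemma level_null_exhaustion l c w (u t : nat -> R) :
  (forall s, 0 < s -> s < l -> exists n, u n <= s <= t n) ->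
  (forall n, leb (`[u n, t n] `&` [set s | w s = c]) = 0) ->
  leb (`[0, l] `&` [set s | w s = c]) = 0.
Proof.
move=> ut h; have mc : measurable [set s : TR | w s = c].
  by apply: measurable_eq_set => //; exact: measurable_path.
have mU : measurable (\bigcup_n (`[u n, t n] `&` [set s | w s = c])).
  by apply: bigcupT_measurable => n; apply: measurableI.
have U0 : leb (\bigcup_n (`[u n, t n] `&` [set s | w s = c])) = 0.
  apply/eqP; rewrite eq_le measure_ge0 andbT.
  have := @measure_sigma_subadditive _ _ _ leb _ (fun n => `[u n, t n] `&` [set s : TR | w s = c])
    (fun n => measurableI _ _ (measurable_itv _) mc) mU (@subset_refl _ _).
  by rewrite eseries0// => n _ _; exact: h.
apply/eqP; rewrite eq_le measure_ge0 andbT.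
have m01 : measurable ([set 0] `|` [set l] : set TR) by exact: measurableU.
apply: (@le_trans _ _ (leb ((\bigcup_n (`[u n, t n] `&` [set s | w s = c])) `|` ([set 0] `|` [set l])))).
  apply: le_measure; rewrite ?inE; [exact: measurableI|exact: measurableU|].
  move=> s [/=]; rewrite in_itv/= => /andP[s0 sl] sc.
  have [->|s0'] := eqVneq s 0; first by right; left.
  have [->|sl'] := eqVneq s l; first by right; right.
  have s_gt0 : 0 < s by rewrite lt_neqAle eq_sym s0'.
  have s_ltl : s < l by rewrite lt_neqAle sl'.
  by have [n sn] := ut s s_gt0 s_ltl; left; exists n => //; split => //=; rewrite in_itv.
have B0 : leb ([set 0] `|` [set l]) = 0.
  rewrite -[RHS](@lebesgue_measure_set1 R 0).
  by apply: (@measureU0 _ _ _ leb) => //; exact: lebesgue_measure_set1.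
suff -> : leb (\bigcup_n (`[u n, t n] `&` [set s | w s = c]) `|` ([set 0] `|` [set l])) = 0 by [].
by rewrite -U0; exact: (@measureU0 _ _ _ leb).
Qed.

End level_sets.

(** * Strong Markov property *)

Section hitting.
Context {R : realType}.

Let contB (w : cpath R) y : continuous (fun t => w t - y).
Proof. by move=> t; apply: cvgB; [exact: path_cont|exact: cvg_cst]. Qed.

Lemma hitting_gtP y t (w : cpath R) :
  (t%:E < hitting_time y w)%E <-> forall s, 0 <= s -> s <= t -> w s != y.
Proof.
rewrite hitting_timeE; split.
  by move=> /first_zero_gtP h s s0 st; rewrite -subr_eq0; apply: h.
by move=> h; apply/first_zero_gtP => // s s0 st; rewrite subr_eq0; exact: h.
Qed.

Lemma hitting_leP y t (w : cpath R) :
  (hitting_time y w <= t%:E)%E <-> exists s, [/\ 0 <= s, s <= t & w s = y].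
Proof.
rewrite hitting_timeE; split.
  move=> /first_zeroP => /(_ (@contB w y))[s [s0 st /eqP]].
  by rewrite subr_eq0 => /eqP ws; exists s.
by move=> [s [s0 st ws]]; apply/first_zeroP => //; exists s; split => //; rewrite ws subrr.
Qed.

Lemma hitting_finP y t (w : cpath R) : hitting_time y w = t%:E <->
  [/\ 0 <= t, w t = y & forall s, 0 <= s -> s < t -> w s != y].
Proof.
rewrite hitting_timeE; split.
  move=> /first_zero_finP => /(_ (@contB w y))[t0 /eqP].
  by rewrite subr_eq0 => /eqP wt h; split => // s s0 st; rewrite -subr_eq0 h.
move=> [t0 wt h]; apply/first_zero_finP => //; split => //; first by rewrite wt subrr.
by move=> s s0 st; rewrite subr_eq0 h.
Qed.

Lemma hitting_ge0 y (w : cpath R) : (0 <= hitting_time y w)%E.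
Proof. by rewrite hitting_timeE first_zero_ge0. Qed.

Lemma ereal_eq_le (u v : \bar R) : (0 <= u)%E -> (0 <= v)%E ->
  (forall r : R, (u <= r%:E)%E <-> (v <= r%:E)%E) -> u = v.
Proof.
move: u v => [u| |] [v| |]// _ _ h.
- congr EFin; apply/eqP; rewrite eq_le -!lee_fin.
  by rewrite (h v).2// (h u).1.
- by have := (h u).1 (lexx _).
- by have := (h v).2 (lexx _).
Qed.

Lemma hitting_shift y t (w : cpath R) : 0 <= t -> (t%:E <= hitting_time y w)%E ->
  hitting_time y w = (t%:E + hitting_time y (shift_path t w))%E.
Proof.
move=> t0 tw; apply: ereal_eq_le; first exact: hitting_ge0.
  by rewrite adde_ge0// hitting_ge0.
move=> r; rewrite -leeBrDl// -EFinB; split => /hitting_leP[s [s0 sr ws]]; apply/hitting_leP.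
  have ts : t <= s.
    rewrite -lee_fin (le_trans tw)//; apply/hitting_leP; by exists s.
  by exists (s - t); split; [lra|lra|rewrite shift_pathE ?subr_ge0// addrC subrK].
by exists (t + s); split; [lra|lra|rewrite -shift_pathE].
Qed.

Definition alive t : set (cpath R) := [set w | (t%:E < hitting_time 0 w)%E].

Lemma measurable_alive t : measurable (alive t).
Proof. by apply: measurable_time_gt; exact: proper_measurable (proper_hitting_time 0). Qed.

Lemma alive_filtration t : 0 <= t -> natural_filtration t (alive t).
Proof.
move=> t0; apply: natural_filtration_invariant => //; first exact: measurable_alive.
move=> w; rewrite /alive/= !ltNge; have := proper_stop (proper_hitting_time 0) w t0 (lexx t).
by move=> h; split => /negP h'; apply/negP => /h.
Qed.

Lemma alive_gt0 t (w : cpath R) : 0 <= w 0 -> 0 <= t -> alive t w -> 0 < w t.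
Proof.
move=> w0 t0 /hitting_gtP aw; rewrite ltNge; apply/negP => wt.
have cw : {within `[0, t], continuous w}.
  by apply: continuous_subspaceT => s; exact: path_cont.
have w0t : Num.min (w 0) (w t) <= 0 <= Num.max (w 0) (w t).
  by rewrite ge_min le_max w0 wt orbT.
have [c] := IVT t0 cw w0t.
rewrite in_itv/= => /andP[c0 ct] wc.
by have := aw c c0 ct; rewrite wc eqxx.
Qed.

Lemma aliveD s t w : 0 <= s -> 0 <= t ->
  alive (s + t) w <-> alive s w /\ alive t (shift_path s w).
Proof.
move=> s0 t0; split.
  move=> /hitting_gtP h; split; apply/hitting_gtP => u u0 us.
    by apply: h => //; lra.
  by rewrite shift_pathE//; apply: h; lra.
move=> [/hitting_gtP h1 /hitting_gtP h2]; apply/hitting_gtP => u u0 ust.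
have [us|su] := leP u s; first exact: h1.
have us0 : 0 <= u - s by lra.
by have := h2 _ us0; rewrite shift_pathE// [s + _]addrC subrK; apply; lra.
Qed.

End hitting.

Section kernel_law.
Context d d' (X : measurableType d) (Y : measurableType d') (R : realType).
Variables (k : R.-pker X ~> Y) (x : X).

(** [P x] packaged as a probability measure, as required by product measures and Tonelli's
    theorem. *)
Definition kernel_law : set Y -> \bar R := k x.

HB.instance Definition _ := Measure.copy kernel_law (k x).

HB.instance Definition _ := Measure_isProbability.Build _ _ _ kernel_law
  (@prob_kernel _ _ _ _ _ k x).

End kernel_law.

Section markov.
Context {R : realType} (b : \bar R) (k : boundary) (S m : R -> R).
Variable P : R.-pker (measurableTypeR R) ~> cpath R.
Hypothesis P_diff : recurrent_diffusion b k P S m.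
Local Notation E := (state_space b k).
Local Notation I := (state_interior b).

Lemma state_interiorW x : I x -> E x.
Proof. by move=> [x0 xb]; split; [exact: ltW|case: (k) => //; exact: ltW]. Qed.

Lemma state_space_lt x y : E y -> 0 < x -> x < y -> I x.
Proof.
move=> [y0 yb] x0 xy; split => //; case: (k) yb => yb.
- by apply: lt_le_trans yb; rewrite lte_fin.
- by apply: lt_trans yb; rewrite lte_fin.
- by apply: lt_trans yb; rewrite lte_fin.
Qed.

Lemma state_space_itv x y : E y -> 0 <= x -> x <= y -> E x.
Proof.
move=> Ey x0 xy; case: (ltgtP x y) xy => // [xy _|-> //].
move: x0; rewrite le_eqVlt => /predU1P[<-|x0]; last exact/state_interiorW/(state_space_lt Ey).
move: Ey => [y0 yb]; split => //; case: (k) yb => yb.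
- by apply: le_trans yb; rewrite lee_fin.
- by apply: le_lt_trans yb; rewrite lee_fin.
- by apply: le_lt_trans yb; rewrite lee_fin.
Qed.

Lemma start_ae x : E x -> \forall w \ae P x, (w : cpath R) 0 = x.
Proof. by move=> Ex; exact: (diff_start P_diff Ex). Qed.

Lemma law_le1 x A : measurable A -> (P x A <= 1)%E.
Proof. by move=> mA; rewrite -(@prob_kernel _ _ _ _ _ P x); apply: le_measure; rewrite ?inE. Qed.

Section strong_markov_pair.
Variables (x : R) (T : cpath R -> \bar R) (A : set (cpath R)).
Hypotheses (Ex : E x) (pT : proper_time T) (sA : stopped_events T A).
Local Open Scope ereal_scope.

Let t w := fine (T w).
Let mt : measurable_fun setT t.
Proof. by apply: measurable_fine_time; exact: proper_measurable. Qed.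

Let D := A `&` [set w | T w < +oo].
Let mD : measurable D.
Proof.
apply: measurableI; first by case: sA.
by apply: measurable_time_lt; exact: proper_measurable.
Qed.

Let pair (w : cpath R) := (t w, shift_path (t w) w).
Let mpair : measurable_fun setT pair.
Proof. by apply: measurable_fun_pair => //; exact: measurable_shift_comp. Qed.

Let mpair' (w : cpath R) : measurable_fun setT (fun w' : cpath R => (t w, w')).
Proof. exact: measurable_fun_pair. Qed.

Let K (w : cpath R) : {measure set (R * cpath R) -> \bar R} :=
  push_measure (P (w (t w))) (mpair' w).

Let mw : measurable_fun setT (fun w : cpath R => w (t w)).
Proof. exact: measurable_eval_comp. Qed.

Let mK U : measurable U -> measurable_fun setT (K ^~ U).
Proof.
move=> mU; rewrite (_ : K ^~ U = fun w => P (w (t w)) [set w' | [set p | U (t p.1, p.2)] (w, w')]) //.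
apply: (measurable_comp_kernel_section P mw).
rewrite -[X in measurable X]setTI.
apply: (measurable_fun_pair _ _ measurableT mU).
  by apply: measurableT_comp => //; exact: measurable_fst.
exact: measurable_snd.
Qed.

Let K0 (w : cpath R) : {measure set (R * cpath R) -> \bar R} := dirac (pair w).

Let mK0 U : measurable U -> measurable_fun setT (K0 ^~ U).
Proof.
move=> mU; rewrite (_ : K0 ^~ U = EFin \o (\1_(pair @^-1` U) : _ -> R)).
  apply/measurable_EFinP; apply: measurable_indic.
  by rewrite -[X in measurable X]setTI; exact: mpair.
by apply/funext => w; rewrite /K0/= diracE indicE.
Qed.

(** The law of the time and the restarted path on [D], written as a mixture of Dirac masses, so that
    integrals against it unfold to integrals along the path. *)
Let nu : {measure set (R * cpath R) -> \bar R} := mixture_measure (P x) mD mK0.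

Let nuE0 U : measurable U -> nu U = P x (D `&` (pair @^-1` U)).
Proof.
move=> mU; have mpU : measurable (pair @^-1` U).
  by rewrite -[X in measurable X]setTI; exact: mpair.
rewrite /nu /= /mixture/= setIC -integral_indic//.
Qed.

(** Equality is checked on rectangles: that the time lies in [B] is an event of the past, so it is
    moved into the stopped event before the strong Markov property is applied to [C]. Rectangles
    form a generating pi-system. *)
Let nuE U : measurable U -> nu U = mixture_measure (P x) mD mK U.
Proof.
move: U; apply: (@measure_unique _ R _ [set B `*` C | B in measurable & C in measurable]
   (fun=> setT)).
- exact: measurable_prod_measurableType.
- move=> _ _ [B1 mB1 [C1 mC1 <-]] [B2 mB2 [C2 mC2 <-]]; rewrite -setXI.
  by exists (B1 `&` B2); [exact: measurableI|exists (C1 `&` C2); [exact: measurableI|]].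
- by move=> _; exists setT => //; exists setT => //; rewrite setXTT.
- by rewrite bigcup_const//; exists 0%N.
- move=> _ [B mB [C mC <-]].
  have sBA : stopped_events T (A `&` [set w | T w < +oo /\ B (fine (T w))]).
    by apply: stopped_eventsI => //; exact: stopped_events_time.
  have := diff_strong_markov P_diff Ex (proper_stopping_time pT) sBA mC.
  rewrite [in RHS](_ : _ `&` _ = D `&` (t @^-1` B)); last first.
    by apply/seteqP; split => [w [[Aw [Tw Bw]] _]|w [[Aw Tw] Bw]].
  rewrite integral_mkcondr.
  move=> h; rewrite nuE0; last exact: measurableX.
  rewrite (_ : D `&` _ = (A `&` [set w | T w < +oo /\ B (fine (T w))]) `&`
    [set w | T w < +oo /\ C (shift_path (fine (T w)) w)]); last first.
    apply/seteqP; split => w /=.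
      by move=> [[Aw Tw] [Bw Cw]].
    by move=> [[Aw [Tw Bw]] [_ Cw]].
  rewrite h; apply: eq_integral => w _.
  rewrite /K /push_measure/= /pushforward/= patchE; have [Bw|Bw] := pselect (B (t w)).
    rewrite mem_set//=; congr (P _ _).
    by apply/seteqP; split => w' //= [].
  rewrite memNset//= (_ : _ @^-1` _ = set0) ?measure0//.
  by apply/seteqP; split => w' //= [].
- move=> _; rewrite nuE0//; apply: (@le_lt_trans _ _ 1); last by rewrite ltry.
  by apply: law_le1; apply: measurableI => //; rewrite -[X in measurable X]setTI; exact: mpair.
Qed.

(** The restarted path is tested jointly with the restart time, which is known by then and is frozen
    on the right. Events about the absolute time of extinction need this form. *)
Lemma strong_markov_pair U : measurable U ->
  P x (A `&` [set w | T w < +oo /\ U (t w, shift_path (t w) w)]) =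
  \int[P x]_(w in A `&` [set w | T w < +oo]) P (w (t w)) [set w' | U (t w, w')].
Proof.
move=> mU; have := nuE mU; rewrite nuE0// /= /mixture/= => <-.
congr (P x _); apply/seteqP; split => w /=.
  by move=> [Aw [Tw Uw]].
by move=> [[Aw Tw] Uw].
Qed.

Lemma strong_markov_integral (f : R * cpath R -> \bar R) :
  measurable_fun setT f -> (forall p, 0 <= f p) ->
  \int[P x]_(w in A `&` [set w | T w < +oo]) f (t w, shift_path (t w) w) =
  \int[P x]_(w in A `&` [set w | T w < +oo]) \int[P (w (t w))]_w' f (t w, w').
Proof.
move=> mf f0.
transitivity (\int[nu]_p f p).
  rewrite (@integral_mixture _ _ _ _ _ (P x) D K0)//.
  by apply: eq_integral => w _; rewrite /K0 integral_dirac// diracT mul1e.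
rewrite (integral_mixture mD mK nuE)//; apply: eq_integral => w _.
by rewrite /K /push_measure ge0_integral_pushforward.
Qed.

End strong_markov_pair.

Lemma stopped_eventsT (T : cpath R -> \bar R) : proper_time T -> stopped_events T setT.
Proof.
move=> pT; split => // t t0; rewrite setTI.
by have [_] := proper_stopping_time pT; apply.
Qed.

Lemma simple_markov x t A B : E x -> 0 <= t -> natural_filtration t A -> measurable B ->
  P x (A `&` shift_path t @^-1` B) = (\int[P x]_(w in A) P (w t) B)%E.
Proof.
move=> Ex t0 FA mB.
have := @strong_markov_pair x _ A Ex (proper_cst t0) (stopped_events_cst t0 FA)
  (setT `*` B) (measurableX measurableT mB).
rewrite (_ : [set w | (t%:E < +oo)%E] = setT) ?setIT; last first.
  by apply/seteqP; split => w //= _; rewrite ltry.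
rewrite (_ : [set w | (_ < _)%E /\ _] = shift_path t @^-1` B); last first.
  by apply/seteqP; split => w /= => [[_ []]|Bw]; rewrite ?ltry.
move=> ->; apply: eq_integral => w _; congr (P _ _).
by apply/seteqP; split => w' //= [].
Qed.

Lemma simple_markov_integral x t A (f : cpath R -> \bar R) : E x -> 0 <= t ->
  natural_filtration t A -> measurable_fun setT f -> (forall w, 0 <= f w)%E ->
  (\int[P x]_(w in A) f (shift_path t w) = \int[P x]_(w in A) \int[P (w t)]_w' f w')%E.
Proof.
move=> Ex t0 FA mf f0.
have := @strong_markov_integral x _ A Ex (proper_cst t0) (stopped_events_cst t0 FA)
  (f \o snd) (measurableT_comp mf measurable_snd) (fun=> f0 _).
rewrite (_ : [set w | (t%:E < +oo)%E] = setT) ?setIT//.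
by apply/seteqP; split => w //= _; rewrite ltry.
Qed.

(** By continuity the path sits at [y] at the hitting time, so the restart law is the fixed measure
    [P y]. *)
Lemma hitting_markov x y D : E x -> measurable D ->
  P x [set w | (hitting_time y w < +oo)%E /\
    D (fine (hitting_time y w), shift_path (fine (hitting_time y w)) w)] =
  (\int[P x]_(w in [set w | hitting_time y w < +oo])
     P y [set w' | D (fine (hitting_time y w), w')])%E.
Proof.
move=> Ex mD.
have pT := proper_hitting_time y.
have := strong_markov_pair Ex pT (stopped_eventsT pT) mD.
rewrite !setTI => ->; apply: eq_integral => w; rewrite inE /= => Tw.
have : hitting_time y w \is a fin_num by rewrite ge0_fin_numE// hitting_timeE first_zero_ge0.
move=> /fineK/esym; rewrite {1}hitting_timeE => /first_zero_finP[].
  by move=> t; apply: cvgB; [exact: path_cont|exact: cvg_cst].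
by move=> _ /eqP; rewrite subr_eq0 => /eqP -> _.
Qed.

Lemma hitting_markov_integral x y (f : R * cpath R -> \bar R) : E x ->
  measurable_fun setT f -> (forall p, 0 <= f p)%E ->
  (\int[P x]_(w in [set w | hitting_time y w < +oo])
    f (fine (hitting_time y w), shift_path (fine (hitting_time y w)) w) =
  \int[P x]_(w in [set w | hitting_time y w < +oo])
     \int[P y]_w' f (fine (hitting_time y w), w'))%E.
Proof.
move=> Ex mf f0.
have pT := proper_hitting_time y.
have := strong_markov_integral Ex pT (stopped_eventsT pT) mf f0.
rewrite !setTI => ->; apply: eq_integral => w; rewrite inE /= => Tw.
have : hitting_time y w \is a fin_num by rewrite ge0_fin_numE// hitting_timeE first_zero_ge0.
move=> /fineK/esym; rewrite {1}hitting_timeE => /first_zero_finP[].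
  by move=> t; apply: cvgB; [exact: path_cont|exact: cvg_cst].
by move=> _ /eqP; rewrite subr_eq0 => /eqP -> _.
Qed.

Lemma state_ae x t : E x -> 0 <= t -> \forall w \ae P x, E ((w : cpath R) t).
Proof.
move=> Ex t0; have := diff_state P_diff Ex.
by apply: filterS => w; apply.
Qed.

Lemma hitting_ae x y : E x -> E y -> \forall w \ae P x, (hitting_time y w < +oo)%E.
Proof.
move=> Ex Ey; have h := diff_recurrent P_diff Ex Ey.
have mH : measurable [set w : cpath R | (hitting_time y w < +oo)%E].
  by apply: measurable_time_lt; exact: proper_measurable (proper_hitting_time y).
apply/negligibleP; first exact: measurableC.
by have := probability_setC (kernel_law P x) mH; rewrite /kernel_law h subee.
Qed.

Lemma measurable_law_eval t B : measurable B -> measurable_fun setT (fun w : cpath R => P (w t) B).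
Proof. by move=> mB; exact: (measurableT_comp (measurable_kernel P B mB) (measurable_eval t)). Qed.

(** If the Markov integral vanished, its nonnegative integrand would vanish almost everywhere on
    [A], where it is positive. *)
Lemma simple_markov_gt0 x t A B : E x -> 0 <= t -> natural_filtration t A ->
  measurable B -> (0 < P x A)%E -> (forall w, A w -> E (w t) -> (0 < P (w t) B)%E) ->
  (0 < P x (A `&` shift_path t @^-1` B))%E.
Proof.
move=> Ex t0 FA mB A0 AB; have mA := natural_filtration_measurable FA.
rewrite lt0e measure_ge0 andbT simple_markov//; apply/eqP => int0.
have := @ae_eq_integral_abs _ _ _ (P x) A mA (fun w => P (w t) B)
  (measurable_funTS (measurable_law_eval t mB)).
move=> [+ _]; have h w : (`|P (w t) B| = P (w t) B)%E by rewrite gee0_abs.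
rewrite (eq_integral (fun w : cpath R => P (w t) B)); last by move=> w _; exact: h.
move=> /(_ int0) ae0.
have : \forall w \ae P x, ~ A w.
  move: ae0 (state_ae Ex t0); apply: filterS2 => w h1 h2 Aw.
  by have := AB _ Aw h2; rewrite (h1 Aw) ltxx.
move=> /negligibleP; rewrite (_ : ~` _ = A) => [|]; last first.
  by apply/seteqP; split => w /=; [move=> /contrapT|move=> ? ?].
by move=> /(_ mA) A00; move: A0; rewrite A00 ltxx.
Qed.


(** * Domain of the generator *)

Hypothesis Sm : scale_and_speed b k S m.
Local Notation leb := (@lebesgue_measure R).

Let state_itv d : E d -> forall x, 0 <= x -> x <= d -> E x.
Proof. by move=> Ed x x0 xd; exact: state_space_itv xd. Qed.

Let within_state d (f : R -> R) : E d -> {within E, continuous f} ->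
  {within `[0, d], continuous f}.
Proof.
move=> Ed; apply: continuous_subspaceW => x /=; rewrite in_itv/= => /andP[].
exact: state_itv.
Qed.

Lemma is_derive_scale x : I x -> is_derive x 1 S ((derive1 S) x).
Proof. by move=> Ix; rewrite derive1E; apply: derivableP; exact: (ss_S_derivable Sm). Qed.

Lemma scale_continuous x : I x -> {for x, continuous S}.
Proof.
move=> Ix; apply: differentiable_continuous; apply/derivable1_diffP.
exact: (ss_S_derivable Sm).
Qed.

Lemma scale_lt x y : 0 <= x -> E y -> x < y -> S x < S y.
Proof.
move=> x0 Ey xy; rewrite -subr_gt0.
have Iz z : z \in `]x, y[ -> I z.
  by rewrite in_itv/= => /andP[xz zy]; apply: state_space_lt Ey _ zy; exact: le_lt_trans xz.
have [] := @MVT R S (derive1 S) x y xy.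
- by move=> z /Iz; exact: is_derive_scale.
- apply: continuous_subspaceW (ss_S_cont Sm) => z /=; rewrite in_itv/= => /andP[xz zy].
  by apply: state_itv Ey _ _ zy; exact: le_trans xz.
move=> z /Iz Iz' ->; rewrite mulr_gt0 ?subr_gt0//.
exact: (ss_dS_gt0 Sm).
Qed.

Lemma scale_le x y : 0 <= x -> E y -> x <= y -> S x <= S y.
Proof.
by move=> x0 Ey; rewrite le_eqVlt => /predU1P[->//|xy]; rewrite ltW// scale_lt.
Qed.

Lemma open_state_interior : open I.
Proof.
rewrite (_ : I = [set x | 0 < x] `&` [set x | (x%:E < b)%E]).
  apply: openI; first exact: open_gt.
  case: b => [c| |].
  - rewrite (_ : [set x | _] = [set x | x < c]); first exact: open_lt.
    by apply/seteqP; split => x /=; rewrite lte_fin.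
  - rewrite (_ : [set x | _] = setT); first exact: openT.
    by apply/seteqP; split => x //= _; rewrite ltry.
  - rewrite (_ : [set x | _] = set0); first exact: open0.
    by apply/seteqP; split => x //=; rewrite ltNge leNye.
by apply/seteqP; split => x.
Qed.

Lemma measurable_state_interior : measurable I.
Proof. by apply: open_measurable; exact: open_state_interior. Qed.

Lemma measurable_state_space : measurable E.
Proof.
rewrite (_ : E = `[0, +oo[ `&` [set x | if k is Reflecting then (x%:E <= b)%E else (x%:E < b)%E]).
  apply: measurableI; first exact: measurable_itv.
  have mE : measurable_fun setT (EFin \o (id : R -> R)) by exact/measurable_EFinP.
  have h (J : interval (\bar R)) : measurable [set x : R | x%:E \in J].
    by rewrite -[X in measurable X]setTI; exact: (mE measurableT _ (emeasurable_itv J)).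
  case: (k).
  - by have := h `]-oo, b]; congr measurable; apply/seteqP; split => x /=; rewrite in_itv.
  - by have := h `]-oo, b[; congr measurable; apply/seteqP; split => x /=; rewrite in_itv.
  - by have := h `]-oo, b[; congr measurable; apply/seteqP; split => x /=; rewrite in_itv.
by apply/seteqP; split => x /=; rewrite in_itv/= andbT.
Qed.

(** Extension by 0 outside the interior, so that the density is measurable and integrable on the
    whole line. *)
Definition speed_density : R -> R := m \_ I.

Lemma speed_densityE x : I x -> speed_density x = m x.
Proof. by move=> Ix; rewrite /speed_density patchE mem_set. Qed.

Lemma speed_density_ge0 x : 0 <= speed_density x.
Proof.
rewrite /speed_density patchE; case: ifPn => // /[!inE] Ix.
by rewrite ltW//; exact: (ss_m_gt0 Sm).
Qed.

Lemma speed_density_integrable A : measurable A ->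
  leb.-integrable A (EFin \o speed_density).
Proof.
move=> mA; apply: (@integrableS _ _ _ leb setT) => //.
have mm : measurable_fun I m.
  apply: open_continuous_measurable_fun; first exact: open_state_interior.
  by move=> x /[!inE]; exact: (ss_m_cont Sm).
have mI := measurable_state_interior.
apply/integrableP; split.
  by apply/measurable_EFinP; apply/(measurable_restrictT _ mI).
rewrite (_ : (\int[leb]_(x in setT) _)%E = (\int[leb]_(x in I) (m x)%:E)%E); last first.
  rewrite [RHS]integral_mkcond; apply: eq_integral => x _ /=.
  by rewrite ger0_norm ?speed_density_ge0// /speed_density !patchE; case: ifP.
exact: (ss_mass Sm).
Qed.

Lemma integrable_scale A (f : R -> R) c : leb.-integrable A (EFin \o f) -> measurable A ->
  leb.-integrable A (EFin \o (fun u => c * f u)).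
Proof. by move=> fi mA; have := integrableZl mA c fi. Qed.

Section weighted_cdf.
Variables (phi : R -> R) (C : R).
Hypotheses (mphi : measurable_fun setT phi) (phiC : forall u, `|phi u| <= C).

(* The distribution function of the measure with density [phi] with respect
   to the speed measure. *)
Definition wcdf (x : R) : R := \int[leb]_(u in `]0, x]) (phi u * speed_density u).

Lemma weighted_integrable A : measurable A ->
  leb.-integrable A (EFin \o (fun u => phi u * speed_density u)).
Proof.
move=> mA.
have := @integrableMr _ _ _ leb A mA phi (EFin \o speed_density) (measurable_funTS mphi).
apply; last exact: speed_density_integrable.
exists C; split; first exact: num_real.
by move=> r Cr u _ /=; rewrite (le_trans (phiC _))// ltW.
Qed.

Lemma wcdfB x y : 0 <= x -> x <= y ->
  wcdf y - wcdf x = \int[leb]_(u in `]x, y]) (phi u * speed_density u).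
Proof. by move=> x0 xy; rewrite /wcdf Rintegral_itvB//; exact: weighted_integrable. Qed.

Lemma wcdf_derive x : I x -> {for x, continuous phi} -> is_derive x 1 wcdf (phi x * m x).
Proof.
move=> Ix cphi.
have x1 : x < x + 1 by rewrite ltrDl.
have := @continuous_FTC1 _ (fun u => phi u * speed_density u) (BRight 0) x _ x1
  (weighted_integrable (measurable_itv _)).
move=> /=; rewrite /Order.lt/= => /(_ Ix.1) h.
rewrite -[m x]speed_densityE//.
have [|d dE] := h; last by rewrite -dE derive1E; apply: derivableP.
apply: cvgM; first exact: cphi.
rewrite speed_densityE//; apply: cvg_trans (ss_m_cont Sm Ix); apply: near_eq_cvg.
have : \forall y \near x, I y by exact: open_state_interior.
by apply: filterS => y Iy; rewrite speed_densityE.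
Qed.

End weighted_cdf.

Local Notation M := (wcdf (fun=> 1)).

Let norm11 (u : R) : `|(fun=> 1 : R) u| <= 1. Proof. by rewrite normr1. Qed.

Lemma wcdf_le (phi : R -> R) C x y : measurable_fun setT phi -> (forall u, `|phi u| <= C) ->
  0 <= x -> x <= y -> `|wcdf phi y - wcdf phi x| <= C * (M y - M x).
Proof.
move=> mphi phiC x0 xy; rewrite !(wcdfB _ phiC)// !(wcdfB _ norm11)//.
have mA : measurable `]x, y] by exact: measurable_itv.
have int1 := weighted_integrable (measurable_cst (1 : R)) norm11 mA.
have intphi := weighted_integrable mphi phiC mA.
rewrite -RintegralZl//.
apply: (le_trans (le_normr_Rintegral _ intphi)) => //.
apply: le_Rintegral => //.
- exact: integrable_norm intphi.
- exact: integrable_scale int1 mA.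
move=> u _; rewrite normrM mul1r (ger0_norm (speed_density_ge0 u)).
by rewrite ler_wpM2r// speed_density_ge0.
Qed.

Lemma speed_le x y : 0 <= x -> x <= y -> M x <= M y.
Proof.
move=> x0 xy; rewrite -subr_ge0 (wcdfB _ norm11)//.
by apply: Rintegral_ge0 => u _; rewrite mul1r speed_density_ge0.
Qed.

(** Absolute continuity of the integral of an integrable density. *)
Lemma speed_uniformly_continuous e : 0 < e -> exists2 r, 0 < r &
  forall x y, 0 <= x -> x <= y -> y - x < r -> M y - M x < e.
Proof.
move=> e0; have := speed_density_integrable measurableT.
move=> /integral_normr_continuous /(_ _ e0)[r [r0 hr]]; exists r => // x y x0 xy yxr.
rewrite (wcdfB _ norm11)//.
have lxy : (leb `]x, y] < r%:E)%E.
  by rewrite lebesgue_measure_itv/= lte_fin; case: ifPn => _; rewrite -?EFinB lte_fin.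
apply: le_lt_trans (hr _ (measurable_itv _) lxy); rewrite le_eqVlt; apply/orP; left.
by apply/eqP/eq_Rintegral => u _; rewrite mul1r ger0_norm ?speed_density_ge0.
Qed.

Lemma speed_cdf_derive x : I x -> is_derive x 1 (speed_cdf m) (m x).
Proof.
move=> Ix; have [d dE] := wcdf_derive (measurable_cst (1 : R)) norm11 Ix (@cvg_cst _ _ _ _ _).
have e : \forall y \near x, M y = speed_cdf m y.
  have : \forall y \near x, I y by exact: open_state_interior.
  apply: filterS => y Iy; apply: eq_Rintegral => u; rewrite inE/= in_itv/= => /andP[u0 uy].
  rewrite mul1r speed_densityE//; move: uy; rewrite le_eqVlt => /predU1P[->//|uy].
  exact: (state_space_lt (state_interiorW Iy)).
apply: DeriveDef; first exact: near_eq_derivable e d.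
by rewrite -(near_eq_derive _ e) dE mul1r.
Qed.

Lemma deriv_wrt_speed (h : R -> R) x a : I x -> is_derive x 1 h (a * m x) ->
  deriv_wrt (speed_cdf m) h x x^' a.
Proof.
move=> Ix dh; have m0 : m x != 0 by rewrite gt_eqF//; exact: (ss_m_gt0 Sm).
have h1 := is_derive_quotient dh.
have h2 := is_derive_quotient (speed_cdf_derive Ix).
have h3 : (h y - h x) / (y - x) *
    ((speed_cdf m y - speed_cdf m x) / (y - x))^-1 @[y --> x^'] --> a.
  by rewrite -[a](mulfK m0); apply: cvgM => //; apply: cvgV.
apply: cvg_trans h3; apply: near_eq_cvg.
near=> y; have yx0 : y - x != 0.
  by rewrite subr_eq0; near: y; exact: nbhs_dnbhs_neq.
by rewrite invf_div mulrA divfK.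
Unshelve. all: by end_near. Qed.

Lemma deriv_wrt_scale (p : R -> R) x a : I x -> is_derive (S x) 1 p a ->
  deriv_wrt S (p \o S) x x^' a.
Proof.
move=> Ix /is_derive_quotient dp.
have SS : S y @[y --> x^'] --> (S x)^'.
  move=> A hA; suff : \forall y \near x, y != x -> A (S y) by [].
  have {}hA : \forall z \near S x, z != S x -> A z by exact: hA.
  have : \forall y \near x, S y != S x -> A (S y) by exact: (scale_continuous Ix hA).
  have : \forall y \near x, I y by exact: open_state_interior.
  apply: filterS2 => y Iy hy yx; apply: hy.
  have [xy|xy|xy] := ltgtP x y; last by rewrite xy eqxx in yx.
    by rewrite gt_eqF// scale_lt// ?(ltW Ix.1)//; exact: state_interiorW.
  by rewrite lt_eqF// scale_lt// ?(ltW Iy.1)//; exact: state_interiorW.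
exact: cvg_comp SS dp.
Qed.

Section bump_domain.
Variables (c1 c2 : R) (n : nat).
Hypotheses (I1 : I c1) (I2 : I c2) (c12 : c1 < c2).

(** Projection onto $[c1,c2]$. The bump and its second derivative vanish in the scale variable at
    both ends and outside, so the projection keeps the values inside the state interval, while
    making the functions continuous and bounded on all of [R]. *)
Let clamp (x : R) : R := Num.max c1 (Num.min x c2).

Let clamp_itv x : c1 <= clamp x <= c2.
Proof. by rewrite /clamp le_max lexx/= ge_max ge_min (ltW c12) lexx orbT. Qed.

Let clampI x : I (clamp x).
Proof.
have /andP[h1 h2] := clamp_itv x.
have [-> //|h3] := eqVneq (clamp x) c2.
apply: (state_space_lt (state_interiorW I2)); first exact: lt_le_trans I1.1 h1.
by rewrite lt_neqAle h3.
Qed.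

Let clamp_continuous : continuous clamp.
Proof.
move=> r; apply: (@continuous_max _ _ (fun=> c1) (fun r => Num.min r c2)).
  exact: cvg_cst.
by apply: (@continuous_min _ _ id (fun=> c2)); [exact: cvg_id|exact: cvg_cst].
Qed.

Let clamp_comp (f : R -> R) : (forall x, I x -> {for x, continuous f}) ->
  continuous (f \o clamp).
Proof. by move=> cf x; apply: continuous_comp; [exact: clamp_continuous|exact: cf]. Qed.

Let clamp_bounded (f : R -> R) : (forall x, I x -> {for x, continuous f}) ->
  exists C : R, forall x, `|f (clamp x)| <= C.
Proof.
move=> cf; have [c _ hc] : exists2 c, c \in `[c1, c2] & forall x, x \in `[c1, c2] -> `|f x| <= `|f c|.
  apply: EVT_max; first exact: ltW.
  apply: (@continuous_in_subspaceT _ _ _ (fun x => `|f x|)) => x; rewrite inE/= in_itv/= => /andP[h1 h2].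
  have Ix : I x.
    have [-> //|h3] := eqVneq x c2.
    apply: (state_space_lt (state_interiorW I2)); first exact: lt_le_trans I1.1 h1.
    by rewrite lt_neqAle h3.
  by apply: continuous_comp; [exact: cf|exact: norm_continuous].
by exists `|f c| => x; apply: hc; rewrite in_itv/=; exact: clamp_itv.
Qed.

Let al := S c1.
Let be := S c2.

Definition bump_fun (x : R) : R := bump al be n (S (clamp x)).

(** The scale derivative of $p\circ S$ is $p'\circ S$, and the speed derivative of the latter is
    $p''(S)\,S'/m$. *)
Definition bump_gen (x : R) : R :=
  bump2 al be n (S (clamp x)) * (derive1 S (clamp x) / m (clamp x)).

Let quad_le0 x : 0 <= x -> E x -> ~~ (c1 < x < c2) -> Num.max ((S x - al) * (be - S x)) 0 = 0.
Proof.
move=> x0 Ex nx; apply: max_r; have [xc|cx] := leP x c1.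
  apply: mulr_le0_ge0; rewrite ?subr_le0 ?subr_ge0; apply: scale_le => //.
  - exact: state_interiorW.
  - exact: state_interiorW.
  - by rewrite (le_trans xc)// ltW.
move: nx; rewrite cx/= -leNgt => cx2.
apply: mulr_ge0_le0; rewrite ?subr_le0 ?subr_ge0; apply: scale_le => //.
- exact: ltW I1.1.
- exact: ltW.
- exact: ltW I2.1.
Qed.

Let quad_clamp x : 0 <= x -> E x ->
  Num.max ((S (clamp x) - al) * (be - S (clamp x))) 0 = Num.max ((S x - al) * (be - S x)) 0.
Proof.
move=> x0 Ex; have [/andP[h1 h2]|h] := boolP (c1 < x < c2).
  by rewrite /clamp [Num.min _ _]min_l ?ltW// [Num.max c1 _]max_r ?ltW.
rewrite [RHS]quad_le0//; move: h; rewrite negb_and -!leNgt => h.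
have : clamp x = c1 \/ clamp x = c2.
  rewrite /clamp; case/orP: h => h.
    by left; rewrite [Num.min _ _]min_l ?(le_trans h (ltW c12))// max_l.
  by right; rewrite [Num.min _ _]min_r// max_r// ltW.
by case=> ->; rewrite subrr ?mulr0 ?mul0r maxxx.
Qed.

Lemma bump_funE x : E x -> bump_fun x = bump al be n (S x).
Proof. by move=> Ex; rewrite /bump_fun /bump quad_clamp//; case: Ex. Qed.

Lemma bump_genE x : I x -> bump_gen x = bump2 al be n (S x) * (derive1 S x / m x).
Proof.
move=> Ix; have Ex := state_interiorW Ix; rewrite /bump_gen.
have [/andP[h1 h2]|h] := boolP (c1 < x < c2).
  by rewrite /clamp [Num.min _ _]min_l ?ltW// [Num.max c1 _]max_r ?ltW.
have z := quad_le0 (ltW Ix.1) Ex h.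
have z' : Num.max ((S (clamp x) - al) * (be - S (clamp x))) 0 = 0.
  by rewrite quad_clamp ?(ltW Ix.1).
by rewrite /bump2 z z' !expr0n/=; ring.
Qed.

Lemma bump_fun0 x : ~~ (c1 < x < c2) -> bump_fun x = 0.
Proof.
rewrite negb_and -!leNgt => h; have : clamp x = c1 \/ clamp x = c2.
  rewrite /clamp; case/orP: h => h.
    by left; rewrite [Num.min _ _]min_l ?(le_trans h (ltW c12))// max_l.
  by right; rewrite [Num.min _ _]min_r// max_r// ltW.
by rewrite /bump_fun /bump; case=> ->; rewrite subrr ?mulr0 ?mul0r maxxx expr0n.
Qed.

Lemma bump_gen0 x : ~~ (c1 < x < c2) -> bump_gen x = 0.
Proof.
rewrite negb_and -!leNgt => h; have : clamp x = c1 \/ clamp x = c2.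
  rewrite /clamp; case/orP: h => h.
    by left; rewrite [Num.min _ _]min_l ?(le_trans h (ltW c12))// max_l.
  by right; rewrite [Num.min _ _]min_r// max_r// ltW.
by rewrite /bump_gen /bump2; case=> ->; rewrite subrr ?mulr0 ?mul0r maxxx !expr0n/=; ring.
Qed.

Let bump_cont s : {for s, continuous (bump al be n)}.
Proof.
by apply: differentiable_continuous; apply/derivable1_diffP; case: (is_derive_bump al be s n).
Qed.

Let bump2_cont : continuous (bump2 al be n).
Proof.
have cq : continuous (fun s : R => Num.max ((s - al) * (be - s)) 0).
  move=> s; apply: (@continuous_max _ _ (fun s => (s - al) * (be - s)) (fun=> 0)); last exact: cvg_cst.
  by apply: cvgM; apply: cvgB; try exact: cvg_id; exact: cvg_cst.
have cl : continuous (fun s : R => al + be - 2 * s).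
  by move=> s; apply: cvgB; [exact: cvg_cst|apply: cvgM; [exact: cvg_cst|exact: cvg_id]].
move=> s; apply: cvgM; first exact: cvg_cst.
apply: cvgB; last first.
  by apply: cvgM; [exact: cvg_cst|exact: (continuous_comp (cq s) (@exprn_continuous _ _ _))].
apply: cvgM.
  by apply: cvgM; [exact: cvg_cst|exact: (continuous_comp (cq s) (@exprn_continuous _ _ _))].
exact: (continuous_comp (cl s) (@exprn_continuous _ _ _)).
Qed.

Let fcont x : I x -> {for x, continuous (bump al be n \o S)}.
Proof. by move=> Ix; apply: continuous_comp; [exact: scale_continuous|exact: bump_cont]. Qed.

Let gcont x : I x ->
  {for x, continuous (fun x => bump2 al be n (S x) * (derive1 S x / m x))}.
Proof.
move=> Ix; apply: cvgM.
  by apply: continuous_comp; [exact: scale_continuous|exact: bump2_cont].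
apply: cvgM; first exact: (ss_dS_cont Sm).
by apply: cvgV; [rewrite gt_eqF//; exact: (ss_m_gt0 Sm)|exact: (ss_m_cont Sm)].
Qed.

Lemma bump_fun_continuous : continuous bump_fun.
Proof. exact: clamp_comp fcont. Qed.

Lemma bump_gen_continuous : continuous bump_gen.
Proof. exact: clamp_comp gcont. Qed.

Lemma bump_fun_bounded : exists C, forall x, `|bump_fun x| <= C.
Proof. exact: clamp_bounded fcont. Qed.

Lemma bump_gen_bounded : exists C, forall x, `|bump_gen x| <= C.
Proof. exact: clamp_bounded gcont. Qed.

(** The witness for the scale derivative is [bump1] composed with [S]. The conditions at the end
    points hold because the function vanishes near them. *)
Lemma bump_domain : dm_dS b k S m bump_fun bump_gen.
Proof.
split.
- split; first by apply: continuous_subspaceT; exact: bump_fun_continuous.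
  by have [C hC] := bump_fun_bounded; exists C.
- split; first by apply: continuous_subspaceT; exact: bump_gen_continuous.
  by have [C hC] := bump_gen_bounded; exists C.
exists (bump1 al be n \o S); split.
- move=> x Ix; apply: cvg_trans (deriv_wrt_scale Ix (is_derive_bump al be (S x) n)).
  apply: near_eq_cvg; apply: nbhs_dnbhs.
  have : \forall y \near x, I y by exact: open_state_interior.
  by apply: filterS => y Iy /=; rewrite !bump_funE//; exact: state_interiorW.
- move=> x Ix; apply: (deriv_wrt_speed Ix); have m0 := ss_m_gt0 Sm Ix.
  rewrite (bump_genE Ix) -[X in is_derive _ _ _ X]mulrA (divfK (lt0r_neq0 m0)).
  exact: is_derive1_comp (is_derive_bump1 al be (S x) n) (is_derive_scale Ix).
- apply: cvg_near_cst; near=> y; rewrite !bump_fun0 ?subrr ?mul0r//.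
    by rewrite ltNge (ltW I1.1).
  by rewrite (ltNge c1 y) (_ : y <= c1)//; near: y; apply: nbhs_right_le; exact: I1.1.
- move=> kR; have bf : b \is a fin_num.
    by rewrite fin_real//; apply/andP; split; [exact: lt_le_trans (ltNyr 0) (ltW (ss_b_gt0 Sm))|exact: (ss_b_fin Sm kR)].
  have c2b : c2 < fine b by rewrite -lte_fin fineK//; case: I2.
  apply: cvg_near_cst; near=> y; rewrite !bump_fun0 ?subrr ?mul0r//.
    by rewrite (ltNge _ c2) (ltW c2b) andbF.
  by rewrite (ltNge y c2) (_ : c2 <= y) ?andbF//; near: y; apply: nbhs_left_ge.
Unshelve. all: by end_near. Qed.

End bump_domain.

Section integral_domain.
Variables (g : R -> R) (C d : R).
Hypotheses (cg : continuous g) (gC : forall u, `|g u| <= C).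
Hypotheses (Ed : E d) (d0 : 0 < d) (kd : k = Reflecting -> d = fine b).
Hypotheses (gd : forall x, E x -> d < x -> g x = 0) (g0 : wcdf g d = 0).

Let mg : measurable_fun setT g. Proof. exact: continuous_measurable_fun. Qed.

Let C0 : 0 <= C. Proof. exact: le_trans (normr_ge0 _) (gC 0). Qed.

Let clamp (x : R) : R := Num.max 0 (Num.min x d).

Let clampE x : 0 <= x -> x <= d -> clamp x = x.
Proof. by move=> x0 xd; rewrite /clamp min_l// max_r. Qed.

Let clamp_itv x : 0 <= clamp x <= d.
Proof. by rewrite /clamp le_max lexx/= ge_max ge_min (ltW d0) lexx orbT. Qed.

Let measurable_clamp : measurable_fun setT (S \o clamp).
Proof.
apply: (@measurable_comp _ _ _ _ _ _ `[0, d]%classic) => //.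
- by move=> _ [x _ <-] /=; rewrite in_itv/=; exact: clamp_itv.
- apply: subspace_continuous_measurable_fun => //.
  exact: within_state Ed (ss_S_cont Sm).
apply: continuous_measurable_fun => r.
apply: (@continuous_max _ _ (fun=> 0) (fun r => Num.min r d)); first exact: cvg_cst.
by apply: (@continuous_min _ _ id (fun=> d)); [exact: cvg_id|exact: cvg_cst].
Qed.

Let weight x u := (S x - S (clamp u)) * g u.

Let mweight x : measurable_fun setT (weight x).
Proof. by apply: measurable_funM => //; apply: measurable_funB. Qed.

Let weightC x : exists K, forall u, `|weight x u| <= K.
Proof.
exists ((`|S x| + (`|S 0| + `|S d|)) * C) => u; rewrite normrM ler_pM//.
rewrite (le_trans (ler_normB _ _))// lerD2l.
have /andP[c0 cd] := clamp_itv u.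
have h1 : S 0 <= S (clamp u) by apply: scale_le => //; exact: state_itv Ed _ _ cd.
have h2 : S (clamp u) <= S d by apply: scale_le.
rewrite ler_norml; apply/andP; split.
  by rewrite (le_trans _ h1)// lerNl (le_trans (ler_norm _))// normrN lerDl.
by rewrite (le_trans h2)// (le_trans (ler_norm _))// lerDr.
Qed.

Let weight_integrable x A : measurable A ->
  leb.-integrable A (EFin \o (fun u => weight x u * speed_density u)).
Proof.
by move=> mA; have [K hK] := weightC x; exact: weighted_integrable (mweight x) hK _ mA.
Qed.

(** The solution $f(x)=\int_0^x(S(x)-S(u))\,g(u)\,m(du)$ of $\frac{d}{dm}\frac{d}{dS}f=g$ with
    $f(0)=0$ and zero scale derivative at 0; its scale derivative is [wcdf g]. The condition [g0]
    makes the latter vanish at [d], so that [f] obeys the condition at a reflecting end, or is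
    constant from [d] on and thereby bounded. *)
Definition int_fun (x : R) : R := wcdf (weight x) x.

(** The remainder is $\int_x^y(S(y)-S(u))\,g(u)\,m(du)$, where $S(y)-S(u)\le S(y)-S(x)$. *)
Let int_fun_incr x y : 0 <= x -> x <= y -> E y ->
  `|int_fun y - int_fun x - (S y - S x) * wcdf g x| <= (S y - S x) * (C * (M y - M x)).
Proof.
move=> x0 xy Ey; have [K hK] := weightC y.
have intg A : measurable A -> leb.-integrable A (EFin \o (fun u => g u * speed_density u)).
  by move=> mA'; exact: (weighted_integrable mg gC mA').
have Sxy : 0 <= S y - S x by rewrite subr_ge0 scale_le.
have e : wcdf (weight y) x - wcdf (weight x) x = (S y - S x) * wcdf g x.
  rewrite /wcdf -RintegralB//; [|exact: weight_integrable..].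
  rewrite -RintegralZl//; last exact: intg.
  by apply: eq_Rintegral => u _; rewrite /weight; ring.
rewrite -e (_ : _ - _ = wcdf (weight y) y - wcdf (weight y) x); last first.
  by rewrite /int_fun; ring.
rewrite (wcdfB (mweight y) hK)//.
have mA : measurable `]x, y] by exact: measurable_itv.
have int1 := weighted_integrable (measurable_cst (1 : R)) norm11 mA.
rewrite (wcdfB (measurable_cst (1 : R)) norm11)// mulrA -RintegralZl//.
apply: (le_trans (le_normr_Rintegral _ (weight_integrable y mA))) => //.
apply: le_Rintegral => //.
- exact: integrable_norm (weight_integrable y mA).
- exact: (integrable_scale _ int1 mA).
move=> u /=; rewrite in_itv/= => /andP[xu uy].
rewrite normrM mul1r (ger0_norm (speed_density_ge0 u)) ler_wpM2r ?speed_density_ge0//.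
have u0 : 0 <= u by rewrite ltW// (le_lt_trans x0).
have Eu : E u by exact: state_itv Ey _ u0 uy.
rewrite /weight normrM; have [ud|du] := leP u d; last first.
  by rewrite gd// normr0 mulr0 mulr_ge0.
rewrite clampE// ler_pM//.
rewrite ger0_norm ?subr_ge0 ?scale_le// lerD2l lerN2 scale_le//.
exact: ltW.
Qed.

Let int_fun_cst x : E x -> d <= x -> int_fun x = int_fun d.
Proof.
move=> Ex dx; have [K hK] := weightC x.
have intg A : measurable A -> leb.-integrable A (EFin \o (fun u => g u * speed_density u)).
  by move=> mA'; exact: (weighted_integrable mg gC mA').
have : wcdf (weight x) x - wcdf (weight x) d = 0.
  rewrite (wcdfB (mweight x) hK) ?(ltW d0)//.
  rewrite (@eq_Rintegral _ _ _ _ _ (fun=> 0)); last first.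
    move=> u; rewrite inE/= in_itv/= => /andP[du ux].
    by rewrite /weight gd ?mulr0 ?mul0r//; apply: state_itv Ex _ _ ux; rewrite ltW// (lt_trans d0).
  by rewrite Rintegral_cst// mul0r.
move=> /eqP; rewrite subr_eq0 => /eqP; rewrite /int_fun => ->.
apply/eqP; rewrite -subr_eq0; apply/eqP.
rewrite /wcdf -RintegralB//; [|exact: weight_integrable..].
transitivity (\int[leb]_(u in `]0, d]) ((S x - S d) * (g u * speed_density u))).
  by apply: eq_Rintegral => u _; rewrite /weight; ring.
by rewrite RintegralZl//; [rewrite [X in _ * X]g0 mulr0|exact: intg].
Qed.

(** The bound uses the speed integral of $|g|$ and not its supremum: a narrow [g] then has a
    uniformly small solution. *)
Lemma int_fun_le x : E x -> `|int_fun x| <= (S d - S 0) * wcdf (fun u => `|g u|) d.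
Proof.
move=> Ex; wlog xd : x Ex / x <= d.
  move=> h; have [xd|dx] := leP x d; first exact: h.
  by rewrite int_fun_cst ?(ltW dx)//; exact: h.
have x0 : 0 <= x by case: Ex.
have intg A : measurable A -> leb.-integrable A (EFin \o (fun u => `|g u| * speed_density u)).
  move=> mA; apply: (@weighted_integrable (fun u => `|g u|) C) => //.
    exact: measurableT_comp.
  by move=> u; rewrite normr_id.
have mA : measurable `]0, x] by exact: measurable_itv.
apply: (le_trans (le_normr_Rintegral _ (weight_integrable x mA))) => //.
have Sd : 0 <= S d - S 0 by rewrite subr_ge0 scale_le// ltW.
rewrite (@le_trans _ _ ((S d - S 0) * wcdf (fun u => `|g u|) x))//; last first.
  rewrite ler_wpM2l// -subr_ge0 (@wcdfB _ C)//.
  - by apply: Rintegral_ge0 => u _; rewrite mulr_ge0 ?speed_density_ge0.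
  - exact: measurableT_comp.
  - by move=> u; rewrite normr_id.
rewrite /wcdf -RintegralZl//; last exact: intg.
apply: le_Rintegral => //.
- exact: integrable_norm (weight_integrable x mA).
- by apply: (@integrable_scale `]0, x] (fun u => `|g u| * speed_density u)); [exact: intg|].
move=> u /=; rewrite in_itv/= => /andP[u0 ux].
rewrite normrM (ger0_norm (speed_density_ge0 u)) mulrA ler_wpM2r ?speed_density_ge0//.
have ud := le_trans ux xd.
rewrite /weight normrM clampE ?(ltW u0)// ler_wpM2r//.
rewrite ger0_norm ?subr_ge0 ?scale_le ?(ltW u0)// lerB// scale_le ?(ltW u0)//.
exact: state_itv Ed _ (ltW u0) ud.
Qed.

(** For [x < y] this is [int_fun_incr] divided by the scale increment. Exchanging the points
    replaces [wcdf g x] by [wcdf g y], which costs the same amount once more; hence the factor 2. *)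
Let quot x y : E x -> E y -> x != y ->
  `|(int_fun y - int_fun x) / (S y - S x) - wcdf g x| <= 2 * C * `|M y - M x|.
Proof.
move=> Ex Ey; wlog suff h : x y Ex Ey / x < y ->
    `|(int_fun y - int_fun x) / (S y - S x) - wcdf g x| <= C * (M y - M x).
  rewrite neq_lt => /orP[xy|yx].
    have x0 : 0 <= x by case: Ex.
    have Mxy : 0 <= M y - M x by rewrite subr_ge0 speed_le// ltW.
    apply: (le_trans (h _ _ Ex Ey xy)); rewrite (ger0_norm Mxy).
    by rewrite ler_wpM2r// ler_peMl// ler1n.
  have y0 : 0 <= y by case: Ey.
  have Mxy : 0 <= M x - M y by rewrite subr_ge0 speed_le// ltW.
  have h1 := h _ _ Ey Ex yx.
  have h2 := @wcdf_le g C y x mg gC y0 (ltW yx).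
  rewrite -[S y - S x]opprB -[int_fun y - _]opprB invrN mulrNN.
  rewrite [X in _ <= _ * X]distrC (ger0_norm Mxy).
  rewrite (_ : _ - wcdf g x = (int_fun x - int_fun y) / (S x - S y) - wcdf g y - (wcdf g x - wcdf g y)); last by ring.
  by rewrite (le_trans (ler_normB _ _))//; lra.
move=> xy; have x0 : 0 <= x by case: Ex.
have Sxy : 0 < S y - S x by rewrite subr_gt0 scale_lt.
have := int_fun_incr x0 (ltW xy) Ey.
rewrite -[X in _ <= X -> _]mulrC -ler_pdivrMr// => h; apply: le_trans h.
rewrite (_ : _ / _ - _ = (int_fun y - int_fun x - (S y - S x) * wcdf g x) / (S y - S x)); last first.
  by field; rewrite gt_eqF.
by rewrite normf_div (gtr0_norm Sxy).
Qed.

Lemma int_domain : dm_dS b k S m int_fun g.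
Proof.
have bint : exists K, forall x, E x -> `|int_fun x| <= K.
  by exists ((S d - S 0) * wcdf (fun u => `|g u|) d) => x; exact: int_fun_le.
have E0 : E 0 by exact: state_itv Ed _ _ (ltW d0).
have hC : forall x, E x -> forall e, 0 < e -> exists2 r, 0 < r & forall y, E y -> `|x - y| < r ->
    2 * C * `|M y - M x| < e.
  move=> x Ex e e0; have C20 : 0 < 2 * C + 1 by rewrite ltr_wpDl// mulr_ge0.
  have [r r0 hr] := speed_uniformly_continuous (divr_gt0 e0 C20).
  exists r => // y Ey xyr; rewrite (@le_lt_trans _ _ ((2 * C + 1) * `|M y - M x|))//.
    by rewrite ler_wpM2r// lerDl.
  rewrite -ltr_pdivlMl// mulrC.
  have [xy|yx] := leP x y.
    rewrite ger0_norm ?subr_ge0 ?speed_le//; [|by case: Ex].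
    apply: hr => //; first by case: Ex.
    by rewrite (le_lt_trans _ xyr)// distrC ler_norm.
  rewrite distrC ger0_norm ?subr_ge0 ?speed_le// ?(ltW yx)//; [|by case: Ey].
  apply: hr => //; [by case: Ey|exact: ltW|].
  by rewrite (le_lt_trans _ xyr)// ler_norm.
have lim (x : R) (F : set_system R) : ProperFilter F -> E x ->
    (forall r, 0 < r -> \forall y \near F, `|x - y| < r /\ y != x /\ E y) ->
    deriv_wrt S int_fun x F (wcdf g x).
  move=> FF Ex nF; apply/cvgrPdist_lt => e e0.
  have [r r0 hr] := hC x Ex e e0.
  apply: filterS (nF r r0) => y [yr [yx Ey]]; rewrite distrC.
  by apply: le_lt_trans (hr y Ey yr); apply: quot => //; rewrite eq_sym.
split.
- split => //; apply/subspace_continuousP => x Ex.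
  have Scx := iffLR (subspace_continuousP _ _) (ss_S_cont Sm) x Ex.
  have [r r0 hr] := hC x Ex 1 ltr01.
  have h0 : 0 < `|wcdf g x| + 1 by rewrite ltr_wpDl.
  apply/cvgrPdist_lt => e e0; move/cvgrPdist_lt : Scx => /(_ _ (divr_gt0 e0 h0)).
  have nr : \forall y \near x, `|x - y| < r by exact: nbhsx_ballx.
  rewrite !near_withinE; apply: filterS2 nr => y yr /[swap] Ey /(_ Ey).
  have [->|yx] := eqVneq y x; first by rewrite !subrr normr0.
  rewrite distrC ltr_pdivlMr// mulrC [X in _ -> X < _]distrC; apply: le_lt_trans.
  have Sxy : S y - S x != 0.
    have [xy|xy|xy] := ltgtP x y; last by rewrite xy eqxx in yx.
      by rewrite gt_eqF// subr_gt0 scale_lt//; case: Ex.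
    by rewrite lt_eqF// subr_lt0 scale_lt//; case: Ey.
  rewrite -[X in `|X|](divfK Sxy) normrM ler_wpM2r//.
  have := quot Ex Ey; rewrite eq_sym => /(_ yx) h.
  rewrite -[X in `|X|](subrK (wcdf g x)) (le_trans (ler_normD _ _))// addrC lerD2l.
  by rewrite (le_trans h)// ltW// hr.
- by split; [exact: continuous_subspaceT|exists C].
exists (wcdf g); split.
- move=> x Ix; apply: lim => //; first exact: state_interiorW.
  move=> r r0; have : \forall y \near x, I y by exact: open_state_interior.
  move=> Iy; near=> y; split; last split.
  + near: y; apply: nbhs_dnbhs; exact: nbhsx_ballx.
  + near: y; exact: nbhs_dnbhs_neq.
  + apply: state_interiorW; near: y; exact: nbhs_dnbhs Iy.
- move=> x Ix; apply: deriv_wrt_speed => //.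
  by have := @wcdf_derive g C mg gC x Ix (@cg x).
- have := @lim 0 0^'+; rewrite /wcdf set_itvoc0 Rintegral_set0; apply => //.
  move=> r r0; near=> y; have y0 : 0 < y by [].
  split; last split.
  + by rewrite sub0r normrN gtr0_norm//; near: y; exact: nbhs_right_lt.
  + by rewrite gt_eqF.
  + apply: (state_itv Ed (ltW y0)); near: y; exact: nbhs_right_le.
- move=> /kd <-; have := @lim d d^'-; rewrite g0; apply => //.
  move=> r r0; near=> y; have yd : y < d by [].
  split; last split.
  + rewrite gtr0_norm ?subr_gt0// ltrBlDr -ltrBlDl; near: y; apply: nbhs_left_gt.
    by rewrite gtrBl.
  + by rewrite lt_eqF.
  + apply: (state_itv Ed _ (ltW yd)); near: y; exact: nbhs_left_ge.
Unshelve. all: by end_near. Qed.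

End integral_domain.

(** * Integrals under the laws of the diffusion *)

Section law_integrals.
Implicit Types (phi : cpath R -> R) (A : set (cpath R)).

Lemma law_fin_num x A : measurable A -> P x A \is a fin_num.
Proof. by move=> mA; exact: (fin_num_measure (kernel_law P x)). Qed.

Lemma law_ltoo x A : measurable A -> (P x A < +oo)%E.
Proof. by move=> mA; rewrite (le_lt_trans (law_le1 x mA))// ltry. Qed.

Lemma law_integrable x A phi C : measurable A -> measurable_fun setT phi ->
  (forall w, `|phi w| <= C) -> (P x).-integrable A (EFin \o phi).
Proof.
move=> mA mphi phiC; apply: measurable_bounded_integrable => //.
- exact: law_ltoo.
- exact: measurable_funTS.
exists C; split; first exact: num_real.
by move=> r Cr w _ /=; rewrite (le_trans (phiC w))// ltW.
Qed.

Lemma null_ae x A : measurable A -> P x A = 0 -> \forall w \ae P x, ~ A w.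
Proof. by move=> mA A0; exists A; split => // w /contrapT. Qed.

Lemma measurable_law_integral phi C : measurable_fun setT phi ->
  (forall w, `|phi w| <= C) -> measurable_fun setT (fun x => \int[P x]_w phi w).
Proof.
move=> mphi phiC.
(* Adding [C] makes the integrand nonnegative, and measurability of kernel integrals applies. *)
rewrite (_ : (fun x => _) = (fun x => fine (\int[P x]_w (phi w + C)%:E) - C)); last first.
  apply/funext => x.
  have h := law_integrable x measurableT mphi phiC.
  have hC : (P x).-integrable setT (EFin \o (fun=> C)).
    by apply: (@law_integrable _ _ _ `|C|) => //; exact: measurable_cst.
  have -> : fine (\int[P x]_w (phi w + C)%:E) = \int[P x]_w phi w + \int[P x]_w C.
    exact: (RintegralD measurableT h hC).
  by rewrite Rintegral_cst//= prob_kernel/= mulr1 addrK.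
apply: measurable_funB => //; apply: measurableT_comp => //.
apply: (@measurable_fun_integral_kernel _ _ _ _ _ (fun x => P x)).
- by move=> U mU; exact: measurable_kernel.
- by move=> w; rewrite lee_fin -lerBlDr sub0r; have := phiC w; rewrite ler_norml => /andP[].
- by apply/measurable_EFinP; exact: measurable_funD.
Qed.

Lemma law_integral_le x A phi C : measurable A -> measurable_fun setT phi ->
  (forall w, `|phi w| <= C) -> `|\int[P x]_(w in A) phi w| <= C.
Proof.
move=> mA mphi phiC; have C0 : 0 <= C by exact: le_trans (normr_ge0 _) (phiC point).
apply: (le_trans (le_normr_Rintegral mA (law_integrable x mA mphi phiC))).
rewrite (@le_trans _ _ (\int[P x]_(w in A) C))//.
  apply: le_Rintegral => //.
  - exact: integrable_norm (law_integrable x mA mphi phiC).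
  - by apply: (@law_integrable _ _ _ `|C|) => //; exact: measurable_cst.
rewrite Rintegral_cst// ler_piMr// -lee_fin fineK ?law_fin_num//.
exact: law_le1.
Qed.

Lemma simple_markov_Rintegral x t A phi C : E x -> 0 <= t -> natural_filtration t A ->
  measurable_fun setT phi -> (forall w, `|phi w| <= C) ->
  \int[P x]_(w in A) phi (shift_path t w) = \int[P x]_(w in A) \int[P (w t)]_w' phi w'.
Proof.
move=> Ex t0 FA mphi phiC; have mA := natural_filtration_measurable FA.
have mphis : measurable_fun setT (phi \o shift_path t).
  exact: measurableT_comp mphi (measurable_shift_path t).
have mC y B : measurable B -> (P y).-integrable B (EFin \o (fun=> C)).
  by move=> mB; apply: (@law_integrable _ _ _ `|C|) => //; exact: measurable_cst.
have C0 w : 0 <= phi w + C.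
  by rewrite -lerBlDr sub0r; have := phiC w; rewrite ler_norml => /andP[].
have := @simple_markov_integral x t A (fun w => (phi w + C)%:E) Ex t0 FA.
have mphiC : measurable_fun setT (fun w => (phi w + C)%:E).
  by apply/measurable_EFinP; exact: measurable_funD.
move=> /(_ mphiC) h.
have {h} : \int[P x]_(w in A) (phi (shift_path t w) + C) =
    \int[P x]_(w in A) \int[P (w t)]_w' (phi w' + C).
  rewrite {1}/Rintegral h; last by move=> w; rewrite lee_fin.
  congr fine; apply: eq_integral => w _; rewrite /Rintegral fineK//.
  apply: integrable_fin_num => //; apply: (@law_integrable _ _ _ (C + C)) => //.
    exact: measurable_funD.
  by move=> w'; rewrite ger0_norm// lerD2r (le_trans (ler_norm _)).
rewrite RintegralD//; [|by apply: (law_integrable x mA mphis) => w; exact: phiC|exact: mC].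
have e w : \int[P w]_w' (phi w' + C) = \int[P w]_w' phi w' + C.
  rewrite RintegralD//; [|exact: law_integrable|exact: mC].
  by rewrite Rintegral_cst// prob_kernel mulr1.
under [X in _ = X]eq_Rintegral do rewrite e.
rewrite RintegralD//; last 2 first.
- apply: (@law_integrable x A (fun w : cpath R => \int[P (w t)]_w' phi w') C) => //.
    exact: measurableT_comp (measurable_law_integral mphi phiC) (measurable_eval t).
  by move=> w; exact: law_integral_le.
- exact: mC.
by move=> /addIr.
Qed.

Lemma ae_eq_law_integral x A phi psi : measurable A -> measurable_fun setT phi ->
  measurable_fun setT psi -> (\forall w \ae P x, A w -> phi w = psi w) ->
  \int[P x]_(w in A) phi w = \int[P x]_(w in A) psi w.
Proof.
move=> mA mphi mpsi h; congr fine; apply: ae_eq_integral => //.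
- by apply/measurable_EFinP; exact: measurable_funTS.
- by apply/measurable_EFinP; exact: measurable_funTS.
by move: h; apply: filterS => w h Aw; rewrite h.
Qed.

(** Truncating at $\pm C$ leaves the integral unchanged and turns an almost sure bound into a bound
    everywhere. *)
Lemma law_integral_le_ae x A phi C : measurable A -> measurable_fun setT phi -> 0 <= C ->
  (\forall w \ae P x, A w -> `|phi w| <= C) -> `|\int[P x]_(w in A) phi w| <= C.
Proof.
move=> mA mphi C0 h; pose psi w := Num.min (Num.max (phi w) (- C)) C.
have mpsi : measurable_fun setT psi.
  by apply: measurable_minr => //; exact: measurable_maxr.
rewrite (ae_eq_law_integral mA mphi mpsi).
  apply: law_integral_le => // w; rewrite /psi ler_norml ge_min lexx orbT andbT.
  by rewrite le_min le_max lexx orbT/= lerNl (le_trans _ C0)// oppr_le0.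
move: h; apply: filterS => w h /h; rewrite ler_norml => /andP[h1 h2].
by rewrite /psi max_l// min_l.
Qed.

Lemma law_integral_ge0_ae x A phi : measurable A -> measurable_fun setT phi ->
  (\forall w \ae P x, A w -> 0 <= phi w) -> 0 <= \int[P x]_(w in A) phi w.
Proof.
move=> mA mphi h; pose psi w := Num.max (phi w) 0.
have mpsi : measurable_fun setT psi by exact: measurable_maxr.
rewrite (ae_eq_law_integral mA mphi mpsi).
  by apply: Rintegral_ge0 => w _; rewrite le_max lexx orbT.
by move: h; apply: filterS => w h /h ?; rewrite /psi max_l.
Qed.

Lemma law_dominated_convergence x A (phi_ : nat -> cpath R -> R) phi C C' :
  measurable A -> (forall n, measurable_fun setT (phi_ n)) -> measurable_fun setT phi ->
  (forall w, `|phi w| <= C') ->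
  (\forall w \ae P x, A w -> (forall n, `|phi_ n w| <= C) /\ phi_ n w @[n --> \oo] --> phi w) ->
  \int[P x]_(w in A) phi_ n w @[n --> \oo] --> \int[P x]_(w in A) phi w.
Proof.
move=> mA mphi_ mphi phiC h.
have iC : (P x).-integrable A (EFin \o (fun=> C)).
  by apply: (@law_integrable _ _ _ `|C|) => //; exact: measurable_cst.
have [] := @dominated_convergence _ _ _ (P x) A mA (fun n => EFin \o phi_ n) (EFin \o phi) (EFin \o (fun=> C)).
- by move=> n; apply/measurable_EFinP; exact: measurable_funTS.
- by apply/measurable_EFinP; exact: measurable_funTS.
- move: h; apply: filterS => w h Aw; apply: cvg_EFin; first by near=> n.
  exact: (h Aw).2.
- exact: iC.
- by move: h; apply: filterS => w h n Aw; rewrite /= lee_fin; exact: (h Aw).1.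
move=> iphi _ h'; apply: fine_cvg; rewrite fineK//.
by apply: integrable_fin_num => //; exact: law_integrable phiC.
Unshelve. all: by end_near. Qed.

End law_integrals.

(** * The diffusion killed at 0 *)

Section killed_dynkin.
Variables (f g : R -> R).
Hypotheses (cf : continuous f) (cg : continuous g) (fg : dm_dS b k S m f g).
Hypotheses (f_ge0 : forall x, 0 <= f x) (f_state : forall x, ~ E x -> f x = 0) (f0 : f 0 = 0).
Hypotheses (g_bd : exists C, forall x, `|g x| <= C).

Let generator_fg : generator b k P f g.
Proof. exact/(diff_generator P_diff). Qed.

Let mf : measurable_fun setT f. Proof. exact: continuous_measurable_fun. Qed.

Let mfe t : measurable_fun setT (fun w : cpath R => f (w t)).
Proof. exact: measurableT_comp mf (measurable_eval t). Qed.

Let f_bd : exists2 B, 0 <= B & forall x, `|f x| <= B.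
Proof.
have [[_ [B hB]] _ _ _] := generator_fg.
exists `|B| => // x; have [Ex|nE] := pselect (E x).
  by rewrite (le_trans (hB x Ex))// ler_norm.
by rewrite f_state// normr0.
Qed.

Let sg t x := \int[P x]_w f ((w : cpath R) t).

Let semigroupE t x : semigroup b k P t f x = sg t x.
Proof.
rewrite /semigroup Rintegral_mkcond; apply: eq_Rintegral => w _.
rewrite patchE; case: ifPn => //; rewrite notin_setE/= => nE.
by rewrite f_state.
Qed.

Let sg_cvg x : E x -> (sg n.+1%:R^-1 x - f x) / n.+1%:R^-1 @[n --> \oo] --> g x.
Proof.
move=> Ex; have [_ _ + _] := generator_fg => /(_ x Ex) h.
have := iffLR (cvg_at_rightP _ _ _) h (fun n => n.+1%:R^-1).
have e n : (semigroup b k P n.+1%:R^-1 f x - f x) / n.+1%:R^-1 = (sg n.+1%:R^-1 x - f x) / n.+1%:R^-1.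
  by rewrite semigroupE.
rewrite (funext e); apply; split; [by move=> n; rewrite invr_gt0 ltr0n|exact: cvg_harmonic].
Qed.

Let sg_bd : exists2 C, 0 <= C & forall t x, 0 < t -> E x -> `|sg t x - f x| <= C * t.
Proof.
have [_ _ _ [C hC]] := generator_fg; exists `|C| => // t x t0 Ex.
have := hC t x t0 Ex; rewrite semigroupE normrM normfV (gtr0_norm t0) ler_pdivrMr//.
by move=> h; rewrite (le_trans h)// ler_wpM2r ?(ltW t0)// ler_norm.
Qed.

Definition killed t x := \int[P x]_(w in alive t) f ((w : cpath R) t).

Let loss t x := \int[P x]_(w in ~` alive t) f ((w : cpath R) t).

Let mT t : measurable (~` @alive R t).
Proof. by apply: measurableC; exact: measurable_alive. Qed.

Let killed_loss t x : sg t x = killed t x + loss t x.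
Proof.
have [B B0 fB] := f_bd; rewrite /sg -(setvU (alive t)) setUC Rintegral_setU//.
- exact: measurable_alive.
- by apply: (@law_integrable _ _ _ B) => //; apply: measurableU => //; exact: measurable_alive.
- by rewrite disj_set2E setICr.
Qed.

Let sgE t x : (\int[P x]_w (f ((w : cpath R) t))%:E)%E = (sg t x)%:E.
Proof.
have [B B0 fB] := f_bd; rewrite /sg /Rintegral fineK//.
by apply: integrable_fin_num => //; apply: (@law_integrable _ _ _ B).
Qed.

Let sg0 : E 0 -> sg 0 0 = 0.
Proof.
move=> E0; apply: EFin_inj; rewrite -sgE.
transitivity (\int[P 0%R]_w (cst (0 : \bar R) w))%E; last by rewrite integral0.
apply: ae_eq_integral => //; first exact/measurable_EFinP.
have := start_ae E0; apply: filterS => w w0 _ /=.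
by rewrite w0 f0.
Qed.

(** Restarting at the hitting time [T] of 0 leaves [sg (t - T) 0], which is at most [C * (t - T)]
    because [f 0 = 0]. The remaining factor, the probability of death by time [t], is what makes the
    loss negligible compared with [t]. *)
Let loss_bd C : 0 <= C -> (forall t x, 0 < t -> E x -> `|sg t x - f x| <= C * t) ->
  forall t x, 0 < t -> E x ->
  0 <= loss t x /\ loss t x <= C * t * fine (P x (~` alive t)).
Proof.
move=> C0 hC t x t0 Ex; split; first exact: Rintegral_ge0.
have E0 : E 0 by apply: (state_space_itv Ex) => //; case: (Ex).
have [B B0 fB] := f_bd.
rewrite -lee_fin /loss /Rintegral fineK; last first.
  by apply: integrable_fin_num => //; apply: (@law_integrable _ _ _ B).
rewrite EFinM fineK ?law_fin_num//.
pose F (p : R * cpath R) := ((f (p.2 (t - p.1))) * \1_[set u | u <= t] p.1)%:E.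
have mF : measurable_fun setT F.
  apply/measurable_EFinP; apply: measurable_funM.
    apply: measurableT_comp => //; apply: measurable_eval_comp; last exact: measurable_snd.
    by apply: measurable_funB => //; exact: measurable_fst.
  apply: measurableT_comp; last exact: measurable_fst.
  apply: measurable_indic; rewrite (_ : [set u | _] = `]-oo, t]%classic) //.
have F0 p : (0 <= F p)%E by rewrite lee_fin mulr_ge0.
pose T (w : cpath R) := hitting_time 0 w.
pose H := [set w : cpath R | (T w < +oo)%E].
have mT' := proper_measurable (proper_hitting_time (0 : R)).
have mH : measurable H by apply: measurable_time_lt.
have fT w : H w -> T w \is a fin_num by move=> Hw; rewrite ge0_fin_numE ?hitting_ge0.
have e : (\int[P x]_(w in ~` alive t) (f (w t))%:E =
   \int[P x]_(w in H) F (fine (T w), shift_path (fine (T w)) w))%E.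
  rewrite integral_mkcond [RHS]integral_mkcond; apply: eq_integral => w _.
  rewrite !patchE; case: ifPn => [|]; last first.
    rewrite notin_setE/= => /contrapT aw; case: ifPn => // /[!inE] Hw.
    rewrite /F/= indicE memNset ?mulr0//=; apply/negP; rewrite -ltNge.
    by rewrite -lte_fin fineK ?fT.
  rewrite inE/= /alive/= => /negP; rewrite -leNgt => tw.
  have Hw : H w by rewrite /H/= (le_lt_trans tw)// ltry.
  have tw' : fine (T w) <= t by rewrite -lee_fin fineK ?fT.
  rewrite mem_set// /F indicE mem_set//= mulr1 max_l ?subr_ge0//.
  by rewrite addrC subrK.
rewrite e hitting_markov_integral//.
have mG : measurable_fun setT (fun w => \int[P 0%R]_w' F (fine (T w), w'))%E.
  have := @measurable_fun_fubini_tonelli_F _ _ _ _ _ (kernel_law P 0) F mF F0.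
  by move=> h; exact: (measurableT_comp h (measurable_fine_time mT')).
have Ct0 : (0 <= (C * t)%:E)%E by rewrite lee_fin mulr_ge0// ltW.
have mA := mT t.
rewrite (@le_trans _ _ (\int[P x]_(w in H) ((C * t)%:E * (\1_(~` alive t) w)%:E))%E)//.
  apply: ge0_le_integral => //.
  - by move=> w _; exact: integral_ge0.
  - exact: measurable_funTS.
  - by apply/measurable_funTS/measurable_funeM/measurable_EFinP; exact: measurable_indic.
  move=> w Hw; rewrite indicE; have [aw|aw] := pselect (alive t w).
    rewrite memNset/= ?mule0; last by move=> /(_ aw).
    rewrite integral0_eq// => w' _; rewrite /F/= indicE memNset ?mulr0//=.
    by apply/negP; rewrite -ltNge -lte_fin fineK ?fT.
  rewrite mem_set//= mule1; move: aw; rewrite /alive/= => /negP; rewrite -leNgt => tw.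
  have tw' : fine (T w) <= t by rewrite -lee_fin fineK ?fT.
  rewrite (eq_integral (fun w' : cpath R => (f (w' (t - fine (T w))))%:E)); last first.
    by move=> w' _; rewrite /F/= indicE mem_set//= mulr1.
  rewrite sgE lee_fin; have [tw0|tw0] := leP (t - fine (T w)) 0.
    have -> : t - fine (T w) = 0 by apply/eqP; rewrite eq_le tw0 subr_ge0.
    by rewrite sg0// mulr_ge0// ltW.
  have := hC _ _ tw0 E0; rewrite f0 subr0 => h.
  rewrite (le_trans (ler_norm _))// (le_trans h)// ler_wpM2l// gerBl.
  by rewrite fine_ge0// hitting_ge0.
rewrite ge0_integralZl//; last by apply/measurable_funTS/measurable_EFinP; exact: measurable_indic.
rewrite integral_indic// lee_wpmul2l// le_measure ?inE//.
exact: measurableI.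
Qed.

(** A path that has died by each of the times $1/(n+1)$ has value 0 at time 0, which is excluded for
    a start at [x > 0]. *)
Let dying x : E x -> 0 < x -> fine (P x (~` alive n.+1%:R^-1)) @[n --> \oo] --> (0 : R).
Proof.
move=> Ex x0; apply: (@fine_cvg _ _ _ _ (fun n => P x (~` alive n.+1%:R^-1))).
have mC : measurable (\bigcap_n ~` alive n.+1%:R^-1 : set (cpath R)).
  by apply: bigcapT_measurable.
have h : (\bigcap_n ~` alive n.+1%:R^-1 : set (cpath R)) `<=` [set w | w 0 = 0].
  move=> w hw; have : (hitting_time 0 w <= 0%:E)%E.
    apply/lee_addgt0Pr => e e0; rewrite add0e.
    have [n ne] : exists n : nat, n.+1%:R^-1 < e.
      exists (Num.truncn e^-1); rewrite invf_plt ?posrE//.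
      by rewrite truncnS_gt.
    have := hw n Logic.I; rewrite /alive/= => /negP; rewrite -leNgt => /le_trans; apply.
    by rewrite lee_fin ltW.
  move=> /hitting_leP[s [s0 s0' ws]]; move: ws.
  by have -> : s = 0 by apply/eqP; rewrite eq_le s0 s0'.
have z : P x (\bigcap_n ~` alive n.+1%:R^-1) = 0.
  apply: measure_negligible => //; apply: negligibleS (start_ae Ex) => w /h /= w0.
  by move=> w0x; move: x0; rewrite -w0x w0 ltxx.
rewrite -[X in _ --> X]z; apply: nonincreasing_cvg_mu => //.
- exact: law_ltoo.
- apply/nonincreasing_seqP => n; apply/subsetPset => w; rewrite /alive/= => /negP; rewrite -leNgt => h'.
  by apply/negP; rewrite -leNgt (le_trans h')// lee_fin lef_pV2 ?posrE// ler_nat.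
Qed.

Let killed_bd : exists2 C, 0 <= C & forall t x, 0 < t -> E x -> `|killed t x - f x| <= C * t.
Proof.
have [C C0 hC] := sg_bd; exists (C + C); first exact: addr_ge0.
move=> t x t0 Ex; have [h1 h2] := loss_bd C0 hC t0 Ex.
have -> : killed t x - f x = (sg t x - f x) - loss t x by rewrite killed_loss; ring.
rewrite (le_trans (ler_normB _ _))// mulrDl lerD ?hC// ger0_norm//.
rewrite (le_trans h2)// ler_piMr ?mulr_ge0 ?(ltW t0)//.
by rewrite -lee_fin fineK ?law_fin_num//; exact: law_le1.
Qed.

(** The loss is $o(t)$, so away from 0 killing does not change the derivative at time 0. *)
Let killed_cvg x : E x -> 0 < x ->
  (killed n.+1%:R^-1 x - f x) / n.+1%:R^-1 @[n --> \oo] --> g x.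
Proof.
move=> Ex x0; have [C C0 hC] := sg_bd.
have -> : (fun n => (killed n.+1%:R^-1 x - f x) / n.+1%:R^-1) =
    (fun n => (sg n.+1%:R^-1 x - f x) / n.+1%:R^-1 - loss n.+1%:R^-1 x / n.+1%:R^-1).
  by apply/funext => n; rewrite killed_loss; ring.
rewrite -[X in _ --> X]subr0; apply: cvgB; first exact: sg_cvg.
apply: (@squeeze_cvgr _ _ _ _ (fun=> 0) (fun n => C * fine (P x (~` alive n.+1%:R^-1)))).
- near=> n; have n0 : (0 : R) < n.+1%:R^-1 by rewrite invr_gt0.
  have [h1 h2] := loss_bd C0 hC n0 Ex.
  rewrite divr_ge0 ?(ltW n0)//= ler_pdivrMr//.
  by rewrite (le_trans h2)// -!mulrA ler_wpM2l// mulrC.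
- exact: cvg_cst.
- by rewrite -[X in _ --> X](mulr0 C); apply: cvgM; [exact: cvg_cst|exact: dying].
Unshelve. all: by end_near. Qed.

Let mg : measurable_fun setT g. Proof. exact: continuous_measurable_fun. Qed.

Let mphi t : measurable_fun setT (fun w : cpath R => f (w t) * \1_(alive t) w).
Proof. by apply: measurable_funM => //; apply: measurable_indic; exact: measurable_alive. Qed.

Let killedE t x : killed t x = \int[P x]_w (f ((w : cpath R) t) * \1_(alive t) w).
Proof.
rewrite /killed Rintegral_mkcond; apply: eq_Rintegral => w _.
by rewrite patchE indicE; case: ifPn; rewrite ?mulr1 ?mulr0.
Qed.

Let phi_bd t B : (forall x, `|f x| <= B) -> forall w : cpath R, `|f (w t) * \1_(alive t) w| <= B.
Proof.
move=> fB w; rewrite indicE; case: (_ \in _); rewrite ?mulr1//= mulr0 normr0.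
exact: le_trans (normr_ge0 _) (fB 0).
Qed.

Let m_killed t : measurable_fun setT (killed t).
Proof.
have [B B0 fB] := f_bd; rewrite (funext (killedE t)).
exact: measurable_law_integral (mphi t) (phi_bd t fB).
Qed.

Let m_killed_eval t s : measurable_fun setT (fun w : cpath R => killed t (w s)).
Proof. exact: measurableT_comp (m_killed t) (measurable_eval s). Qed.

Let killed_le B : (forall x, `|f x| <= B) -> forall t x, `|killed t x| <= B.
Proof. by move=> fB t x; rewrite killedE; exact: law_integral_le (mphi t) (phi_bd t fB). Qed.

Let killedD x t u : E x -> 0 <= t -> 0 <= u ->
  killed (t + u) x = \int[P x]_(w in alive t) killed u ((w : cpath R) t).
Proof.
move=> Ex t0 u0; have [B B0 fB] := f_bd.
under eq_Rintegral do rewrite killedE.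
rewrite -(simple_markov_Rintegral Ex t0 (alive_filtration t0) (mphi u) (phi_bd u fB)).
rewrite /killed Rintegral_mkcond [RHS]Rintegral_mkcond; apply: eq_Rintegral => w _.
rewrite !patchE shift_pathE// indicE; have [a1|a1] := pselect (alive t w); last first.
  by rewrite [in RHS]memNset// memNset//; move=> /(aliveD _ t0 u0)[].
rewrite [in RHS]mem_set//; have [a2|a2] := pselect (alive u (shift_path t w)).
  by rewrite !mem_set ?mulr1//; apply/aliveD.
by rewrite [in RHS]memNset// mulr0 memNset//; move=> /(aliveD _ t0 u0)[].
Qed.

Let killed_diff x t u : E x -> 0 <= t -> 0 <= u ->
  killed (t + u) x - killed t x =
  \int[P x]_(w in alive t) (killed u ((w : cpath R) t) - f (w t)).
Proof.
move=> Ex t0 u0; have [B B0 fB] := f_bd; have mA := @measurable_alive R t.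
rewrite killedD// RintegralB//.
- by apply: (@law_integrable _ _ _ B) => // w; exact: killed_le.
- by apply: (@law_integrable _ _ _ B).
Qed.

Let killed0 x : E x -> 0 < x -> killed 0 x = f x.
Proof.
move=> Ex x0; rewrite killedE (@ae_eq_law_integral _ _ _ (fun=> f x))//.
  by rewrite Rintegral_cst// prob_kernel mulr1.
have := start_ae Ex; apply: filterS => w w0 _.
rewrite indicE w0 mem_set ?mulr1//; apply/hitting_gtP => s s0 s0'.
by rewrite (_ : s = 0) ?w0 ?gt_eqF//; apply/eqP; rewrite eq_le s0 s0'.
Qed.

Let alive_ae x t : E x -> 0 < x -> 0 <= t ->
  \forall w \ae P x, alive t w -> E ((w : cpath R) t) /\ 0 < w t.
Proof.
move=> Ex x0 t0; have := start_ae Ex; have := state_ae Ex t0.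
apply: filterS2 => w Ewt w0 aw; split => //.
by apply: (alive_gt0 _ t0 aw); rewrite w0 ltW.
Qed.

(** By the Markov property the right derivative of [killed t x] is the integral of [g (w t)] over
    the paths alive at [t], at least [lam * killed t x] when these are in [J]. The set [J] allows
    the inequality to be used just where the path is known to be. *)
Lemma killed_growth (J : set R) x lam eps : E x -> 0 < x -> 0 <= eps ->
  (forall y, J y -> lam * f y <= g y) ->
  (forall t, 0 <= t -> t < eps -> \forall w \ae P x, alive t w -> J ((w : cpath R) t)) ->
  f x * expR (lam * eps) <= killed eps x.
Proof.
move=> Ex x0 eps0 lamJ hJ; rewrite -(killed0 Ex x0).
have [B B0 fB] := f_bd; have [C C0 hC] := killed_bd; have [Cg hCg] := g_bd.
have mge t : measurable_fun setT (fun w : cpath R => g (w t)).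
  exact: measurableT_comp mg (measurable_eval t).
apply: (@right_derivative_growth _ (fun t => killed t x)
  (fun t => \int[P x]_(w in alive t) g ((w : cpath R) t)) C) => //.
  move=> s t s0 st; have u0 : 0 <= t - s by rewrite subr_ge0.
  move: (u0); rewrite le_eqVlt => /predU1P[u00|u0'].
    by rewrite -u00 mulr0 (_ : t = s) ?subrr ?normr0//; apply/eqP; rewrite -subr_eq0 -u00.
  rewrite -{1}(subrK s t) [_ - s + s]addrC killed_diff//.
  apply: law_integral_le_ae; [exact: measurable_alive|exact: measurable_funB|exact: mulr_ge0|].
  by have := state_ae Ex s0; apply: filterS => w Ew _; exact: hC.
move=> t t0 te; have mA := @measurable_alive R t; split.
  rewrite -subr_ge0 /killed -RintegralZl//; last by apply: (@law_integrable _ _ _ B).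
  rewrite -RintegralB//; last 2 first.
  - by apply: (@law_integrable _ _ _ Cg).
  - apply: (@law_integrable _ _ (fun w : cpath R => lam * f (w t)) (`|lam| * B)) => //.
      exact: measurable_funM.
    by move=> w; rewrite normrM ler_wpM2l.
  apply: law_integral_ge0_ae => //.
    by apply: measurable_funB => //; exact: measurable_funM.
  by move: (hJ t t0 te); apply: filterS => w h /h Jw; rewrite subr_ge0 lamJ.
rewrite (_ : (fun n => _) = (fun n => \int[P x]_(w in alive t)
    ((killed n.+1%:R^-1 ((w : cpath R) t) - f (w t)) / n.+1%:R^-1))); last first.
  apply/funext => n; rewrite killed_diff// -RintegralZr//.
  apply: (@law_integrable _ _ (fun w : cpath R => killed n.+1%:R^-1 (w t) - f (w t)) (B + B)) => //.
    exact: measurable_funB.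
  by move=> w; rewrite (le_trans (ler_normB _ _))// lerD// killed_le.
apply: (@law_dominated_convergence _ _ _ _ C Cg) => //.
  by move=> n; apply: measurable_funM => //; exact: measurable_funB.
have := alive_ae Ex x0 t0; apply: filterS => w h /h[Ew w0]; split; last exact: killed_cvg.
move=> n; have n0 : (0 : R) < n.+1%:R^-1 by rewrite invr_gt0.
by rewrite normrM [X in _ * X]gtr0_norm ?invr_gt0// ler_pdivrMr// hC.
Qed.

End killed_dynkin.


(** * Positive probability of staying, descending, dying and surviving *)

Lemma scale_speed_ratio c1 c2 : I c1 -> I c2 -> c1 <= c2 ->
  exists k0 K, [/\ 0 < k0, 0 < K & forall x, c1 <= x <= c2 ->
    k0 <= derive1 S x / m x /\ derive1 S x / m x <= K].
Proof.
move=> I1 I2 c12; pose r x := derive1 S x / m x.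
have Ix x : c1 <= x <= c2 -> I x.
  move=> /andP[h1 h2]; split; first by apply: lt_le_trans h1; case: I1.
  by apply: le_lt_trans (I2.2); rewrite lee_fin.
have rc : {within `[c1, c2], continuous r}.
  apply: continuous_in_subspaceT => x; rewrite inE/= in_itv/= => /Ix Ix'.
  apply: cvgM; first exact: (ss_dS_cont Sm).
  by apply: cvgV; [rewrite gt_eqF//; exact: (ss_m_gt0 Sm)|exact: (ss_m_cont Sm)].
have r0 x : c1 <= x <= c2 -> 0 < r x.
  move=> /Ix Ix'; apply: divr_gt0; [exact: (ss_dS_gt0 Sm)|exact: (ss_m_gt0 Sm)].
have [x1 x1i h1] := EVT_max c12 rc; have [x2 x2i h2] := EVT_min c12 rc.
exists (r x2), (r x1); split; [exact: r0|exact: r0|] => x xi; split; [exact: h2|exact: h1].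
Qed.

Lemma measurable_eval_itv c1 c2 t : measurable [set w : cpath R | c1 < w t < c2].
Proof.
rewrite (_ : mkset _ = (fun w : cpath R => w t) @^-1` `]c1, c2[).
  by rewrite -[X in measurable X]setTI; apply: measurable_eval.
by apply/seteqP; split => w; rewrite /= in_itv.
Qed.

Lemma measurable_eval_gt c t : measurable [set w : cpath R | c < w t].
Proof.
rewrite (_ : mkset _ = (fun w : cpath R => w t) @^-1` `]c, +oo[).
  by rewrite -[X in measurable X]setTI; apply: measurable_eval.
by apply/seteqP; split => w; rewrite /= in_itv/= andbT.
Qed.

Lemma measurable_eval_lt c t : measurable [set w : cpath R | w t < c].
Proof.
rewrite (_ : mkset _ = (fun w : cpath R => w t) @^-1` `]-oo, c[).
  by rewrite -[X in measurable X]setTI; apply: measurable_eval.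
by apply/seteqP; split => w; rewrite /= in_itv.
Qed.

Lemma killed_bump_gt0 c1 c2 n x t : I c1 -> I c2 -> c1 < c2 -> E x ->
  0 < killed (bump_fun c1 c2 n) t x ->
  (0 < P x (alive t `&` [set w | (c1 < w t < c2)%R]))%E.
Proof.
move=> I1 I2 c12 Ex kt; have mA := @measurable_alive R t.
have mi := measurable_eval_itv c1 c2 t.
have mf := continuous_measurable_fun (@bump_fun_continuous c1 c2 n I1 I2 c12).
rewrite lt0e measure_ge0 andbT; apply/eqP => P0; move: kt; rewrite /killed.
rewrite (@ae_eq_law_integral _ _ _ (fun=> 0)) ?Rintegral_cst ?mul0r ?ltxx//.
  exact: measurableT_comp mf (measurable_eval t).
have := null_ae (measurableI _ _ mA mi) P0; apply: filterS => w h aw; rewrite bump_fun0//.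
by apply/negP => cw; apply: h.
Qed.

(** A bump at [x] shrinks at most exponentially under the killed semigroup, because its generator is
    bounded below by a multiple of it. So the killed expectation stays positive at all times. *)
Lemma stay_gt0 c1 c2 x t : I c1 -> I c2 -> c1 < x -> x < c2 -> 0 <= t ->
  (0 < P x (alive t `&` [set w | (c1 < w t < c2)%R]))%E.
Proof.
move=> I1 I2 cx xc t0; have c12 := lt_trans cx xc.
have x0 : 0 < x by exact: lt_trans (I1.1) cx.
have Ix : I x by split => //; apply: lt_trans (I2.2); rewrite lte_fin.
have Ex := state_interiorW Ix.
apply: (@killed_bump_gt0 c1 c2 0) => //.
have S12 : S c1 < S c2.
  by apply: scale_lt => //; [exact: ltW (I1.1)|exact: state_interiorW].
have [k0 [K [k00 K0 hK]]] := scale_speed_ratio I1 I2 (ltW c12).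
have fx : 0 < bump_fun c1 c2 0 x.
  rewrite bump_funE// /bump exprn_gt0// lt_max mulr_gt0// subr_gt0.
    by apply: scale_lt => //; exact: ltW (I1.1).
  by apply: scale_lt => //; [exact: ltW|exact: state_interiorW].
pose lam := - (150 / (S c2 - S c1) ^+ 2) * K.
apply: (@lt_le_trans _ _ (bump_fun c1 c2 0 x * expR (lam * t))).
  by rewrite mulr_gt0// expR_gt0.
apply: (@killed_growth _ (bump_gen c1 c2 0) _ _ _ _ _ _ _ setT) => //; last by move=> s _ _; exact: aeW.
- exact: bump_fun_continuous.
- exact: bump_gen_continuous.
- exact: bump_domain.
- by move=> y; rewrite /bump_fun /bump exprn_ge0// le_max lexx orbT.
- move=> y nEy; rewrite bump_fun0//; apply/negP => /andP[h1 h2]; apply: nEy.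
  apply: state_interiorW; split; first exact: lt_trans (I1.1) h1.
  by apply: lt_trans (I2.2); rewrite lte_fin.
- by rewrite bump_fun0// ltNge (ltW I1.1).
- exact: bump_gen_bounded.
move=> y _; have [yc|yc] := boolP (c1 < y < c2); last first.
  by rewrite bump_fun0// bump_gen0// mulr0.
have Iy : I y.
  case/andP: yc => h1 h2; split; first exact: lt_trans (I1.1) h1.
  by apply: lt_trans (I2.2); rewrite lte_fin.
have yc' : c1 <= y <= c2 by case/andP: yc => ? ?; rewrite !ltW.
have [h1 h2] := hK y yc'.
rewrite bump_funE ?bump_genE//; last exact: state_interiorW.
apply: (@le_trans _ _ (- (150 / (S c2 - S c1) ^+ 2) * bump (S c1) (S c2) 0 (S y) * (derive1 S y / m y))).
  have c0 : 0 <= 150 / (S c2 - S c1) ^+ 2 by rewrite divr_ge0// sqr_ge0.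
  have B0 : 0 <= bump (S c1) (S c2) 0 (S y) by rewrite /bump exprn_ge0// le_max lexx orbT.
  have := ler_wpM2l (mulr_ge0 c0 B0) h2; rewrite /lam.
  by move: (150 / _) (bump _ _ _ _) (_ / m y) => c B r; lra.
apply: ler_wpM2r; first exact: le_trans (ltW k00) h1.
exact: bump2_ge.
Qed.

Lemma hitting_lt_shift z t e (w : cpath R) : 0 <= t -> (hitting_time z (shift_path t w) < e%:E)%E ->
  (hitting_time z w < (t + e)%:E)%E.
Proof.
move=> t0 h; have hf : hitting_time z (shift_path t w) \is a fin_num.
  by rewrite ge0_fin_numE ?hitting_ge0// (lt_trans h)// ltry.
have := fineK hf => /esym /hitting_finP[s0 ws _].
apply: (@le_lt_trans _ _ (t + fine (hitting_time z (shift_path t w)))%:E).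
  apply/hitting_leP; exists (t + fine (hitting_time z (shift_path t w))); split => //.
    exact: addr_ge0.
  by rewrite -shift_pathE.
by rewrite lte_fin ltrD2l -lte_fin fineK.
Qed.

Lemma hitting_between z c (w : cpath R) : z <= c -> c <= w 0 -> (hitting_time c w <= hitting_time z w)%E.
Proof.
move=> zc cw; case h : (hitting_time z w) => [t| |]; last 2 first.
- exact: leey.
- by have := hitting_ge0 z w; rewrite h.
move: h => /hitting_finP[t0 wt _]; apply/hitting_leP.
have cont : {within `[0, t], continuous w}.
  by apply: continuous_subspaceT => s; exact: path_cont.
have w0t : Num.min (w 0) (w t) <= c <= Num.max (w 0) (w t).
  by rewrite ge_min le_max wt zc cw orbT.
have [s] := IVT t0 cont w0t.
by rewrite in_itv/= => /andP[s0 st] ws; exists s.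
Qed.

Lemma measurable_hitting_lt z (e : \bar R) : measurable [set w : cpath R | (hitting_time z w < e)%E].
Proof. by apply: measurable_time_lt; exact: proper_measurable (proper_hitting_time z). Qed.

Lemma measurable_hitting_shift z : measurable_fun setT
  (fun w : cpath R => (fine (hitting_time z w), shift_path (fine (hitting_time z w)) w)).
Proof.
have mt : measurable_fun setT (fun w : cpath R => fine (hitting_time z w)).
  by apply: measurable_fine_time; exact: proper_measurable (proper_hitting_time z).
by apply: measurable_fun_pair => //; exact: measurable_shift_comp.
Qed.

Lemma hitting_markov_gt0 x y (A : set R) (D : set (R * cpath R)) : E x ->
  measurable A -> measurable D ->
  (0 < P x [set w | (hitting_time y w < +oo)%E /\ A (fine (hitting_time y w))])%E ->
  (forall u : R, 0 <= u -> A u -> (0 < P y [set w | D (u, w)])%E) ->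
  (0 < P x [set w | (hitting_time y w < +oo)%E /\
    D (fine (hitting_time y w), shift_path (fine (hitting_time y w)) w)])%E.
Proof.
move=> Ex mA mD A0 hD; rewrite hitting_markov// lt0e; apply/andP; split; last exact: integral_ge0.
apply/eqP => int0; pose F (w : cpath R) := P y [set w' | D (fine (hitting_time y w), w')].
have mT : measurable_fun setT (fun w : cpath R => fine (hitting_time y w)).
  by apply: measurable_fine_time; exact: proper_measurable (proper_hitting_time y).
have mF : measurable_fun setT F.
  have h : measurable_fun setT (fun u : R => P y [set w' | D (u, w')]).
    exact: (@measurable_comp_kernel_section _ _ _ _ _ _ _ P (fun=> y) (measurable_cst y) D mD).
  exact: (measurableT_comp h mT).
have mH : measurable [set w : cpath R | (hitting_time y w < +oo)%E] by exact: measurable_hitting_lt.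
have := @ae_eq_integral_abs _ _ _ (P x) _ mH F (measurable_funTS mF).
move=> [+ _]; have h w : (`|F w| = F w)%E by rewrite gee0_abs.
rewrite (eq_integral F); last by move=> w _; exact: h.
move=> /(_ int0) ae0.
have : \forall w \ae P x, ~ [set w | (hitting_time y w < +oo)%E /\ A (fine (hitting_time y w))] w.
  move: ae0; apply: filterS => w h1 [Hw Aw].
  have := hD (fine (hitting_time y w)); rewrite fine_ge0 ?hitting_ge0// => /(_ isT Aw).
  by have := h1 Hw; rewrite /F => ->; rewrite ltxx.
move=> /negligibleP; rewrite (_ : ~` _ = [set w : cpath R | (hitting_time y w < +oo)%E /\ A (fine (hitting_time y w))]) => [|]; last first.
  by apply/seteqP; split => w /=; [move=> /contrapT|move=> ? ?].
have mB : measurable [set w : cpath R | (hitting_time y w < +oo)%E /\ A (fine (hitting_time y w))].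
  by apply: measurableI => //; rewrite -[X in measurable X]setTI; exact: mT.
by move=> /(_ mB) A00; move: A0; rewrite A00 ltxx.
Qed.

Lemma hitting_lt_fine z e (w : cpath R) :
  (hitting_time z w < e%:E)%E <-> (hitting_time z w < +oo)%E /\ fine (hitting_time z w) < e.
Proof.
split=> [h|[h1]]; last by rewrite -lte_fin fineK// ge0_fin_numE// hitting_ge0.
have h1 : (hitting_time z w < +oo)%E by rewrite (lt_trans h)// ltry.
by split => //; rewrite -lte_fin fineK// ge0_fin_numE// hitting_ge0.
Qed.

(** Strong Markov property at the visit to [y]; [D] records that the first leg took less than
    [e1]. *)
Lemma hitting_chain x y z e1 e2 : E x ->
  (0 < P x [set w | hitting_time y w < e1%:E])%E ->
  (0 < P y [set w | hitting_time z w < e2%:E])%E ->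
  (0 < P x [set w | hitting_time z w < (e1 + e2)%:E])%E.
Proof.
move=> Ex h1 h2; pose D := `]-oo, e1[%classic `*` [set w : cpath R | (hitting_time z w < e2%:E)%E].
have mD : measurable D by apply: measurableX => //; exact: measurable_hitting_lt.
have := @hitting_markov_gt0 x y `]-oo, e1[ D Ex _ mD.
have -> : [set w | (hitting_time y w < +oo)%E /\ `]-oo, e1[%classic (fine (hitting_time y w))] =
    [set w | (hitting_time y w < e1%:E)%E].
  apply/seteqP; split => w /=; rewrite in_itv/=; first by move=> h; apply/hitting_lt_fine.
  by move=> /hitting_lt_fine.
move=> /(_ _ h1) h; apply: (lt_le_trans (h _ _)) => //.
  move=> u u0 ue; rewrite (_ : [set w | _] = [set w | (hitting_time z w < e2%:E)%E])//.
  by apply/seteqP; split => w /= => [[]|].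
apply: le_measure; rewrite ?inE.
- rewrite (_ : [set w | _] = [set w | (hitting_time y w < +oo)%E] `&`
    (fun w => (fine (hitting_time y w), shift_path (fine (hitting_time y w)) w)) @^-1` D)//.
  apply: measurableI; first exact: measurable_hitting_lt.
  rewrite -[X in measurable X]setTI.
  exact: (measurable_hitting_shift y).
- exact: measurable_hitting_lt.
move=> w /= [_ [/=]]; rewrite in_itv/= => te h'.
have t0 : 0 <= fine (hitting_time y w) by rewrite fine_ge0// hitting_ge0.
by apply: lt_trans (hitting_lt_shift t0 h') _; rewrite lte_fin ltrD2r.
Qed.

Lemma law_le_ae x A B : measurable A -> measurable B ->
  (\forall w \ae P x, A w -> B w) -> (P x A <= P x B)%E.
Proof.
move=> mA mB [N [mN N0 hN]]; apply: (@le_trans _ _ (P x (B `|` N))).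
  apply: le_measure; rewrite ?inE//; first exact: measurableU.
  move=> w Aw; have [Bw|Bw] := pselect (B w); [by left|right].
  by apply: hN => h; apply: Bw; exact: h.
by apply: (le_trans (measureU2 _ mB mN)); rewrite [X in (_ + X)%E]N0 adde0.
Qed.

(* Otherwise the path stays above c up to time eps, where the n-th bump centred
   below c in scale grows at rate of order n^2, while the bumps are at most Q ^ n. *)
Lemma descent_local c y eps : 0 < c -> c < y -> I y -> S y - S 0 < 2 * (S c - S 0) -> 0 < eps ->
  (0 < P y [set w | hitting_time c w < eps%:E])%E.
Proof.
move=> c0 cy Iy Scy eps0; have Ey := state_interiorW Iy; have y0 := lt_trans c0 cy.
have Ic : I c by exact: state_space_lt Ey c0 cy.
rewrite lt0e measure_ge0 andbT; apply/eqP => P0.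
(* The bump on $[c1,c2]$ has to contain [y] and to have its scale midpoint below [c]. The hypothesis
   on the scale leaves room for [c1] near 0, then for [c2] slightly above [y]. *)
have [c1 [c10 c1c Sc1]] : exists c1, [/\ 0 < c1, c1 < c & S c1 + S y < 2 * S c].
  have E0 : E 0 by apply: (state_space_itv Ey) => //; exact: ltW.
  have h : S u @[u --> within E (nbhs 0)] --> S 0 := iffLR (subspace_continuousP _ _) (ss_S_cont Sm) 0 E0.
  have : \forall u \near within E (nbhs 0), S u < 2 * S c - S y.
    by apply: (cvgr_lt _ h); move: (S y) (S 0) (S c) Scy => p1 p2 p3 ?; lra.
  rewrite near_withinE => /nbhs_ballP[r /= r0 hr].
  exists (Num.min (r / 2) (c / 2)).
  have p0 : 0 < Num.min (r / 2) (c / 2) by rewrite lt_min !divr_gt0.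
  have pc : Num.min (r / 2) (c / 2) < c by rewrite gt_min orbC ltr_pdivrMr// ltr_pMr// ltr1n.
  split => //; rewrite -ltrBrDr; apply: hr.
    rewrite /ball/= sub0r normrN gtr0_norm// gt_min.
    by rewrite ltr_pdivrMr// ltr_pMr// ltr1n.
  by apply: (state_space_itv (state_interiorW Ic)); exact: ltW.
have Ic1 : I c1 by apply: state_space_lt Ey c10 _; exact: lt_trans cy.
have [c2 [yc2 Ic2 Sc2]] : exists c2, [/\ y < c2, I c2 & S c1 + S c2 < 2 * S c].
  have h := scale_continuous Iy.
  have h1 : \forall u \near y, S u < 2 * S c - S c1.
    by apply: (cvgr_lt _ h); rewrite ltrBrDr addrC.
  have h2 : \forall u \near y, I u by exact: open_state_interior.
  have : \forall u \near y, S u < 2 * S c - S c1 /\ I u by exact: filterI h1 h2.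
  move=> /nbhs_ballP[r /= r0 hr].
  exists (y + r / 2); have [] := hr (y + r / 2).
    rewrite /ball/= opprD addrA subrr sub0r normrN gtr0_norm ?divr_gt0//.
    by rewrite ltr_pdivrMr// ltr_pMr// ltr1n.
  move=> h3 h4; split => //; first by rewrite ltrDl divr_gt0.
  by rewrite addrC -ltrBrDr.
have c12 : c1 < c2 by exact: lt_trans c1c (lt_trans cy yc2).
(* [eta] is the scale distance from the midpoint to [c]; a path that stays above [c] stays at least
   that far from the midpoint. *)
pose al := S c1; pose be := S c2; pose eta := S c - (al + be) / 2.
have eta0 : 0 < eta by rewrite /eta /al /be; move: Sc2; lra.
have alc : al < S c by apply: scale_lt => //; [exact: ltW|exact: state_interiorW].
have [k0 [K [k00 K0 hK]]] := scale_speed_ratio Ic1 Ic2 (ltW c12).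
pose Q := (be - al) ^+ 2 / 4.
have q0 : 0 < (S y - al) * (be - S y).
  rewrite mulr_gt0// subr_gt0; first by apply: lt_trans alc _; apply: scale_lt => //; exact: ltW.
  by apply: scale_lt => //; [exact: ltW|exact: state_interiorW].
set q := (S y - al) * (be - S y) in q0.
have qQ : q <= Q by exact: quad_le.
have Q0 : 0 < Q by exact: lt_le_trans qQ.
pose kap := 2 * eta ^+ 2 / Q ^+ 2 * k0.
have kap0 : 0 < kap by rewrite mulr_gt0// divr_gt0 ?exprn_gt0// mulr_gt0// exprn_gt0.
have growth n : Q <= eta ^+ 2 * n.+2%:R ->
    q ^+ n.+3 * expR (n.+3%:R * n.+2%:R * kap * eps) <= Q ^+ n.+3.
  move=> hn; pose f := bump_fun c1 c2 n.
  have fy : f y = q ^+ n.+3 by rewrite /f bump_funE// /bump max_l// ltW.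
  have f_ge0 x : 0 <= f x by rewrite /f /bump_fun /bump exprn_ge0// le_max lexx orbT.
  have cf : continuous f by exact: bump_fun_continuous.
  have kQ : killed f eps y <= Q ^+ n.+3.
    apply: le_trans (ler_norm _) _; apply: law_integral_le.
    - exact: measurable_alive.
    - exact: measurableT_comp (continuous_measurable_fun cf) (measurable_eval eps).
    - by move=> w; rewrite ger0_norm//; exact: bump_le.
  apply: le_trans kQ; rewrite -fy.
  apply: (@killed_growth f (bump_gen c1 c2 n) _ _ _ _ _ _ _ [set x | c <= x /\ E x]) => //.
  - exact: bump_gen_continuous.
  - exact: bump_domain.
  - move=> x nEx; rewrite /f bump_fun0//; apply/negP => /andP[h1 h2]; apply: nEx.
    apply: state_interiorW; split; first exact: lt_trans h1.
    by apply: lt_trans (Ic2.2); rewrite lte_fin.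
  - by rewrite /f bump_fun0// ltNge (ltW c10).
  - exact: bump_gen_bounded.
  - exact: ltW.
  - move=> x [cx Ex]; have [xc|xc] := boolP (c1 < x < c2); last first.
      by rewrite /f bump_fun0// bump_gen0// mulr0.
    have /andP[c1x xc2] := xc.
    have Ix : I x by apply: state_space_lt (state_interiorW Ic2) _ xc2; exact: lt_trans c1x.
    have xc' : c1 <= x <= c2 by rewrite !ltW.
    have [h1 h2] := hK x xc'.
    rewrite /f bump_funE// bump_genE//.
    have B0 : 0 <= bump al be n (S x) by rewrite /bump exprn_ge0// le_max lexx orbT.
    have alx : al < S x by apply: scale_lt => //; exact: ltW.
    have xbe : S x < be by apply: scale_lt => //; [exact: le_trans (ltW c0) cx|exact: state_interiorW].
    have Scx : S c <= S x by apply: scale_le => //; exact: ltW.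
    have etax : eta <= S x - (al + be) / 2 by rewrite /eta lerD2r.
    have h3 := bump2_growth alx xbe eta0 etax hn.
    apply: (@le_trans _ _ (n.+3%:R * n.+2%:R * (2 * eta ^+ 2 / Q ^+ 2) * bump al be n (S x) * (derive1 S x / m x))).
      have A0 : 0 <= n.+3%:R * n.+2%:R * (2 * eta ^+ 2 / Q ^+ 2) * bump al be n (S x).
        apply: mulr_ge0 => //; apply: mulr_ge0; first exact: mulr_ge0.
        by apply: divr_ge0; rewrite ?sqr_ge0// mulr_ge0// sqr_ge0.
      have := ler_wpM2l A0 h1; rewrite /kap.
      move: (n.+3%:R) (n.+2%:R) (2 * _ / _) (bump _ _ _ _) (_ / m x) => N3 N2 A B r; lra.
    by apply: ler_wpM2r h3; exact: le_trans (ltW k00) h1.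
  move=> t t0 te; have h1 := start_ae Ey; have h2 := state_ae Ey t0.
  have h3 := null_ae (measurable_hitting_lt _ _) P0.
  near=> w => _; split; last by near: w.
  have w0 : w 0 = y by near: w.
  have hw : ~ (hitting_time c w < eps%:E)%E by near: w.
  rewrite leNgt; apply/negP => wc; apply: hw.
  apply: (@le_lt_trans _ _ t%:E); last by rewrite lte_fin.
  apply: (@le_trans _ _ (hitting_time (w t) w)).
    by apply: hitting_between; [exact: ltW|rewrite w0 ltW].
  by apply/hitting_leP; exists t.
have ke0 : 0 < kap * eps * q by apply: mulr_gt0 => //; exact: mulr_gt0.
(* Large enough for the growth estimate, and for a contradiction with its consequence
   $q\,(1+(n+2)\,kap\,eps)\le Q$, obtained by taking roots and from $e^a\ge1+a$. *)
pose n := (Num.truncn (Q / (kap * eps * q)) + Num.truncn (Q / eta ^+ 2))%N.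
have n1 : Q / (kap * eps * q) < n.+2%:R.
  by apply: lt_le_trans (truncnS_gt _) _; rewrite ler_nat /n !ltnS leqW// leq_addr.
have n2 : Q / eta ^+ 2 <= n.+2%:R.
  by apply: le_trans (ltW (truncnS_gt _)) _; rewrite ler_nat /n !ltnS leqW// leq_addl.
have /growth : Q <= eta ^+ 2 * n.+2%:R by rewrite mulrC -ler_pdivrMr// exprn_gt0.
have -> : q ^+ n.+3 * expR (n.+3%:R * n.+2%:R * kap * eps) =
    (q * expR (n.+2%:R * (kap * eps))) ^+ n.+3 
  by rewrite [RHS]exprMn -(expRM_natl n.+3) !mulrA.
rewrite ler_pXn2r ?nnegrE//; last 2 first.
- by apply: mulr_ge0; [exact: ltW|exact: expR_ge0].
- exact: ltW.
have h := expR_ge1Dx (n.+2%:R * (kap * eps)).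
move=> h'; have := le_trans (ler_wpM2l (ltW q0) h) h'.
move: n1; rewrite ltr_pdivrMr//.
move: (n.+2%:R) => N; nra.
Unshelve. all: by end_near. Qed.

(** [descent_local] goes down by any scale factor above one half. Steps by the factor $2/3$ are thus
    allowed, finitely many of them reach [c], and each takes half of the time that is left. *)
Lemma descent c y eps : 0 < c -> c < y -> I y -> 0 < eps ->
  (0 < P y [set w | hitting_time c w < eps%:E])%E.
Proof.
move=> c0 cy Iy eps0; have Ic := state_space_lt (state_interiorW Iy) c0 cy.
have Sc : 0 < S c - S 0 by rewrite subr_gt0; apply: scale_lt => //; exact: state_interiorW.
have [n hn] : exists n, S y - S 0 < (3 / 2) ^+ n * (S c - S 0).
  (* Bernoulli's inequality, to bound the number of steps. *)
  have bern n : 1 + n%:R / 2 <= (3 / 2 : R) ^+ n.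
    elim: n => [|n IHn]; first by rewrite mul0r addr0 expr0.
    rewrite exprS; have n0 : (0 : R) <= n%:R by [].
    by move: IHn n0; rewrite -(natr1 n); move: (n%:R : R) ((3 / 2 : R) ^+ n) => N r h1 h2; lra.
  pose r := (S y - S 0) / (S c - S 0); pose n := Num.truncn (2 * r).
  exists n.+1; rewrite -ltr_pdivrMr// -/r.
  have h1 : 2 * r < n.+1%:R by exact: truncnS_gt.
  by have := bern n.+1; move: h1; move: (n.+1%:R) (_ ^+ _) => N p; lra.
elim: n y eps cy Iy eps0 hn => [|n IHn] y eps cy Iy eps0 hn.
  move: hn; rewrite expr0 mul1r ltrD2r ltNge => /negP[].
  by apply: scale_le => //; [exact: ltW|exact: state_interiorW|exact: ltW].
have [hy|hy] := ltP (S y - S 0) (2 * (S c - S 0)); first exact: descent_local.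
have Ey := state_interiorW Iy; have y0 := lt_trans c0 cy.
have cS : {within `[0, y], continuous S} by exact: within_state (ss_S_cont Sm).
have Sy : Num.min (S 0) (S y) <= S 0 + (S y - S 0) * (2 / 3) <= Num.max (S 0) (S y).
  have h := scale_lt (lexx 0) Ey y0; rewrite min_l ?max_r ?(ltW h)//.
  by apply/andP; split; move: h; lra.
have [y'] := IVT (ltW y0) cS Sy; rewrite in_itv/= => /andP[y'0 y'y] Sy'.
have h0 := scale_lt (lexx 0) Ey y0.
have Ey' : E y' by exact: state_space_itv Ey y'0 y'y.
have cy' : c < y'.
  rewrite ltNge; apply/negP => y'c.
  have := scale_le y'0 (state_interiorW Ic) y'c; rewrite Sy'; move: hy h0 Sc; lra.
have y'y' : y' < y.
  rewrite lt_neqAle y'y andbT; apply/eqP => yy; move: Sy'; rewrite yy; move: h0; lra.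
have Iy' : I y' by apply: state_space_lt Ey _ y'y'; exact: lt_trans cy'.
have e20 : 0 < eps / 2 by rewrite divr_gt0.
rewrite [eps]splitr; apply: (hitting_chain Ey (y := y')).
  apply: descent_local => //; first exact: lt_trans cy'.
  by rewrite Sy'; move: h0; lra.
apply: IHn => //; rewrite Sy'; move: hn; rewrite exprS; lra.
Qed.

Lemma state_interior_above x : I x -> exists2 y, x < y & I y.
Proof.
move=> Ix; have : \forall u \near x, I u by exact: open_state_interior.
move=> /nbhs_ballP[r /= r0 hr]; exists (x + r / 2); first by rewrite ltrDl divr_gt0.
apply: hr; rewrite /ball/= opprD addrA subrr sub0r normrN gtr0_norm ?divr_gt0//.
by rewrite ltr_pdivrMr// ltr_pMr// ltr1n.
Qed.

(** Otherwise 0 is reached from no small level in time less than [eps]. A path from [x] with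
    extinction time [T], finite by recurrence, would then visit all the levels [del n] before
    [T - eps], so its minimum over $[0,T-eps]$ would be 0, although it is alive there. *)
Lemma hitting_small x eps : I x -> 0 < eps -> exists2 del, 0 < del < x &
  (0 < P del [set w | hitting_time 0 w < eps%:E])%E.
Proof.
move=> Ix eps0; have Ex := state_interiorW Ix; have x0 : 0 < x by case: Ix.
apply: contrapT => /forall2NP h.
pose del n := x / n.+2%:R.
have del0 n : 0 < del n by rewrite divr_gt0.
have delx n : del n < x by rewrite ltr_pdivrMr// ltr_pMr// ltr1n.
have null n : \forall w \ae P x, ~ ((hitting_time (del n) w < +oo)%E /\
    (hitting_time 0 (shift_path (fine (hitting_time (del n) w)) w) < eps%:E)%E).
  pose D : set (R * cpath R) := setT `*` [set w | (hitting_time 0 w < eps%:E)%E].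
  have mD : measurable D by apply: measurableX => //; exact: measurable_hitting_lt.
  have Pd : P (del n) [set w | (hitting_time 0 w < eps%:E)%E] = 0.
    have [/negP|/negP] := h (del n); first by rewrite del0 delx.
    by rewrite lt0e measure_ge0 andbT negbK => /eqP.
  have := hitting_markov (del n) Ex mD; rewrite integral0_eq; last first.
    move=> w _; rewrite (_ : [set w' | _] = [set w' | (hitting_time 0 w' < eps%:E)%E])//.
    by apply/seteqP; split => w' /= => [[]|].
  have mB : measurable [set w : cpath R | (hitting_time (del n) w < +oo)%E /\
      D (fine (hitting_time (del n) w), shift_path (fine (hitting_time (del n) w)) w)].
    apply: measurableI; first exact: measurable_hitting_lt.
    rewrite -[X in measurable X]setTI; exact: (measurable_hitting_shift (del n)).
  move=> /(null_ae mB); apply: filterS => w hw [h1 h2]; apply: hw; split => //.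
have E0 : E 0 by apply: (state_space_itv Ex) => //; exact: ltW.
have : \forall w \ae P x, forall n, ~ ((hitting_time (del n) w < +oo)%E /\
    (hitting_time 0 (shift_path (fine (hitting_time (del n) w)) w) < eps%:E)%E).
  by apply/ae_foralln.
move=> hn; have hs := start_ae Ex; have ht := hitting_ae Ex E0.
suff : P x setT = 0 by rewrite prob_kernel => /eqP; rewrite onee_eq0.
have : \forall w \ae P x, False.
  near=> w; have w0 : w 0 = x by near: w.
  have wT : (hitting_time 0 w < +oo)%E by near: w.
  have wn : forall n, ~ ((hitting_time (del n) w < +oo)%E /\
    (hitting_time 0 (shift_path (fine (hitting_time (del n) w)) w) < eps%:E)%E) by near: w.
  have Tf : hitting_time 0 w \is a fin_num by rewrite ge0_fin_numE ?hitting_ge0.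
  pose T := fine (hitting_time 0 w).
  have TE : hitting_time 0 w = T%:E by rewrite fineK.
  (* The first visit to [del n] precedes [T]; were it later than [T - eps], the rest of the way to 0
     would take less than [eps], against [wn]. *)
  have sn n : exists s, [/\ 0 <= s, s <= T - eps & w s = del n].
    have sT : (hitting_time (del n) w <= hitting_time 0 w)%E.
      by apply: hitting_between; [exact: ltW|rewrite w0 ltW].
    have sf : hitting_time (del n) w \is a fin_num.
      by rewrite ge0_fin_numE ?hitting_ge0// (le_lt_trans sT).
    have /esym/hitting_finP[s0 ws _] := fineK sf.
    exists (fine (hitting_time (del n) w)); split => //.
    rewrite lerBrDr leNgt; apply/negP => lt; apply: (wn n); split.
      by rewrite (le_lt_trans sT).
    have := @hitting_shift _ 0 _ w s0; rewrite fineK// => /(_ sT); rewrite TE => e.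
    move: e; case: (hitting_time 0 (shift_path _ _)) => [u| |] //=; last 2 first.
      - by rewrite -(fineK sf).
      - by rewrite ltNyr.
    rewrite -[in X in _ = X](fineK sf) -EFinD => -[e].
    by move: lt; rewrite e ltrD2l lte_fin.
  have Te : 0 <= T - eps by have [s [s0 s1 _]] := sn 0%N; exact: le_trans s1.
  have cw : {within `[0, T - eps], continuous w}.
    by apply: continuous_subspaceT => s; exact: path_cont.
  have [c ci hc] := EVT_min Te cw.
  have wc : 0 < w c.
    move: ci; rewrite in_itv/= => /andP[c0 cT].
    have /hitting_gtP ca : alive c w.
      by rewrite /alive/= TE lte_fin (le_lt_trans cT)// ltrBlDr ltrDl.
    by apply: alive_gt0 => //; [rewrite w0 ltW|apply/hitting_gtP].
  pose n := Num.truncn (x / w c).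
  have [s [s0 sT ws]] := sn n.
  have := hc s; rewrite in_itv/= s0 sT => /(_ isT); rewrite ws leNgt => /negP; apply.
  rewrite /del ltr_pdivrMr// mulrC -ltr_pdivrMr//.
  by apply: lt_trans (truncnS_gt _) _; rewrite ltr_nat.
move=> /negligibleP; rewrite (_ : ~` _ = setT); first by apply.
by apply/seteqP; split => w //= _ [].
Unshelve. all: by end_near. Qed.

Lemma extinction_gt0 x eps : I x -> 0 < eps -> (0 < P x [set w | hitting_time 0 w < eps%:E])%E.
Proof.
move=> Ix eps0; have e20 : 0 < eps / 2 by rewrite divr_gt0.
have [del /andP[d0 dx] hd] := hitting_small Ix e20.
rewrite [eps]splitr; apply: (hitting_chain (state_interiorW Ix) (y := del)) => //.
exact: descent.
Qed.

Lemma survival_gt0 x t : I x -> 0 <= t -> (0 < P x (alive t))%E.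
Proof.
move=> Ix t0; have x0 : 0 < x by case: Ix.
have [c2 xc2 Ic2] := state_interior_above Ix.
have x2 : x / 2 < x by rewrite ltr_pdivrMr// ltr_pMr// ltr1n.
have Ic1 : I (x / 2) by apply: state_space_lt (state_interiorW Ix) _ x2; rewrite divr_gt0.
apply: lt_le_trans (stay_gt0 Ic1 Ic2 x2 xc2 t0) _; apply: le_measure; rewrite ?inE.
- by apply: measurableI; [exact: measurable_alive|exact: measurable_eval_itv].
- exact: measurable_alive.
- by move=> w [].
Qed.

Lemma alive_eval_filtration t (A : set R) : 0 <= t -> measurable A ->
  natural_filtration t (alive t `&` [set w | A (w t)]).
Proof.
move=> t0 mA; apply: natural_filtration_invariant => //.
  apply: measurableI; first exact: measurable_alive.
  rewrite -[X in measurable X]setTI; exact: measurable_eval.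
move=> w; have h := proper_stop (proper_hitting_time 0) w t0 (lexx t).
rewrite /setI /mkset stop_pathE// /alive /mkset !ltNge.
by split => -[/negP h' Aw]; split => //; apply/negP => /h.
Qed.

(** Stay in a neighbourhood of [y] above [z0] until [t], then die quickly from an interior point. *)
Lemma extinction_window_gt0 (z0 y t r : R) : 0 < z0 -> z0 < y -> I y -> 0 <= t -> t < r ->
  (0 < P y ((alive t `&` [set w | (z0 < w t)%R]) `&`
     shift_path t @^-1` [set w | hitting_time 0 w < (r - t)%:E]))%E.
Proof.
move=> z00 z0y Iy t0 tr; have Ey := state_interiorW Iy.
have [c2 yc2 Ic2] := state_interior_above Iy.
have Iz := state_space_lt Ey z00 z0y.
have mi : measurable (`]z0, c2[%classic : set R) by exact: measurable_itv.
have e : alive t `&` [set w : cpath R | `]z0, c2[%classic (w t)] = alive t `&` [set w : cpath R | z0 < w t < c2].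
  by apply/seteqP; split => w; rewrite /= in_itv.
have F := alive_eval_filtration t0 mi.
have mB := measurable_hitting_lt 0 (r - t)%:E.
apply: (@lt_le_trans _ _ (P y ((alive t `&` [set w : cpath R | `]z0, c2[%classic (w t)]) `&`
     shift_path t @^-1` [set w | (hitting_time 0 w < (r - t)%:E)%E]))).
  apply: simple_markov_gt0 => //; first by rewrite e; exact: stay_gt0.
  move=> w [_ /=]; rewrite in_itv/= => /andP[h1 h2] _.
  apply: extinction_gt0; last by rewrite subr_gt0.
  by apply: state_space_lt (state_interiorW Ic2) _ h2; exact: lt_trans h1.
have mS : measurable (shift_path t @^-1` [set w : cpath R | (hitting_time 0 w < (r - t)%:E)%E]).
  by rewrite -[X in measurable X]setTI; exact: measurable_shift_path.
apply: le_measure; rewrite ?inE.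
- by apply: measurableI => //; exact: natural_filtration_measurable F.
- apply: measurableI => //; apply: measurableI; first exact: measurable_alive.
  exact: measurable_eval_gt.
by move=> w [[h1 /=]]; rewrite in_itv/= => /andP[h2 _] h3.
Qed.

(** Three legs: reach [c] in the middle of $(0,z0)$ before [t], stay between [c / 2] and [z0] until
    [t], survive from [t] to [r]. *)
Lemma survival_below_gt0 (z0 y t r : R) : 0 < z0 -> z0 < y -> I y -> 0 < t -> t <= r ->
  (0 < P y (alive r `&` [set w | (w t < z0)%R]))%E.
Proof.
move=> z00 z0y Iy t0 tr; have Ey := state_interiorW Iy.
have Iz := state_space_lt Ey z00 z0y.
pose c := z0 / 2.
have c0 : 0 < c by rewrite divr_gt0.
have cz : c < z0 by rewrite ltr_pdivrMr// ltr_pMr// ltr1n.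
have Ic := state_space_lt (state_interiorW Iz) c0 cz.
have cc : c / 2 < c by rewrite ltr_pdivrMr// ltr_pMr// ltr1n.
have Icc : I (c / 2) by apply: state_space_lt (state_interiorW Ic) _ cc; rewrite divr_gt0.
(* [p.1] is the time already used when the path [p.2] starts from [c]. *)
pose D : set (R * cpath R) := [set p : R * cpath R | [/\ p.1 < t, p.2 (t - p.1) < z0 &
  ((r - p.1)%:E < hitting_time 0 p.2)%E]].
have mD : measurable D.
  rewrite (_ : D = [set p : R * cpath R | p.1 < t] `&` ([set p : R * cpath R | p.2 (t - p.1) < z0] `&`
    [set p : R * cpath R | (r - p.1)%:E < hitting_time 0 p.2]%E)); last first.
    by apply/seteqP; split => p /= [h1]; [move=> h2 h3|case=> h2 h3]; split.
  have mt : measurable_fun setT (fun p : R * cpath R => t - p.1).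
    by apply: measurable_funB => //; exact: measurable_fst.
  have mw : measurable_fun setT (fun p : R * cpath R => p.2 (t - p.1)).
    by apply: measurable_eval_comp => //; exact: measurable_snd.
  apply: measurableI; last apply: measurableI.
  - rewrite (_ : mkset _ = fst @^-1` `]-oo, t[).
      by rewrite -[X in measurable X]setTI; apply: measurable_fst.
    by apply/seteqP; split => p; rewrite /= in_itv.
  - rewrite (_ : mkset _ = (fun p : R * cpath R => p.2 (t - p.1)) @^-1` `]-oo, z0[).
      by rewrite -[X in measurable X]setTI; apply: mw.
    by apply/seteqP; split => p; rewrite /= in_itv.
  - rewrite -[X in measurable X]setTI; apply: measurable_lte => //.
      by apply/measurable_EFinP; apply: measurable_funB => //; exact: measurable_fst.
    by apply: (measurableT_comp _ measurable_snd); exact: proper_measurable (proper_hitting_time 0).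
have Dpos (u : R) : 0 <= u -> `]-oo, t[%classic u -> (0 < P c [set w | D (u, w)])%E.
  move=> u0 /=; rewrite in_itv/= => ut; have tu : 0 <= t - u by rewrite subr_ge0 ltW.
  have mi : measurable (`]c / 2, z0[%classic : set R) by exact: measurable_itv.
  have e : alive (t - u) `&` [set w : cpath R | `]c / 2, z0[%classic (w (t - u))] =
      alive (t - u) `&` [set w : cpath R | c / 2 < w (t - u) < z0].
    by apply/seteqP; split => w; rewrite /= in_itv.
  have F := alive_eval_filtration tu mi.
  have mal := @measurable_alive R (r - t).
  apply: (@lt_le_trans _ _ (P c ((alive (t - u) `&` [set w : cpath R | `]c / 2, z0[%classic (w (t - u))]) `&`
     shift_path (t - u) @^-1` (alive (r - t))))).
    apply: simple_markov_gt0 => //; first exact: state_interiorW.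
      by rewrite e; exact: stay_gt0.
    move=> w [_ /=]; rewrite in_itv/= => /andP[h1 h2] _.
    apply: survival_gt0; last by rewrite subr_ge0.
    apply: state_space_lt (state_interiorW Iz) _ h2; apply: lt_trans h1.
    by rewrite divr_gt0.
  apply: le_measure; rewrite ?inE.
  - apply: measurableI; first exact: natural_filtration_measurable F.
    by rewrite -[X in measurable X]setTI; exact: measurable_shift_path.
  - have mu : measurable_fun setT (fun w : cpath R => (u, w)) by exact: measurable_fun_pair.
    by rewrite -[X in measurable X]setTI; exact: mu.
  move=> w [[h1 /=]]; rewrite in_itv/= => /andP[h2 h3] h4; split => //=.
  have rt : 0 <= r - t by rewrite subr_ge0.
  have := (aliveD w tu rt).2 (conj h1 h4); rewrite /alive/=.
  by rewrite (_ : t - u + (r - t) = r - u)//; ring.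
have := hitting_markov_gt0 Ey (measurable_itv `]-oo, t[) mD _ Dpos.
have -> : [set w | (hitting_time c w < +oo)%E /\ `]-oo, t[%classic (fine (hitting_time c w))] =
    [set w | (hitting_time c w < t%:E)%E].
  apply/seteqP; split => w /=; rewrite in_itv/=; first by move=> h; apply/hitting_lt_fine.
  by move=> /hitting_lt_fine.
move=> /(_ (descent c0 (lt_trans cz z0y) Iy t0)) h; apply: (lt_le_trans h).
apply: law_le_ae.
- apply: measurableI; first exact: measurable_hitting_lt.
  rewrite -[X in measurable X]setTI; exact: (measurable_hitting_shift c).
- apply: measurableI; first exact: measurable_alive.
  exact: measurable_eval_lt.
have := start_ae Ey; apply: filterS => w w0 [h1 [/= h2 h3 h4]].
have sT : (hitting_time c w <= hitting_time 0 w)%E.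
  by apply: hitting_between; [exact: ltW|rewrite w0 ltW// (lt_trans cz)].
have sf : hitting_time c w \is a fin_num by rewrite ge0_fin_numE ?hitting_ge0.
have /esym/hitting_finP[s0 ws _] := fineK sf.
split; last first.
  by move: h3; rewrite max_l ?subr_ge0 ?ltW// addrC subrK.
have := @hitting_shift _ 0 _ w s0; rewrite fineK// => /(_ sT).
rewrite /alive/= => ->; rewrite -{1}(fineK sf) -lteBlDl// -EFinB.
Qed.

Lemma law_expect_continuous (h : R -> R) K x : continuous h -> (forall y, `|h y| <= K) ->
  continuous (fun s : R => \int[P x]_w h ((w : cpath R) s)).
Proof.
move=> ch hK s; apply/(@cvg_nbhsP _ R^o) => u us.
have mh t : measurable_fun setT (fun w : cpath R => h (w t)).
  exact: measurableT_comp (continuous_measurable_fun ch) (measurable_eval t).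
apply: (@law_dominated_convergence _ setT (fun n (w : cpath R) => h (w (u n))) (fun w => h (w s)) K K) => //.
apply: aeW => w _; split => //.
by apply: continuous_cvg; [exact: ch|apply: continuous_cvg => //; exact: path_cont].
Qed.

(** * Occupation of points *)

Section dynkin.
Variables (f g : R -> R) (B C : R).
Hypotheses (fg : dm_dS b k S m f g) (fB : forall x, E x -> `|f x| <= B).
Hypotheses (mg : measurable_fun setT g) (gC : forall x, `|g x| <= C).

Let F := f \_ E.

Let mF : measurable_fun setT F.
Proof.
apply: (iffLR (measurable_restrictT _ measurable_state_space)).
apply: subspace_continuous_measurable_fun; first exact: measurable_state_space.
by have [[]] := fg.
Qed.

Let B0 : 0 <= B.
Proof.
have E0 : E 0.
  by split => //; case: (k); [exact: ltW (ss_b_gt0 Sm)|exact: (ss_b_gt0 Sm)|exact: (ss_b_gt0 Sm)].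
exact: le_trans (normr_ge0 _) (fB E0).
Qed.

Let FB x : `|F x| <= B.
Proof. by rewrite /F patchE; case: ifPn => [/[!inE]|_]; [exact: fB|rewrite normr0]. Qed.

Let FE x : E x -> F x = f x.
Proof. by move=> Ex; rewrite /F patchE mem_set. Qed.

Let mFe t : measurable_fun setT (fun w : cpath R => F (w t)).
Proof. exact: measurableT_comp mF (measurable_eval t). Qed.

Let sg t x := \int[P x]_w F ((w : cpath R) t).

Let msg t : measurable_fun setT (sg t).
Proof. by apply: measurable_law_integral => // w; exact: FB. Qed.

Let sg_le t x : `|sg t x| <= B.
Proof. by apply: law_integral_le => // w; exact: FB. Qed.

Let semigroupE t x : semigroup b k P t f x = sg t x.
Proof.
rewrite /semigroup Rintegral_mkcond; apply: eq_Rintegral => w _.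
by rewrite /F !patchE; congr (if _ then _ else _); apply/idP/idP; rewrite !inE.
Qed.

Let generator_fg : generator b k P f g.
Proof. exact/(diff_generator P_diff). Qed.

Let sg_cvg x : E x -> (sg n.+1%:R^-1 x - F x) / n.+1%:R^-1 @[n --> \oo] --> g x.
Proof.
move=> Ex; have [_ _ + _] := generator_fg => /(_ x Ex) h.
have := iffLR (cvg_at_rightP _ _ _) h (fun n => n.+1%:R^-1).
have e n : (semigroup b k P n.+1%:R^-1 f x - f x) / n.+1%:R^-1 = (sg n.+1%:R^-1 x - F x) / n.+1%:R^-1.
  by rewrite semigroupE FE.
rewrite (funext e); apply; split; [by move=> n; rewrite invr_gt0 ltr0n|exact: cvg_harmonic].
Qed.

Let sg_bd : exists2 K, 0 <= K & forall t x, 0 < t -> E x -> `|sg t x - F x| <= K * t.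
Proof.
have [_ _ _ [K hK]] := generator_fg; exists `|K| => // t x t0 Ex.
have := hK t x t0 Ex; rewrite semigroupE FE// normrM normfV (gtr0_norm t0) ler_pdivrMr//.
by move=> h; rewrite (le_trans h)// ler_wpM2r ?(ltW t0)// ler_norm.
Qed.

Let sg_diff x t u : E x -> 0 <= t -> 0 <= u ->
  sg (t + u) x - sg t x = \int[P x]_w (sg u ((w : cpath R) t) - F (w t)).
Proof.
move=> Ex t0 u0; rewrite RintegralB//.
- congr (_ - _).
  have FT : natural_filtration t (@setT (cpath R)) by exact: natural_filtration_invariant.
  rewrite -(simple_markov_Rintegral Ex t0 FT (mFe u) (fun w => FB (w u))).
  by apply: eq_Rintegral => w _; rewrite shift_pathE.
- apply: (@law_integrable _ _ (fun w : cpath R => sg u (w t)) B) => //.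
  exact: measurableT_comp (msg u) (measurable_eval t).
- by apply: (@law_integrable _ _ (fun w : cpath R => F (w t)) B).
Qed.

Let expect (h : R -> R) x (s : R) := \int[P x]_w h ((w : cpath R) s).

(** Dynkin's formula as an inequality: [sg u x + kap * u - H u] has the expectation of
    [g + kap - bet] as its right derivative, so it does not decrease, and [sg] stays between [- B]
    and [B]. *)
Lemma occupation_le (bet : R -> R) K kap x t : continuous bet -> (forall y, `|bet y| <= K) ->
  (forall y, E y -> bet y - kap <= g y) -> E x -> 0 <= t ->
  \int[leb]_(s in `]0, t]) (\int[P x]_w bet ((w : cpath R) s)) <= B + B + kap * t.
Proof.
move=> cbet betK betg Ex t0; pose h := expect bet x.
have ch : continuous h by exact: law_expect_continuous cbet betK.
have hK s : `|h s| <= K.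
  apply: law_integral_le => //.
  exact: measurableT_comp (continuous_measurable_fun cbet) (measurable_eval s).
(* The integral starts at -1 so that [H] has a two-sided derivative at 0 as well; [h] is continuous
   there, since paths are constant before 0. *)
pose H (u : R) := \int[leb]_(s in `]-1, u]) h s.
have inth u v : leb.-integrable `]u, v] (EFin \o h).
  apply: measurable_bounded_integrable => //.
  - by rewrite /= lebesgue_measure_itv; case: ifP => _; rewrite ?ltry.
  - by apply: measurable_funTS; exact: continuous_measurable_fun.
  - by exists K; split; [exact: num_real|move=> r Kr y _; exact: le_trans (hK y) (ltW Kr)].
have dH (u : R) : 0 <= u -> is_derive u 1 H (h u).
  move=> u0; have u1 : u < u + 1 by rewrite ltrDl.
  have := @continuous_FTC1 _ h (BRight (-1)) u _ u1 (inth _ _).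
  rewrite /= /Order.lt/= => /(_ _ (ch u)) [|d dE]; first by rewrite (lt_le_trans _ u0)// oppr_lt0.
  by rewrite -dE derive1E; apply: derivableP.
have [L L0 hL] := sg_bd.
have mge s : measurable_fun setT (fun w : cpath R => g (w s)).
  exact: measurableT_comp mg (measurable_eval s).
have lip s u : 0 <= s -> s < u -> `|sg u x - sg s x| <= L * (u - s).
  move=> s0 su; have u0 : 0 < u - s by rewrite subr_gt0.
  rewrite -{1}(subrK s u) [_ - s + s]addrC sg_diff ?(ltW u0)//.
  apply: law_integral_le_ae => //.
  - by apply: measurable_funB => //; exact: measurableT_comp (msg _) (measurable_eval s).
  - by rewrite mulr_ge0// ltW.
  by have := state_ae Ex s0; apply: filterS => w Ew _; exact: hL.
have csg : {within `[0, t], continuous (sg ^~ x)}.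
  apply/subspace_continuousP => s; rewrite /= in_itv/= => /andP[s0 st].
  apply/cvgrPdist_lt => e e0; have L1 : 0 < L + 1 by rewrite ltr_wpDl.
  rewrite near_withinE; near=> u => /=; rewrite in_itv/= => /andP[u0 ut].
  have le : `|sg s x - sg u x| <= L * `|s - u|.
    have [su|us|->] := ltgtP s u; last by rewrite !subrr !normr0 mulr0.
      by rewrite distrC [X in _ * X]distrC (ger0_norm (_ : 0 <= u - s)) ?subr_ge0 ?(ltW su)// lip.
    by rewrite (ger0_norm (_ : 0 <= s - u)) ?subr_ge0 ?(ltW us)// lip.
  apply: (le_lt_trans le); rewrite (@le_lt_trans _ _ ((L + 1) * `|s - u|))//.
    by rewrite ler_wpM2r// lerDl.
  rewrite -ltr_pdivlMl// mulrC; near: u; apply: nbhsx_ballx; exact: divr_gt0.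
have : sg 0 x + kap * 0 - H 0 <= sg t x + kap * t - H t.
  apply: (@right_derivative_nondecreasing _ (fun u => sg u x + kap * u - H u)
    (fun u => expect g x u + kap - h u)) => //.
    apply/subspace_continuousP => s si; have s0 : 0 <= s by move: si; rewrite /= in_itv/= => /andP[].
    apply: cvgB; last first.
      apply: cvg_within_filter; apply: differentiable_continuous.
      by apply/derivable1_diffP; case: (dH s s0).
    apply: cvgD; first exact: (iffLR (subspace_continuousP _ _) csg s si).
    by apply: cvg_within_filter; apply: cvgM; [exact: cvg_cst|exact: cvg_id].
  move=> s s0 st; split.
    have mb : measurable_fun setT (fun w : cpath R => bet (w s)).
      exact: measurableT_comp (continuous_measurable_fun cbet) (measurable_eval s).
    have ik : (P x).-integrable setT (EFin \o (fun _ : cpath R => kap)).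
      by apply: (@law_integrable _ _ _ `|kap|) => //; exact: measurable_cst.
    have ig : (P x).-integrable setT (EFin \o (fun w : cpath R => g (w s))).
      by apply: (@law_integrable _ _ _ C).
    have ib : (P x).-integrable setT (EFin \o (fun w : cpath R => bet (w s))).
      by apply: (@law_integrable _ _ _ K).
    have -> : expect g x s + kap - h s = \int[P x]_w (g ((w : cpath R) s) + kap - bet (w s)).
      rewrite (RintegralB measurableT (integrableD measurableT ig ik) ib).
      rewrite (RintegralD measurableT ig ik).
      by rewrite Rintegral_cst// prob_kernel mulr1.
    apply: law_integral_ge0_ae => //.
      by apply: measurable_funB => //; exact: measurable_funD.
    have := state_ae Ex s0; apply: filterS => w Ew _.
    by have := betg _ Ew; rewrite lerBlDr subr_ge0.
  rewrite (_ : (fun n => _) = (fun n => (sg (s + n.+1%:R^-1) x - sg s x) / n.+1%:R^-1 + kap -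
     (H (s + n.+1%:R^-1) - H s) / n.+1%:R^-1)); last first.
    apply/funext => n; have : (n.+1%:R^-1 : R) != 0 by rewrite invr_eq0 pnatr_eq0.
    by move: (n.+1%:R^-1 : R) => r r0; field.
  apply: cvgB; last exact: is_derive_right_quotient (dH s s0).
  apply: cvgD; last exact: cvg_cst.
  rewrite (_ : (fun n => _) = (fun n => \int[P x]_w
      ((sg n.+1%:R^-1 ((w : cpath R) s) - F (w s)) / n.+1%:R^-1))); last first.
    apply/funext => n; rewrite sg_diff// -RintegralZr//.
    apply: (@law_integrable _ _ (fun w : cpath R => sg n.+1%:R^-1 (w s) - F (w s)) (B + B)) => //.
      by apply: measurable_funB => //; exact: measurableT_comp (msg _) (measurable_eval s).
    by move=> w; rewrite (le_trans (ler_normB _ _))// lerD.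
  apply: (@law_dominated_convergence _ _ _ _ L C) => //.
    move=> n; apply: measurable_funM => //; apply: measurable_funB => //.
    exact: measurableT_comp (msg _) (measurable_eval s).
  have := state_ae Ex s0; apply: filterS => w Ew _; split; last exact: sg_cvg.
  move=> n; have n0 : (0 : R) < n.+1%:R^-1 by rewrite invr_gt0.
  by rewrite normrM [X in _ * X]gtr0_norm ?invr_gt0// ler_pdivrMr// hL.
have HE : H t - H 0 = \int[leb]_(s in `]0, t]) h s.
  by rewrite /H Rintegral_itvB// ?bnd_simp// oppr_le0.
move=> le; rewrite mulr0 addr0 in le; rewrite -[leLHS]HE.
have := sg_le 0 x; have := sg_le t x; rewrite !ler_norml => /andP[_ h1] /andP[h2 _].
by move: le h1 h2; move: (sg 0 x) (sg t x) (H 0) (H t) => p1 p2 p3 p4; lra.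
Unshelve. all: by end_near. Qed.

End dynkin.

Section no_atom.
Variables (x t : R).
Hypotheses (Ex : E x) (t0 : 0 <= t).

(** The point beyond which the test generator vanishes: the end point itself if it is reflecting,
    for the scale derivative must vanish there, and otherwise a point beyond [x]. *)
Let exists_edge : exists d, [/\ E d, 0 < d, k = Reflecting -> d = fine b & k <> Reflecting -> x < d].
Proof.
have b0 := ss_b_gt0 Sm; have [kR|kR] := pselect (k = Reflecting).
  have bf : b \is a fin_num.
    by rewrite fin_real//; apply/andP; split; [exact: lt_le_trans (ltNyr 0) (ltW b0)|exact: (ss_b_fin Sm kR)].
  exists (fine b); split => //; last by rewrite -lte_fin fineK.
  by split; [rewrite fine_ge0// ltW|rewrite kR fineK].
have xb : (x%:E < b)%E by case: Ex => _; case: (k) kR.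
have x0 : 0 <= x by case: Ex.
have [d xd db] : exists2 d, x < d & (d%:E < b)%E.
  case: (b) xb => [r| |]//; last by exists (x + 1); rewrite ?ltry// ltrDl.
  by rewrite lte_fin => xr; exists ((x + r) / 2); rewrite ?lte_fin; lra.
exists d; split => //; last exact: le_lt_trans xd.
by split; [rewrite ltW// (le_lt_trans x0)|case: (k) kR].
Qed.

Let tent (c e u : R) : R := Num.max 0 (1 - `|u - c| / e).

Let tent_continuous c e : continuous (tent c e).
Proof.
move=> u; apply: (@continuous_max _ _ (fun=> 0) (fun u => 1 - `|u - c| / e)); first exact: cvg_cst.
apply: cvgB; first exact: cvg_cst.
apply: cvgM; last exact: cvg_cst.
by apply: cvg_norm; apply: cvgB; [exact: cvg_id|exact: cvg_cst].
Qed.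

Let tent_ge0 c e u : 0 <= tent c e u. Proof. by rewrite le_max lexx. Qed.

Let tent_le1 c e u : 0 < e -> tent c e u <= 1.
Proof. by move=> e0; rewrite ge_max ler01/= gerBl divr_ge0// ltW. Qed.

Let tent_norm c e u : 0 < e -> `|tent c e u| <= 1.
Proof. by move=> e0; rewrite ger0_norm// tent_le1. Qed.

Let tent_eq1 c e : tent c e c = 1.
Proof. by rewrite /tent subrr normr0 mul0r subr0 max_r. Qed.

Let tent_eq0 c e u : 0 < e -> e <= `|u - c| -> tent c e u = 0.
Proof. by move=> e0 h; rewrite /tent max_l// subr_le0 ler_pdivlMr// mul1r. Qed.

Let tent_gt0 c e u : 0 < e -> `|u - c| < e -> 0 < tent c e u.
Proof. by move=> e0 h; rewrite /tent lt_max subr_gt0 ltr_pdivrMr// mul1r h orbT. Qed.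

Let mtent c e : measurable_fun setT (tent c e).
Proof. exact: continuous_measurable_fun (@tent_continuous c e). Qed.

Let wcdf_ge0 (phi : R -> R) u : (forall v, 0 <= phi v) -> 0 <= wcdf phi u.
Proof. by move=> h; apply: Rintegral_ge0 => v _; rewrite mulr_ge0// speed_density_ge0. Qed.

Let slope_mass d : E d -> 0 < d -> 0 < wcdf (tent 0 d) d.
Proof.
move=> Ed d0; have ms := mtent 0 d; have s1 u := @tent_norm 0 d u d0.
have mono u v : 0 <= u -> u <= v -> wcdf (tent 0 d) u <= wcdf (tent 0 d) v.
  move=> u0 uv; rewrite -subr_ge0 (wcdfB ms s1)//.
  by apply: Rintegral_ge0 => z _; rewrite mulr_ge0 ?speed_density_ge0.
have d4 : 0 < d / 4 by rewrite divr_gt0.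
have d42 : d / 4 < d / 2 by move: d0; lra.
have Iz z : z \in `[d / 4, d / 2] -> I z.
  by rewrite in_itv/= => /andP[h1 h2]; apply: (state_space_lt Ed); move: d0 h1 h2; lra.
apply: (@lt_le_trans _ _ (wcdf (tent 0 d) (d / 2))); last by apply: mono; move: d0; lra.
apply: (@le_lt_trans _ _ (wcdf (tent 0 d) (d / 4))).
  exact: wcdf_ge0.
have [| |z zi] := @MVT _ (wcdf (tent 0 d)) (fun z => tent 0 d z * m z) _ _ d42.
- move=> z zi; apply: (wcdf_derive ms s1); last exact: tent_continuous.
  by apply: Iz; apply: subset_itv_oo_cc.
- apply: continuous_in_subspaceT => z /[1!inE] zi.
  apply: differentiable_continuous; apply/derivable1_diffP.
  by have [] := wcdf_derive ms s1 (Iz _ zi) (@tent_continuous 0 d z).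
rewrite -subr_gt0 => ->; apply: mulr_gt0; last by rewrite subr_gt0.
apply: mulr_gt0; last first.
  by apply: (ss_m_gt0 Sm); apply: Iz; apply: subset_itv_oo_cc.
apply: tent_gt0 => //; move: zi; rewrite in_itv/= => /andP[z1 z2].
by rewrite subr0 gtr0_norm; move: d0 z1 z2; lra.
Qed.

Let tent_mass e d : 0 < e -> exists2 r, 0 < r & forall del, 0 < del -> del < r -> wcdf (tent x del) d < e.
Proof.
move=> e0; have := speed_density_integrable measurableT.
move=> /integral_normr_continuous /(_ _ e0)[r [r0 hr]]; exists (r / 2); first by rewrite divr_gt0.
move=> del del0 delr; pose A : set R := `[x - del, x + del]%classic.
have mA : measurable A by exact: measurable_itv.
have h : \int[leb]_(u in A) `|speed_density u| < e.
  apply: hr => //; have : (leb A < r%:E)%E; last by [].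
  rewrite /A lebesgue_measure_itv/= lte_fin ifT; last by move: del0; lra.
  by rewrite -EFinB lte_fin; move: delr; lra.
apply: le_lt_trans h; rewrite /wcdf Rintegral_mkcond [leRHS]Rintegral_mkcond.
have mt := mtent x del; have t1 u := @tent_norm x del u del0.
apply: le_Rintegral => //.
- rewrite -restrict_EFin; apply/integrable_restrict => //; rewrite setTI.
  exact: (weighted_integrable mt t1 (measurable_itv _)).
- rewrite -restrict_EFin; apply/integrable_restrict => //; rewrite setTI.
  exact: integrable_norm (speed_density_integrable mA).
move=> u _; rewrite !patchE; case: ifPn => [_|_]; last first.
  by case: ifPn => _; [exact: normr_ge0|exact: lexx].
rewrite (ger0_norm (speed_density_ge0 u)); case: ifPn => [_|].
  by rewrite ler_piMl ?speed_density_ge0// tent_le1.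
rewrite notin_setE /A/= in_itv/= => /negP uA; rewrite tent_eq0 ?mul0r ?lexx//.
rewrite leNgt; apply/negP; rewrite distrC ltr_distl => /andP[h1 h2]; move: uA => /negP[].
by apply/andP; split; apply: ltW; [rewrite ltrBlDr -ltrBlDl; move: h1 h2|]; lra.
Qed.

(* The generator g is a tent of width del at x minus kap times a fixed tent at 0,
   where kap makes the speed integral of g vanish and tends to 0 with del. *)
Lemma no_atom : (\int[leb]_(s in `]0%R, t]) P x [set w : cpath R | w s = x] = 0)%E.
Proof.
have [d [Ed d0 kd xd]] := exists_edge.
have c0 := slope_mass Ed d0; set c := wcdf (tent 0 d) d in c0.
have Sd : 0 <= S d - S 0 by rewrite subr_ge0 scale_le// ltW.
apply/eqP; rewrite eq_le integral_ge0// andbT; apply/lee_addgt0Pr => e e0; rewrite add0e.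
(* The final bound is the speed mass of the tent at [x] times this factor without the 1: twice the
   bound of [int_fun], whose [g] has absolute mass at most twice that of the tent, plus [kap * t].
   The 1 makes [K] positive. *)
pose K := 4 * (S d - S 0) + t / c + 1.
have K0 : 0 < K by rewrite ltr_wpDl// addr_ge0// ?divr_ge0// ?mulr_ge0// ltW.
have [r r0 hr] := tent_mass d (divr_gt0 e0 K0).
have [r' r'0 hr'] : exists2 r', 0 < r' & (k <> Reflecting -> r' <= d - x).
  have [kR|kR] := pselect (k = Reflecting); first by exists 1.
  by exists (d - x) => //; rewrite subr_gt0 xd.
(* Small mass by the first entry; by the second, when the end is not reflecting, the tent at [x]
   does not reach beyond [d]. *)
pose del := Num.min (r / 2) r'.
have del0 : 0 < del by rewrite lt_min r'0 divr_gt0.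
have delr : del < r by rewrite gt_min ltr_pdivrMr// ltr_pMr// ltr1n.
have delr' : del <= r' by rewrite ge_min lexx orbT.
pose kap := wcdf (tent x del) d / c.
have kap0 : 0 <= kap by rewrite divr_ge0 ?(ltW c0)//; exact: wcdf_ge0.
pose g u := tent x del u - kap * tent 0 d u.
have cg : continuous g.
  move=> u; apply: cvgB; first exact: tent_continuous.
  by apply: cvgM; [exact: cvg_cst|exact: tent_continuous].
have gC u : `|g u| <= 1 + kap.
  rewrite (le_trans (ler_normB _ _))// lerD ?tent_norm// normrM ger0_norm//.
  by rewrite ler_piMr// tent_norm.
have kd' : k = Reflecting -> d = fine b by [].
have gd u : E u -> d < u -> g u = 0.
  move=> Eu du; have [kR|kR] := pselect (k = Reflecting).
    have bf : b \is a fin_num.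
      by rewrite fin_real//; apply/andP; split; [exact: lt_le_trans (ltNyr 0) (ltW (ss_b_gt0 Sm))|exact: (ss_b_fin Sm kR)].
    move: Eu => -[_]; rewrite kR -(fineK bf) -(kd kR) lee_fin => ud.
    by move: du; rewrite ltNge ud.
  have du0 := lt_trans d0 du.
  rewrite /g !tent_eq0 ?mulr0 ?subrr//; first by rewrite subr0 gtr0_norm// ltW.
  have := hr' kR; move: (xd kR) => xd' r'd.
  by rewrite ger0_norm; move: delr' du xd' r'd; lra.
have intt c' e' A : 0 < e' -> measurable A -> leb.-integrable A (EFin \o (fun u => tent c' e' u * speed_density u)).
  by move=> e'0 mA; apply: (weighted_integrable (mtent c' e') (fun u => @tent_norm c' e' u e'0) mA).
have linear (s : R) : wcdf (fun u => tent x del u + s * tent 0 d u) d = wcdf (tent x del) d + s * c.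
  rewrite /c /wcdf -RintegralZl//; last exact: intt.
  rewrite -RintegralD//; last 2 first.
  - exact: intt.
  - by apply: integrable_scale => //; exact: intt.
  by apply: eq_Rintegral => u _; ring.
have g0 : wcdf g d = 0.
  rewrite (_ : g = fun u => tent x del u + (- kap) * tent 0 d u); last first.
    by apply/funext => u; rewrite /g mulNr.
  by rewrite linear mulNr /kap divfK ?subrr// gt_eqF.
have mg := continuous_measurable_fun cg.
have gabs : wcdf (fun u => `|g u|) d <= 2 * wcdf (tent x del) d.
  rewrite (_ : 2 * _ = wcdf (fun u => tent x del u + kap * tent 0 d u) d); last first.
    by rewrite linear /kap divfK ?gt_eqF//; ring.
  have mA : measurable `]0, d] by exact: measurable_itv.
  apply: le_Rintegral => //.
  - apply: (@weighted_integrable (fun u => `|g u|) (1 + kap)) => //.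
      exact: measurableT_comp.
    by move=> u; rewrite normr_id.
  - apply: (@weighted_integrable (fun u => tent x del u + kap * tent 0 d u) (1 + kap)) => //.
      by apply: measurable_funD; [exact: mtent|apply: measurable_funM => //; exact: mtent].
    move=> u; rewrite (le_trans (ler_normD _ _))// lerD ?tent_norm// normrM ger0_norm//.
    by rewrite ler_piMr// tent_norm.
  move=> u _; apply: ler_wpM2r; first exact: speed_density_ge0.
  rewrite (le_trans (ler_normB _ _))// (ger0_norm (tent_ge0 _ _ _)) lerD2l normrM.
  by rewrite !ger0_norm.
have occ := @occupation_le (int_fun g d) g _ _ (int_domain cg gC Ed d0 kd' gd g0)
  (int_fun_le cg gC Ed d0 gd g0) mg gC (tent x del) 1 kap x t (@tent_continuous x del)
  (fun u => @tent_norm x del u del0).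
have {}occ := occ _ Ex t0.
pose h s := \int[P x]_w tent x del ((w : cpath R) s).
have mt s : measurable_fun setT (fun w : cpath R => tent x del (w s)).
  exact: measurableT_comp (mtent x del) (measurable_eval s).
have ih s : (P x).-integrable setT (EFin \o (fun w : cpath R => tent x del (w s))).
  by apply: (@law_integrable _ _ _ 1) => // w; exact: tent_norm.
have h0 s : 0 <= h s by apply: Rintegral_ge0.
have h1 s : h s <= 1.
  apply: le_trans (ler_norm _) _; apply: law_integral_le => // w; exact: tent_norm.
have mh : measurable_fun setT h.
  apply: continuous_measurable_fun.
  exact: law_expect_continuous (@tent_continuous x del) (fun u => @tent_norm x del u del0).
have mP : measurable_fun setT (fun s : R => P x [set w : cpath R | w s = x]).
  have mD : measurable [set p : R * cpath R | p.2 p.1 = x].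
    rewrite (_ : mkset _ = (fun p : R * cpath R => p.2 p.1) @^-1` [set x])//.
    rewrite -[X in measurable X]setTI.
    by apply: (measurable_eval_comp measurable_fst measurable_snd).
  exact: (@measurable_comp_kernel_section _ _ _ _ _ _ _ P (fun=> x) (measurable_cst x) _ mD).
have mI : measurable `]0, t] by exact: measurable_itv.
apply: (@le_trans _ _ (\int[leb]_(s in `]0%R, t]) (h s)%:E)%E).
  apply: ge0_le_integral => //.
  - exact: measurable_funTS.
  - by apply/measurable_EFinP; exact: measurable_funTS.
  move=> s _; rewrite /h /Rintegral fineK; last exact: integrable_fin_num (ih s).
  have ms : measurable [set w : cpath R | w s = x].
    rewrite (_ : mkset _ = (fun w : cpath R => w s) @^-1` [set x])//.
    by rewrite -[X in measurable X]setTI; apply: measurable_eval.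
  have -> : P x [set w | w s = x] = (\int[P x]_w (\1_[set w | w s = x] w)%:E)%E.
    by rewrite integral_indic// setIT.
  apply: ge0_le_integral => //.
  - by apply/measurable_EFinP; exact: measurable_indic.
  - by apply/measurable_EFinP.
  move=> w _; rewrite lee_fin indicE; have [e1|e1] := pselect (w s = x); last by rewrite memNset.
  by rewrite mem_set// e1 tent_eq1.
have ihI : leb.-integrable `]0, t] (EFin \o h).
  apply: measurable_bounded_integrable => //.
  - by rewrite /= lebesgue_measure_itv; case: ifP => _; rewrite ?ltry.
  - exact: measurable_funTS.
  - exists 1; split; [exact: num_real|move=> z z1 s _].
    by rewrite /= ger0_norm// (le_trans (h1 s))// ltW.
rewrite -[leLHS]fineK; last by apply: integrable_fin_num.
rewrite lee_fin; apply: (le_trans (occ _)).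
  by move=> y Ey; rewrite /g lerB// ler_piMr// tent_le1.
have hrd := hr del del0 delr.
rewrite ltr_pdivlMr// in hrd.
rewrite (le_trans _ (ltW hrd))// /K.
have := ler_wpM2l Sd gabs; have w0 : 0 <= wcdf (tent x del) d by exact: wcdf_ge0.
have -> : kap * t = wcdf (tent x del) d * (t / c) by rewrite /kap -mulrA [c^-1 * t]mulrC.
move: w0; move: (wcdf (tent x del) d) (wcdf (fun u => `|g u|) d) (S d - S 0) (t / c) => p1 p2 p3 p4 p5 p6; lra.
Qed.

End no_atom.

Lemma return_null z t : E z -> 0 <= t ->
  (\int[leb]_(s in `]0%R, t]) P z [set w : cpath R | w s = w 0%R] = 0)%E.
Proof.
move=> Ez t0; rewrite -[RHS](no_atom Ez t0); apply: eq_integral => s _.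
have m1 : measurable [set w : cpath R | w s = w 0].
  by apply: measurable_eq_set; exact: measurable_eval.
have m2 : measurable [set w : cpath R | w s = z].
  rewrite (_ : mkset _ = (fun w : cpath R => w s) @^-1` [set z])//.
  by rewrite -[X in measurable X]setTI; apply: measurable_eval.
have h := start_ae Ez; apply/eqP; rewrite eq_le; apply/andP; split; apply: law_le_ae => //.
  by apply: filterS h => w /= -> ->.
by apply: filterS h => w /= -> ->.
Qed.

Lemma measurable_return : measurable [set q : R * cpath R | q.2 q.1 = q.2 0].
Proof.
have m1 : measurable_fun setT (fun q : R * cpath R => q.2 q.1).
  by apply: measurable_eval_comp; [exact: measurable_fst|exact: measurable_snd].
have m2 : measurable_fun setT (fun q : R * cpath R => q.2 0).
  by apply: measurable_eval_comp => //; exact: measurable_snd.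
exact: measurable_eq_set.
Qed.

(** The Markov property at [u] reduces this to [return_null] from the random point [w u]. The
    average over that point is exchanged with the integral over the later time by Tonelli. *)
Lemma forward_return_null y u b' : E y -> 0 <= u ->
  (\int[leb]_(v in `]u, b']) P y [set w : cpath R | w u = w v] = 0)%E.
Proof.
move=> Ey u0; have [b'u|ub] := leP b' u.
  by rewrite set_itv_ge ?integral_set0// bnd_simp -leNgt.
have c0 : 0 <= b' - u by rewrite subr_ge0 ltW.
pose kap (s : measurableTypeR R) : \bar R := (\int[P y]_w P (w u) [set w' : cpath R | w' s = w' 0%R])%E.
have mker : measurable_fun setT (fun q : cpath R * measurableTypeR R => P (q.1 u) [set w' : cpath R | w' q.2 = w' 0]).
  have mf : measurable_fun setT (fun q : cpath R * measurableTypeR R => q.1 u : measurableTypeR R).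
    by apply: measurable_eval_comp => //; exact: measurable_fst.
  apply: (@measurable_comp_kernel_section _ _ _ _ _ _ _ P _ mf
    [set z : (cpath R * measurableTypeR R) * cpath R | z.2 z.1.2 = z.2 0]).
  have mg : measurable_fun setT (fun z : (cpath R * measurableTypeR R) * cpath R => (z.1.2 : R, z.2)).
    apply: measurable_fun_pair; last exact: measurable_snd.
    by apply: measurableT_comp measurable_fst; exact: measurable_snd.
  by have := mg measurableT _ measurable_return; rewrite setTI.
have kap0 s : (0 <= kap s)%E by apply: integral_ge0.
have mkap : measurable_fun setT kap.
  exact: (@measurable_fun_fubini_tonelli_G _ _ _ _ _ (kernel_law P y) _ mker).
have FT : natural_filtration u (@setT (cpath R)) by exact: natural_filtration_invariant.
transitivity (\int[leb]_(v in (fun v : measurableTypeR R => (v + - u)%R : measurableTypeR R) @^-1` `]0%R, (b' - u)%R]) kap (v + - u)%R)%E.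
  rewrite (_ : _ @^-1` _ = `]u, b']%classic); last first.
    by apply/seteqP; split => v /=; rewrite !in_itv/= subr_gt0 lerD2r.
  apply: eq_integral => v; rewrite inE/= in_itv/= => /andP[uv vb].
  have ms : measurable [set w' : cpath R | w' (v - u) = w' 0].
    have mp : measurable_fun setT (fun w : cpath R => (v - u : R, w)) by exact: measurable_fun_pair.
    by have := mp measurableT _ measurable_return; rewrite setTI.
  rewrite /kap -(simple_markov Ey u0 FT ms) setTI; congr (P y _).
  have vu : 0 <= v - u by rewrite subr_ge0 ltW.
  by apply/seteqP; split => w /=; rewrite maxxx max_l// addr0 [u + _]addrC subrK => ->.
rewrite integral_translation//.
pose Q (q : cpath R * measurableTypeR R) : \bar R :=
  (P (q.1 u) [set w' : cpath R | w' q.2 = w' 0%R] * (\1_(`]0%R, (b' - u)%R]%classic : set R) q.2)%:E)%E.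
have mQ : measurable_fun setT Q.
  apply: emeasurable_funM => //; apply/measurable_EFinP.
  by apply: measurableT_comp measurable_snd; exact: measurable_indic.
have Q0 q : (0 <= Q q)%E by rewrite mule_ge0// lee_fin.
have QE (w : cpath R) : (\int[leb]_(s in `]0%R, (b' - u)%R]) P (w u) [set w' : cpath R | w' s = w' 0%R] =
    \int[leb]_s Q (w, s))%E.
  rewrite integral_mkcond; apply: eq_integral => s _.
  by rewrite patchE /Q indicE; case: ifPn; rewrite ?mule1 ?mule0.
transitivity (\int[P y]_w \int[leb]_(s in `]0%R, (b' - u)%R]) P (w u) [set w' : cpath R | w' s = w' 0%R])%E.
  rewrite [LHS]integral_mkcond; under [RHS]eq_integral do rewrite QE.
  rewrite (@fubini_tonelli _ _ _ _ _ (kernel_law P y) leb Q mQ Q0).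
  apply: eq_integral => s _; rewrite patchE; case: ifPn => sI.
    by rewrite /kap; apply: eq_integral => w _; rewrite /Q indicE sI mule1.
  by rewrite integral0_eq// => w _; rewrite /Q indicE (negbTE sI) mule0.
under eq_integral do rewrite QE.
have : (\int[P y]_w (cst 0 w : \bar R) = 0)%E by rewrite integral0.
move=> <-; apply: ae_eq_integral => //.
  exact: (@measurable_fun_fubini_tonelli_F _ _ _ _ _ leb Q mQ Q0).
by have := state_ae Ey u0; apply: filterS => w Ew _; rewrite -QE return_null.
Qed.

(** By Tonelli the expected measure of the forward ties is the integral over [u] and [v] of the
    probability that [w u = w v], which vanishes for every [u]. *)
Lemma ties_ae y b' : E y -> 0 <= b' -> \forall w \ae P y, ties 0 b' (w : cpath R) = 0.
Proof.
move=> Ey b0.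
pose A := [set q : cpath R * (measurableTypeR R * measurableTypeR R) | forward_ties b' q.1 q.2].
have mA : measurable A by exact: measurable_forward_ties.
have h := measure_section_swap (kernel_law P y) (@plane R) mA.
have {}h : (\int[P y]_w plane (forward_ties b' w) = 0)%E.
  transitivity (\int[kernel_law P y]_x plane [set y | A (x, y)])%E; first by [].
  rewrite h.
  pose B p := P y [set w : cpath R | forward_ties b' w p].
  have mB : measurable_fun setT B.
    have := @measurable_fun_ysection _ _ _ _ _ (kernel_law P y) A mA.
    by congr (measurable_fun _ _); apply/funext => p; rewrite /= ysectionE.
  transitivity (\int[plane]_p B p)%E; first by [].
  transitivity (\int[leb]_u \int[leb]_v B (u, v))%E.
    exact: (@fubini_tonelli1 _ _ _ _ _ leb leb B mB).
  apply: integral0_eq => u _; have [u0|u0] := leP 0 u; last first.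
    apply: integral0_eq => v _; rewrite /B (_ : mkset _ = set0) ?measure0//.
    by apply/seteqP; split => w //= -[/=]; rewrite leNgt u0.
  rewrite -(forward_return_null b' Ey u0) [RHS]integral_mkcond; apply: eq_integral => v _.
  rewrite patchE; case: ifPn.
    rewrite inE/= in_itv/= => /andP[uv vb]; congr (P y _).
    by apply/seteqP; split => w /= => [[]|].
  rewrite notin_setE/= in_itv/= => /negP uv; rewrite /B (_ : mkset _ = set0) ?measure0//.
  by apply/seteqP; split => w //= -[/= h1 h2 h3 _]; move: uv; rewrite h2 h3.
have mF : measurable_fun setT (fun w => plane (forward_ties b' w)).
  have := @measurable_fun_xsection _ _ _ _ _ (@plane R) A mA.
  by congr (measurable_fun _ _); apply/funext => p; rewrite /= xsectionE.
have [+ _] := @ae_eq_integral_abs _ _ _ (P y) setT measurableT _ mF.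
rewrite (eq_integral (fun w => plane (forward_ties b' w))); last first.
  by move=> w _; rewrite gee0_abs.
by move=> /(_ h); apply: filterS => w /(_ Logic.I) h0; exact: ties_half.
Qed.

(** * Coupling and a Harnack inequality *)

(** With [h] constant this says that the path is at a given point at time [T], with [h] a frozen
    path that it meets this path. *)
Lemma stopped_events_eval (T : cpath R -> \bar R) (h : R -> R) : proper_time T -> continuous h ->
  stopped_events T [set w | (T w < +oo)%E /\ h (fine (T w)) = w (fine (T w))].
Proof.
move=> pT ch; have mT := measurable_fine_time (proper_measurable pT).
have mA : measurable [set w | (T w < +oo)%E /\ h (fine (T w)) = w (fine (T w))].
  apply: measurableI; first by apply: measurable_time_lt; exact: proper_measurable.
  have m1 : measurable_fun setT (fun w => h (fine (T w))).
    exact: measurableT_comp (continuous_measurable_fun ch) mT.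
  have m2 : measurable_fun setT (fun w : cpath R => w (fine (T w))).
    by apply: measurable_eval_comp.
  exact: measurable_eq_set.
split => // t t0; apply: natural_filtration_invariant => //.
  by apply: measurableI => //; apply: measurable_time_le; exact: proper_measurable.
move=> w; split => /= -[[h1 h2] /[dup] h3].
  move=> /(proper_stop pT _ t0 (lexx _)) h4; move: h1 h2; rewrite (proper_time_stop pT)//.
  move=> h1; rewrite min_l// -lee_fin fineK//.
  by rewrite ge0_fin_numE//; exact: proper_ge0.
move=> h4; rewrite (proper_time_stop pT)//; split => //; split => //.
by rewrite h2 min_l// -lee_fin fineK// ge0_fin_numE//; exact: proper_ge0.
Qed.

(* First time at which two paths meet, or one of them hits 0. *)
Definition meet (x y : cpath R) : \bar R := first_zero (fun u => (x u - y u) * (x u * y u)).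

Let meet_continuous (x y : cpath R) : continuous (fun u => (x u - y u) * (x u * y u)).
Proof.
by move=> u; apply: cvgM; [apply: cvgB|apply: cvgM]; exact: path_cont.
Qed.

Lemma meetC x y : meet x y = meet y x.
Proof.
rewrite /meet /first_zero; congr (ereal_inf _); congr (image _ _).
apply/seteqP; split => u /= [u0 h]; split => //; apply/eqP; move/eqP: h;
  by rewrite -opprB mulNr oppr_eq0 [X in _ * X]mulrC.
Qed.

Lemma proper_meet x : proper_time (meet x).
Proof.
apply: (@proper_first_zero _ (fun u r => (x u - r) * (x u * r))) => [t|w].
  by apply: measurable_funM; [exact: measurable_funB|exact: measurable_funM].
exact: meet_continuous.
Qed.

Lemma measurable_meet : measurable_fun setT (fun p : cpath R * cpath R => meet p.1 p.2).
Proof.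
apply: (@measurable_first_zero _ _ _ (fun (p : cpath R * cpath R) u => (p.1 u - p.2 u) * (p.1 u * p.2 u))) => [t|p].
  have m1 : measurable_fun setT (fun p : cpath R * cpath R => p.1 t).
    by apply: measurable_eval_comp => //; exact: measurable_fst.
  have m2 : measurable_fun setT (fun p : cpath R * cpath R => p.2 t).
    by apply: measurable_eval_comp => //; exact: measurable_snd.
  by apply: measurable_funM; [exact: measurable_funB|exact: measurable_funM].
exact: meet_continuous.
Qed.

Lemma meet_le_hitting x y : (meet x y <= hitting_time 0 x)%E.
Proof.
case e : (hitting_time 0 x) => [t| |]; last 2 first.
- by rewrite leey.
- by have := hitting_ge0 0 x; rewrite e.
move/hitting_finP : e => [t0 xt _]; apply/first_zeroP; first exact: meet_continuous.
by exists t; split => //; rewrite xt mul0r mulr0.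
Qed.

(** When [y] dies, [x] is still positive, so [x - y] has changed sign before. At the meeting time
    [x] is not 0, being alive; were [y] equal to 0, the crossing would take place at [l] exactly,
    where [x] is positive. *)
Lemma meet_before (x y : cpath R) l : 0 <= x 0 -> x 0 < y 0 -> hitting_time 0 y = l%:E ->
  (l%:E < hitting_time 0 x)%E ->
  (meet x y < +oo)%E /\ x (fine (meet x y)) = y (fine (meet x y)).
Proof.
move=> x0 xy0 /hitting_finP[l0 yl yn] alx; have xl := alive_gt0 x0 l0 alx.
move/hitting_gtP : alx => xn.
have cxy : {within `[0, l], continuous (fun u => x u - y u)}.
  by apply: continuous_subspaceT => s; apply: cvgB; exact: path_cont.
have sgn : Num.min (x 0 - y 0) (x l - y l) <= 0 <= Num.max (x 0 - y 0) (x l - y l).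
  by rewrite ge_min le_max yl subr0 (ltW xl) orbT subr_le0 (ltW xy0).
have [c] := IVT l0 cxy sgn; rewrite in_itv/= => /andP[c0 cl] /eqP; rewrite subr_eq0 => /eqP xyc.
have Tc : (meet x y <= c%:E)%E.
  apply/first_zeroP; first exact: meet_continuous.
  by exists c; split => //; rewrite xyc subrr mul0r.
have Too : (meet x y < +oo)%E by rewrite (le_lt_trans Tc)// ltry.
have Tf : meet x y \is a fin_num by rewrite ge0_fin_numE//; exact: first_zero_ge0.
have /esym/first_zero_finP := fineK Tf => /(_ (@meet_continuous _ _))[T0 /eqP pT _].
have {}Tc : fine (meet x y) <= c by rewrite -lee_fin fineK.
split => //; move: pT; rewrite !mulf_eq0 subr_eq0 => /orP[/eqP//|/orP[]] /eqP e.
  by have := xn _ T0 (le_trans Tc cl); rewrite e eqxx.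
have lT : l <= fine (meet x y).
  by rewrite leNgt; apply/negP => Tl; have := yn _ T0 Tl; rewrite e eqxx.
have cl' : c = l by apply/eqP; rewrite eq_le cl (le_trans lT).
by move: xl; rewrite -cl' xyc cl' yl ltxx.
Qed.

Definition hits_in (B : set R) : set (cpath R) :=
  [set w | (hitting_time 0 w < +oo)%E /\ B (fine (hitting_time 0 w))].

Lemma measurable_hits_in B : measurable B -> measurable (hits_in B).
Proof.
move=> mB; apply: measurableI; first exact: measurable_hitting_lt.
rewrite -[X in measurable X]setTI.
by apply: (measurable_fine_time (proper_measurable (proper_hitting_time 0))).
Qed.

(** Extinction of a path started when the clock shows [q.1], the set [B] being in clock time. *)
Definition hits_in_after (B : set R) : set (R * cpath R) :=
  [set q | (hitting_time 0 q.2 < +oo)%E /\ B (q.1 + fine (hitting_time 0 q.2))].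

Lemma measurable_hits_in_after B : measurable B -> measurable (hits_in_after B).
Proof.
move=> mB; have mh := proper_measurable (proper_hitting_time (0 : R)).
have m1 : measurable [set q : R * cpath R | (hitting_time 0 q.2 < +oo)%E].
  exact: measurable_ltoo_set (measurableT_comp mh measurable_snd).
have mf : measurable_fun setT (fun q : R * cpath R => q.1 + fine (hitting_time 0 q.2)).
  apply: measurable_funD; first exact: measurable_fst.
  exact: measurableT_comp (measurable_fine_time mh) measurable_snd.
by have := mf measurableT B mB; rewrite setTI => m2; exact: measurableI m1 m2.
Qed.

Lemma hits_in_shift B t (w : cpath R) : 0 <= t -> (t%:E <= hitting_time 0 w)%E ->
  hits_in_after B (t, shift_path t w) <-> hits_in B w.
Proof.
move=> t0 tw; rewrite /hits_in_after /hits_in/= (hitting_shift t0 tw).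
have := hitting_ge0 0 (shift_path t w).
by case: (hitting_time 0 (shift_path t w)) => [r| |] // _; split => -[h1 h2]; split => //; rewrite ltry.
Qed.

Section coupling.
Variables (xi z : R) (B : set R).
Hypotheses (Exi : E xi) (Ez : E z) (mB : measurable B).

Let T (p : cpath R * cpath R) := fine (meet p.1 p.2).

Let mT : measurable_fun setT T.
Proof. by apply: measurableT_comp => //; exact: measurable_meet. Qed.

Let G := [set p : cpath R * cpath R | (meet p.1 p.2 < +oo)%E /\ p.1 (T p) = p.2 (T p)].

Let mG : measurable G.
Proof.
have m2 : measurable [set p : cpath R * cpath R | p.1 (T p) = p.2 (T p)].
  by apply: measurable_eq_set; apply: measurable_eval_comp => //;
    (exact: measurable_fst || exact: measurable_snd).
exact: measurableI (measurable_ltoo_set measurable_meet) m2.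
Qed.

Let D := hits_in_after B.

Let kap (u a : R) : \bar R := P a [set w | D (u, w)].

Let U := [set p : cpath R * cpath R | G p /\ D (T p, shift_path (T p) p.2)].
Let V := [set p : cpath R * cpath R | G p /\ D (T p, shift_path (T p) p.1)].

Let mU : measurable U.
Proof.
have mf : measurable_fun setT (fun p : cpath R * cpath R => (T p, shift_path (T p) p.2)).
  by apply: measurable_fun_pair => //; apply: measurable_shift_comp => //; exact: measurable_snd.
have := mf measurableT _ (measurable_hits_in_after mB).
by rewrite setTI => m2; exact: measurableI mG m2.
Qed.

Let mV : measurable V.
Proof.
have mf : measurable_fun setT (fun p : cpath R * cpath R => (T p, shift_path (T p) p.1)).
  by apply: measurable_fun_pair => //; apply: measurable_shift_comp => //; exact: measurable_fst.
have := mf measurableT _ (measurable_hits_in_after mB).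
by rewrite setTI => m2; exact: measurableI mG m2.
Qed.

Let mkap : measurable_fun setT (fun p : cpath R * cpath R => kap (T p) (p.2 (T p))).
Proof.
have mf : measurable_fun setT (fun p : cpath R * cpath R => p.2 (T p) : measurableTypeR R).
  by apply: measurable_eval_comp => //; exact: measurable_snd.
apply: (@measurable_comp_kernel_section _ _ _ _ _ _ _ P _ mf
  [set q : (cpath R * cpath R) * cpath R | D (T q.1, q.2)]).
have mg : measurable_fun setT (fun q : (cpath R * cpath R) * cpath R => (T q.1, q.2)).
  apply: measurable_fun_pair; last exact: measurable_snd.
  exact: measurableT_comp mT measurable_fst.
by have := mg measurableT _ (measurable_hits_in_after mB); rewrite setTI.
Qed.

(** The common integrand of [stage1] and [stage2]: on [G] both paths are at the same point at the
    meeting time, so it does not matter which of them is restarted. *)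
Let W (p : cpath R * cpath R) : \bar R := (kap (T p) (p.2 (T p)) * (\1_G p)%:E)%E.

Let stage2 x : P z [set y | U (x, y)] = (\int[P z]_y W (x, y))%E.
Proof.
have sA := stopped_events_eval (proper_meet x) (@path_cont R x).
have := strong_markov_pair Ez (proper_meet x) sA (measurable_hits_in_after mB).
rewrite (_ : _ `&` _ = [set y | U (x, y)]); last first.
  by apply/seteqP; split => y /=; rewrite /U /G /T/=; [move=> [[? ?] [? ?]]|move=> [[? ?] ?]].
move=> ->; rewrite integral_mkcond; apply: eq_integral => y _.
rewrite patchE /W indicE; have [g|g] := pselect (G (x, y)).
  rewrite mem_set; last by case: g => ? ?; split.
  by rewrite mem_set//= mule1.
rewrite memNset; last by move=> [/= [? ?] ?]; apply: g; split.
by rewrite memNset// mule0.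
Qed.

Let stage1 y : P xi [set x | V (x, y)] = (\int[P xi]_x W (x, y))%E.
Proof.
have sA := stopped_events_eval (proper_meet y) (@path_cont R y).
have := strong_markov_pair Exi (proper_meet y) sA (measurable_hits_in_after mB).
rewrite (_ : _ `&` _ = [set x | V (x, y)]); last first.
  apply/seteqP; split => x /=; rewrite /V /G /T/= (meetC x y).
    by move=> [[? <-] [? ?]].
  by move=> [[? ->] ?].
move=> ->; rewrite integral_mkcond; apply: eq_integral => x _.
rewrite patchE /W indicE; have [g|g] := pselect (G (x, y)).
  rewrite mem_set; last by move: g; rewrite /G /T/= (meetC x y) => -[? <-]; split.
  by move: (g); rewrite /G /T/= (meetC x y) mem_set//= => -[_ <-]; rewrite mule1.
rewrite memNset; last by move=> [/= [? e] ?]; apply: g; rewrite /G /T/= (meetC x y) e; split.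
by rewrite memNset// mule0.
Qed.

(** With one path frozen, the meeting time is a stopping time of the other, so the strong Markov
    property is used for one path at a time under a product law. Both restarts have integrand [W],
    and Tonelli turns extinction of [y] in [B] into extinction of [x] in [B]. [C1] and [C2] are
    conditions that force a meeting. *)
Lemma coupling_le (C1 C2 : set (cpath R)) : measurable C1 -> measurable C2 ->
  (forall x y : cpath R, x 0 = xi -> y 0 = z -> C1 x -> C2 y -> [/\ (meet x y < +oo)%E,
    x (fine (meet x y)) = y (fine (meet x y)) & hits_in B y]) ->
  (P xi C1 * P z C2 <= P xi (hits_in B))%E.
Proof.
move=> mC1 mC2 hC; pose A : set (cpath R * cpath R) := C1 `*` C2.
have mA : measurable A by exact: measurableX.
apply: (@le_trans _ _ (\int[P xi]_x P z [set y | U (x, y)])%E).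
  rewrite (_ : (P xi C1 * P z C2 = \int[P xi]_x P z [set y | A (x, y)])%E); last first.
    have := @product_measure1E _ _ _ _ _ (kernel_law P xi) (kernel_law P z) C1 C2 mC1 mC2.
    rewrite /product_measure1/= => <-; apply: eq_integral => x _.
    by rewrite /= xsectionE.
  apply: ae_ge0_le_integral => //.
  - have := @measurable_fun_xsection _ _ _ _ _ (kernel_law P z) A mA.
    by congr (measurable_fun _ _); apply/funext => p; rewrite /= xsectionE.
  - have := @measurable_fun_xsection _ _ _ _ _ (kernel_law P z) U mU.
    by congr (measurable_fun _ _); apply/funext => p; rewrite /= xsectionE.
  have := start_ae Exi; apply: filterS => x x0 _; apply: law_le_ae.
  - by have := measurable_xsection x mA; rewrite xsectionE.
  - by have := measurable_xsection x mU; rewrite xsectionE.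
  have := start_ae Ez; apply: filterS => y y0 [/= c1 c2].
  have [h1 h2 h3] := hC x y x0 y0 c1 c2; split; first by split.
  apply/hits_in_shift => //; first by rewrite fine_ge0// first_zero_ge0.
  rewrite fineK; last by rewrite ge0_fin_numE// first_zero_ge0.
  by rewrite /= meetC; exact: meet_le_hitting.
under eq_integral do rewrite stage2.
have mW : measurable_fun setT W.
  by apply: emeasurable_funM => //; apply/measurable_EFinP; exact: measurable_indic.
have W0 p : (0 <= W p)%E by rewrite mule_ge0// lee_fin.
rewrite (@fubini_tonelli _ _ _ _ _ (kernel_law P xi) (kernel_law P z) W mW W0).
apply: (@le_trans _ _ (\int[P z]_y (cst (P xi (hits_in B)) y))%E); last first.
  by rewrite integral_cst// prob_kernel mule1.
apply: ge0_le_integral => //.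
- by move=> y _; apply: integral_ge0.
- exact: (@measurable_fun_fubini_tonelli_G _ _ _ _ _ (kernel_law P xi) W mW W0).
move=> y _; rewrite -[leLHS]stage1; apply: le_measure; rewrite ?inE.
- by have := measurable_ysection y mV; rewrite ysectionE.
- exact: measurable_hits_in.
move=> x [[h1 h2] h3].
have t0 : 0 <= T (x, y) by rewrite fine_ge0// first_zero_ge0.
have tx : ((T (x, y))%:E <= hitting_time 0 x)%E.
  rewrite fineK; last by rewrite ge0_fin_numE// first_zero_ge0.
  exact: meet_le_hitting.
exact: (hits_in_shift B t0 tx).1.
Qed.

End coupling.

(* If the lower path outlives the upper one, then it meets it, and can be
   exchanged with it from the meeting time on. *)
Lemma coupling_above (xi z r : R) (B : set R) : E xi -> E z -> xi < z -> measurable B -> (forall u, B u -> u <= r) ->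
  (P xi (alive r) * P z (hits_in B) <= P xi (hits_in B))%E.
Proof.
move=> Exi Ez xiz mB Br; apply: coupling_le => //.
- exact: measurable_alive.
- exact: measurable_hits_in.
move=> x y x0 y0 ax [hy By]; have hf : hitting_time 0 y \is a fin_num.
  by rewrite ge0_fin_numE// hitting_ge0.
have [] := @meet_before x y (fine (hitting_time 0 y)).
- by rewrite x0; case: Exi.
- by rewrite x0 y0.
- by rewrite fineK.
- by apply: le_lt_trans ax; rewrite lee_fin Br.
by move=> h1 h2; split.
Qed.

(** Here the path from [xi] is the upper one. It dies before [r], when the lower one, which dies in
    [B], is still alive, so they meet. *)
Lemma coupling_below (xi z r : R) (B : set R) : E xi -> E z -> z < xi -> measurable B -> (forall u, B u -> r <= u) ->
  (P xi [set w | hitting_time 0 w < r%:E] * P z (hits_in B) <= P xi (hits_in B))%E.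
Proof.
move=> Exi Ez xiz mB Br; apply: coupling_le => //.
- exact: measurable_hitting_lt.
- exact: measurable_hits_in.
move=> x y x0 y0 /hitting_lt_fine[hx hxr] [hy By]; have hf : hitting_time 0 x \is a fin_num.
  by rewrite ge0_fin_numE// hitting_ge0.
have hfy : hitting_time 0 y \is a fin_num by rewrite ge0_fin_numE// hitting_ge0.
have [] := @meet_before y x (fine (hitting_time 0 x)).
- by rewrite y0; case: Ez.
- by rewrite x0 y0.
- by rewrite fineK.
- by rewrite -(fineK hfy) lte_fin (lt_le_trans hxr)// Br.
by rewrite meetC => h1 h2; split.
Qed.

(** The comparison at the position [w t] is integrated over [A]; being alive at [t] makes extinction
    after the restart the same as extinction of the whole path. *)
Lemma hits_in_markov_ge (y t : R) (A C : set (cpath R)) (B : set R) (c : R) : E y -> 0 <= t ->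
  natural_filtration t A -> A `<=` alive t -> measurable C -> measurable B -> 0 <= c ->
  (forall w, A w -> E (w t) -> (c%:E * P (w t) C <= P (w t) [set w' | hits_in_after B (t, w')])%E) ->
  (c%:E * P y (A `&` shift_path t @^-1` C) <= P y (hits_in B))%E.
Proof.
move=> Ey t0 FA At mC mB c0 h; have mA := natural_filtration_measurable FA.
have mD : measurable [set w' : cpath R | hits_in_after B (t, w')].
  by have := measurable_xsection t (measurable_hits_in_after mB); rewrite xsectionE.
rewrite simple_markov// -ge0_integralZl//; last exact: measurable_funTS (measurable_law_eval t mC).
apply: (@le_trans _ _ (\int[P y]_(w in A) P (w t) [set w' | hits_in_after B (t, w')])%E).
  apply: ae_ge0_le_integral => //.
  - by move=> w _; rewrite mule_ge0// lee_fin.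
  - by apply: measurable_funeM; exact: measurable_funTS (measurable_law_eval t mC).
  - exact: measurable_funTS (measurable_law_eval t mD).
  by have := state_ae Ey t0; apply: filterS => w Ew Aw; exact: h.
rewrite -simple_markov//; apply: le_measure; rewrite ?inE.
- apply: measurableI => //.
  by rewrite -[X in measurable X]setTI; exact: measurable_shift_path.
- exact: measurable_hits_in.
move=> w [/At aw hw]; apply: (hits_in_shift B t0 _).1 hw.
exact: ltW.
Qed.

(* With z0 = y / 2: a start z >= z0 is dominated by the paths from y that are
   below z0 at time t and survive r1, and a start z <= z0 by those that are above
   z0 at time t and die before r0. *)
Lemma harnack (y t r0 r1 : R) : I y -> 0 < t -> t < r0 -> r0 <= r1 ->
  exists2 C : R, 0 <= C & forall z (B : set R), E z -> measurable B ->
    (forall u, B u -> r0 <= u <= r1) ->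
    (P z [set w | hits_in_after B (t, w)] <= C%:E * P y (hits_in B))%E.
Proof.
move=> Iy t0 tr0 r01; have Ey := state_interiorW Iy; have y0 : 0 < y by case: Iy.
pose z0 := y / 2; have z00 : 0 < z0 by rewrite divr_gt0.
have z0y : z0 < y by rewrite ltr_pdivrMr// ltr_pMr// ltr1n.
have p1 := survival_below_gt0 z00 z0y Iy t0 (le_trans (ltW tr0) r01).
have p2 := extinction_window_gt0 z00 z0y Iy (ltW t0) tr0.
set A1 := (X in P y X) in p1; set A2 := (X in P y X) in p2.
have mgt : measurable (`]z0, +oo[%classic : set R) by exact: measurable_itv.
have mlt : measurable (`]-oo, z0[%classic : set R) by exact: measurable_itv.
have F1 := alive_eval_filtration (ltW t0) mlt.
have F2 := alive_eval_filtration (ltW t0) mgt.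
have A1E : A1 = (alive t `&` [set w : cpath R | `]-oo, z0[%classic (w t)]) `&` shift_path t @^-1` alive (r1 - t).
  have rt : 0 <= r1 - t by rewrite subr_ge0 (le_trans (ltW tr0)).
  have tE : t + (r1 - t) = r1 by rewrite addrC subrK.
  apply/seteqP; split => w; rewrite /A1 /= in_itv/=.
    by move=> [+ h]; rewrite -{1}tE => /(aliveD w (ltW t0) rt)[].
  by move=> [[h1 h2] h3]; split => //; rewrite -tE; apply/(aliveD w (ltW t0) rt).
have A2E : A2 = (alive t `&` [set w : cpath R | `]z0, +oo[%classic (w t)]) `&`
    shift_path t @^-1` [set w | (hitting_time 0 w < (r0 - t)%:E)%E].
  by apply/seteqP; split => w; rewrite /A2 /= in_itv/= andbT.
have mS (C : set (cpath R)) : measurable C -> measurable (shift_path t @^-1` C).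
  by move=> mC; rewrite -[X in measurable X]setTI; exact: measurable_shift_path.
have mA1 : measurable A1.
  rewrite A1E; apply: measurableI; first exact: natural_filtration_measurable F1.
  by apply: mS; exact: measurable_alive.
have mA2 : measurable A2.
  rewrite A2E; apply: measurableI; first exact: natural_filtration_measurable F2.
  by apply: mS; exact: measurable_hitting_lt.
have q1 : 0 < fine (P y A1) by rewrite fine_gt0// p1 law_ltoo.
have q2 : 0 < fine (P y A2) by rewrite fine_gt0// p2 law_ltoo.
(* Each coupling gives a positive probability times the left side as a lower bound for
   [P y (hits_in B)]. These probabilities depend neither on [z] nor on [B]. *)
exists (Num.max (fine (P y A1))^-1 (fine (P y A2))^-1).
  by rewrite le_max invr_ge0 ltW.
move=> z B Ez mB Br.
have mD : measurable [set w' : cpath R | hits_in_after B (t, w')].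
  by have := measurable_xsection t (measurable_hits_in_after mB); rewrite xsectionE.
have mBt : measurable ((fun u : R => t + u) @^-1` B).
  rewrite -[X in measurable X]setTI.
  have mf : measurable_fun setT (fun u : R => t + u) by exact: measurable_funD.
  exact: mf.
set c := fine (P z [set w | hits_in_after B (t, w)]).
have cE : P z [set w | hits_in_after B (t, w)] = c%:E by rewrite fineK// law_fin_num.
have c0 : 0 <= c by rewrite fine_ge0.
have bound (q : R) A : 0 < q -> (0 <= P y A)%E -> q = fine (P y A) -> measurable A ->
    (c%:E * P y A <= P y (hits_in B))%E -> (c%:E <= (q^-1)%:E * P y (hits_in B))%E.
  move=> q0 A0 qE mA; have hf := law_fin_num y (measurable_hits_in mB).
  rewrite -(fineK hf) -(fineK (law_fin_num y mA)) -qE -!EFinM !lee_fin.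
  by rewrite ler_pdivlMl// mulrC.
have mono (q : R) : q^-1 <= Num.max (fine (P y A1))^-1 (fine (P y A2))^-1 ->
    (c%:E <= (q^-1)%:E * P y (hits_in B))%E ->
    (c%:E <= (Num.max (fine (P y A1))^-1 (fine (P y A2))^-1)%:E * P y (hits_in B))%E.
  move=> qm h; apply: (le_trans h); exact: lee_wpmul2r.
rewrite cE; have [zz0|z0z] := leP z z0.
  apply: (mono (fine (P y A2))); first by rewrite le_max lexx orbT.
  apply: (bound _ A2) => //; rewrite A2E.
  apply: hits_in_markov_ge => //; first exact: ltW.
    exact: measurable_hitting_lt.
  move=> w [_ /=]; rewrite in_itv/= andbT => zw Ew.
  rewrite -cE muleC; apply: (@coupling_below (w t) z (r0 - t) ((fun u : R => t + u) @^-1` B)) => //.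
    exact: le_lt_trans zw.
  by move=> u /Br /andP[h _]; rewrite lerBlDl.
apply: (mono (fine (P y A1))); first by rewrite le_max lexx.
apply: (bound _ A1) => //; rewrite A1E.
apply: hits_in_markov_ge => //; first exact: ltW.
  exact: measurable_alive.
move=> w [_ /=]; rewrite in_itv/= => wz Ew.
rewrite -cE muleC; apply: (@coupling_above (w t) z (r1 - t) ((fun u : R => t + u) @^-1` B)) => //.
  exact: lt_trans z0z.
by move=> u /Br /andP[_ h]; rewrite lerBrDl.
Qed.

Lemma near_ties_filtration n a t c : 0 <= t ->
  natural_filtration t [set w : cpath R | c < near_ties n a t w].
Proof.
move=> t0; apply: natural_filtration_invariant => //; last by move=> w /=; rewrite near_ties_stop.
by apply: measurable_lt_set => //; exact: measurable_near_ties.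
Qed.

(** Extinction in [B] comes after [t], so the Markov property at [t] applies on [N] and on survival;
    the Harnack bound replaces the extinction probability from [w t] by a constant, which leaves a
    product. *)
Lemma harnack_decoupling (y t r0 r1 C : R) (N : set (cpath R)) (B : set R) : E y -> 0 <= t -> t < r0 ->
  0 <= C -> (forall z B, E z -> measurable B -> (forall u, B u -> r0 <= u <= r1) ->
    (P z [set w | hits_in_after B (t, w)] <= C%:E * P y (hits_in B))%E) ->
  natural_filtration t N -> measurable B -> (forall u, B u -> r0 <= u <= r1) ->
  (P y (N `&` hits_in B) <= C%:E * P y N * P y (hits_in B))%E.
Proof.
move=> Ey t0 tr0 C0 hC FN mB Br; have mN := natural_filtration_measurable FN.
have mH := measurable_hits_in mB.
have FA : natural_filtration t (N `&` alive t).
  have : @measurable _ (g_sigma_algebraType (@coordinate_events R `[0, t])) (N `&` alive t).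
    by apply: measurableI => //; exact: alive_filtration.
  by [].
have mA := natural_filtration_measurable FA.
have mD : measurable [set w' : cpath R | hits_in_after B (t, w')].
  by have := measurable_xsection t (measurable_hits_in_after mB); rewrite xsectionE.
rewrite (_ : N `&` hits_in B = (N `&` alive t) `&` shift_path t @^-1` [set w' | hits_in_after B (t, w')]); last first.
  apply/seteqP; split => w /=.
    move=> [Nw /[dup] Hw [h1 h2]]; have aw : alive t w.
      have hf : hitting_time 0 w \is a fin_num by rewrite ge0_fin_numE// hitting_ge0.
      rewrite /alive/= -(fineK hf) lte_fin (lt_le_trans tr0)//.
      by have /andP[] := Br _ h2.
    by split => //; apply/(hits_in_shift B t0) => //; exact: ltW.
  move=> [[Nw aw] Hw]; split => //; apply: (hits_in_shift B t0 _).1 Hw.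
  exact: ltW.
rewrite simple_markov//.
apply: (@le_trans _ _ (\int[P y]_(w in N `&` alive t) (cst (C%:E * P y (hits_in B))%E w))%E).
  apply: ae_ge0_le_integral => //.
  - exact: measurable_funTS (measurable_law_eval t mD).
  - by move=> w _; rewrite mule_ge0// lee_fin.
  have := state_ae Ey t0; apply: filterS => w Ew _; exact: hC.
rewrite integral_cst// [X in (_ <= X)%E]muleAC.
apply: lee_wpmul2l; first by rewrite mule_ge0// lee_fin.
by apply: le_measure; rewrite ?inE// => w [].
Qed.

(** A path from below [y] that is above [y] at [u0] has passed [y] before. It is restarted there,
    its ties after [u0] are ties of the restarted path, and the decoupling from [y], available for
    every elapsed time up to [u0], bounds them by a quantity in which [x] enters through its
    extinction probability. *)
Lemma ties_before_extinction (x y u0 t c C : R) n (B : set R) : I x -> I y -> x < y -> 0 < u0 -> 0 < t -> 0 <= C ->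
  measurable B -> (forall u, B u -> u0 < u) ->
  (forall s, 0 <= s -> s <= u0 ->
    (P y ([set w : cpath R | (c < near_ties n 0 t w)%R] `&` [set w | hits_in_after B (s, w)]) <=
     C%:E * P y [set w : cpath R | (c < near_ties n 0 t w)%R] * P y [set w | hits_in_after B (s, w)])%E) ->
  (P x ([set w : cpath R | (y < w u0)%R /\ (c < near_ties n u0 t w)%R] `&` hits_in B) <=
   C%:E * P y [set w : cpath R | (c < near_ties n 0 t w)%R] * P x (hits_in B))%E.
Proof.
move=> Ix Iy xy u00 t0 C0 mB Bu hC.
have Ex := state_interiorW Ix; have Ey := state_interiorW Iy.
pose N := [set w : cpath R | c < near_ties n 0 t w].
have mN : measurable N by apply: measurable_lt_set => //; exact: measurable_near_ties.
(* The stopping time is the first visit to [y] or 0 and not to [y] alone: it then precedes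
   extinction, and extinction of the restarted path is that of the original one. *)
pose psi (w : cpath R) u := (w u - y) * w u.
have cpsi w : continuous (psi w).
  by move=> u; apply: cvgM; [apply: cvgB; [|exact: cvg_cst]|]; exact: path_cont.
pose T w := first_zero (psi w).
have pT : proper_time T.
  apply: (@proper_first_zero _ (fun u r => (r - y) * r)) => [s|w]; last exact: cpsi.
  by apply: measurable_funM => //; exact: measurable_funB.
have cy : continuous (fun _ : R => y) by move=> u; exact: cvg_cst.
have sA := stopped_events_eval pT cy.
set A := (X in stopped_events T X) in sA.
have mA : measurable A by case: sA.
pose D0 := [set q : R * cpath R | q.1 <= u0].
have mD0 : measurable D0 by apply: measurable_le_set => //; exact: measurable_fst.
pose D1 := [set q : R * cpath R | N q.2] `&` hits_in_after B.
have mNq : measurable [set q : R * cpath R | N q.2].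
  by have := @measurable_snd _ _ R (cpath R) measurableT N mN; rewrite setTI.
have mH := measurable_hits_in_after mB.
have mD1 : measurable D1 by exact: measurableI.
have Tge0 w : 0 <= fine (T w) by rewrite fine_ge0// first_zero_ge0.
have Tfin w : (T w < +oo)%E -> T w \is a fin_num by move=> h; rewrite ge0_fin_numE//; exact: first_zero_ge0.
have mp : measurable_fun setT (fun w => (fine (T w), shift_path (fine (T w)) w)).
  have mt := measurable_fine_time (proper_measurable pT).
  by apply: measurable_fun_pair => //; exact: measurable_shift_comp.
have mE D : measurable D -> measurable (A `&` [set w | (T w < +oo)%E /\ D (fine (T w), shift_path (fine (T w)) w)]).
  move=> mD; apply: measurableI => //; apply: measurableI.
    by apply: measurable_time_lt; exact: proper_measurable.
  by have := mp measurableT D mD; rewrite setTI.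
have TleH w : A w -> (T w <= hitting_time 0 w)%E.
  move=> [Tw _]; case e : (hitting_time 0 w) => [r| |]; last 2 first.
  - by rewrite leey.
  - by have := hitting_ge0 0 w; rewrite e.
  move/hitting_finP : e => [r0 wr _]; apply/first_zeroP => //.
  by exists r; split => //; rewrite /psi wr mulr0.
apply: (@le_trans _ _ (P x (A `&` [set w | (T w < +oo)%E /\ (D0 `&` D1) (fine (T w), shift_path (fine (T w)) w)]))).
  apply: law_le_ae.
  - apply: measurableI; last exact: measurable_hits_in.
    apply: measurableI; first exact: measurable_eval_gt.
    by apply: measurable_lt_set => //; exact: measurable_near_ties.
  - by apply: mE; exact: measurableI.
  have := start_ae Ex; apply: filterS => w w0 [[/= yw cw] [h1 h2]].
  have cw0 : {within `[0, u0], continuous w}.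
    by apply: continuous_subspaceT => s; exact: path_cont.
  have wy : Num.min (w 0) (w u0) <= y <= Num.max (w 0) (w u0).
    by rewrite ge_min le_max w0 (ltW xy) (ltW yw) orbT.
  have [s] := IVT (ltW u00) cw0 wy; rewrite in_itv/= => /andP[s0 su] ws.
  have Ts : (T w <= s%:E)%E.
    by apply/first_zeroP => //; exists s; split => //; rewrite /psi ws subrr mul0r.
  have Tw : (T w < +oo)%E by rewrite (le_lt_trans Ts)// ltry.
  have Tu : fine (T w) <= u0 by rewrite -lee_fin fineK ?Tfin// (le_trans Ts)// lee_fin.
  have hf : hitting_time 0 w \is a fin_num by rewrite ge0_fin_numE// hitting_ge0.
  have uh : (u0%:E < hitting_time 0 w)%E by rewrite -(fineK hf) lte_fin Bu.
  have /esym/first_zero_finP := fineK (Tfin _ Tw) => /(_ (@cpsi w))[_ /eqP + _].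
  rewrite /psi mulf_eq0 subr_eq0 => /orP[/eqP wT|/eqP wT]; last first.
    have /hitting_gtP/(_ _ (Tge0 w) Tu) := uh.
    by rewrite wT eqxx.
  have Aw : A w by split.
  split => //; split => //; split => //; split => /=.
    apply: (lt_le_trans cw); apply: near_ties_shift => //; first by rewrite subr_ge0.
    by rewrite gerBl.
  by apply/(hits_in_shift B (Tge0 w)); [rewrite fineK ?Tfin//; exact: TleH|split].
rewrite (strong_markov_pair Ex pT sA (measurableI _ _ mD0 mD1)).
set K := (C%:E * P y N)%E.
have K0 : (0 <= K)%E by rewrite mule_ge0// lee_fin.
have AT : A `&` [set w | (T w < +oo)%E] = A by apply/setIidPl => w [].
have msec D : measurable D -> measurable_fun setT (fun w : cpath R => P (w (fine (T w))) [set w' | D (fine (T w), w')]).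
  move=> mD; have mw : measurable_fun setT (fun w : cpath R => w (fine (T w)) : measurableTypeR R).
    by apply: measurable_eval_comp => //; exact: measurable_fine_time (proper_measurable pT).
  apply: (@measurable_comp_kernel_section _ _ _ _ _ _ _ P _ mw [set q : cpath R * cpath R | D (fine (T q.1), q.2)]).
  have mg : measurable_fun setT (fun q : cpath R * cpath R => (fine (T q.1), q.2)).
    apply: measurable_fun_pair; last exact: measurable_snd.
    exact: measurableT_comp (measurable_fine_time (proper_measurable pT)) measurable_fst.
  by have := mg measurableT D mD; rewrite setTI.
have mD2 := measurableI _ _ mD0 mH.
have mD01 := measurableI _ _ mD0 mD1.
apply: (@le_trans _ _ (\int[P x]_(w in A `&` [set w | (T w < +oo)%E])
    (K * P (w (fine (T w))) [set w' | (D0 `&` hits_in_after B) (fine (T w), w')]))%E).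
  rewrite AT; apply: ge0_le_integral => //.
  - exact: measurable_funTS (msec _ mD01).
  - by apply: measurable_funeM; exact: measurable_funTS (msec _ mD2).
  move=> w [_ <-]; have [Tu|Tu] := leP (fine (T w)) u0; last first.
    rewrite (_ : [set w' | (D0 `&` D1) (fine (T w), w')] = set0) ?measure0 ?mule_ge0//.
    by apply/seteqP; split => w' //= -[/= h]; move: Tu; rewrite ltNge h.
  rewrite (_ : [set w' | (D0 `&` D1) (fine (T w), w')] = N `&` [set w' | hits_in_after B (fine (T w), w')]); last first.
    by apply/seteqP; split => w' /= => [[? []]|[? ?]].
  rewrite (_ : [set w' | (D0 `&` _) (fine (T w), w')] = [set w' | hits_in_after B (fine (T w), w')]); last first.
    by apply/seteqP; split => w' /= => [[]|].
  exact: hC.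
rewrite AT ge0_integralZl//; last first.
  exact: measurable_funTS (msec _ mD2).
apply: lee_wpmul2l => //.
rewrite -[X in (\int[_]_(_ in X) _)%E]AT -(strong_markov_pair Ex pT sA mD2).
apply: le_measure; rewrite ?inE.
- exact: mE.
- exact: measurable_hits_in.
move=> w [Aw [Tw [_ hw]]]; apply: (hits_in_shift B (Tge0 w) _).1 hw.
by rewrite fineK ?Tfin//; exact: TleH.
Qed.

(** * The excursion bridge *)

(** [conditioned_hitting] states the disintegration for events, as an equality of two mixtures of
    measures; both are integrated by [integral_mixture]. *)
Lemma conditioned_integral x (Q : R.-pker (measurableTypeR R) ~> cpath R) (B : set R) (f : cpath R -> \bar R) :
  conditioned_hitting P x Q -> measurable B -> measurable_fun setT f -> (forall w, (0 <= f w)%E) ->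
  (\int[P x]_(w in hits_in B) f w =
   \int[P x]_(w in hits_in B) \int[Q (fine (hitting_time 0 w))]_w' f w')%E.
Proof.
move=> [cH _] mB mf f0; have mH := measurable_hits_in mB.
pose K0 (w : cpath R) : {measure set (cpath R) -> \bar R} := dirac w.
have mK0 U : measurable U -> measurable_fun setT (K0 ^~ U).
  move=> mU; rewrite (_ : K0 ^~ U = EFin \o (\1_U : _ -> R)).
    by apply/measurable_EFinP; apply: measurable_indic.
  by apply/funext => w; rewrite /K0/= diracE indicE.
pose K (w : cpath R) : {measure set (cpath R) -> \bar R} := Q (fine (hitting_time 0 w)).
have mK U : measurable U -> measurable_fun setT (K ^~ U).
  move=> mU; have mT := measurable_fine_time (proper_measurable (proper_hitting_time (0 : R))).
  exact: (measurableT_comp (measurable_kernel Q U mU) mT).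
pose nu : {measure set (cpath R) -> \bar R} := mixture_measure (P x) mH mK0.
have nuE0 U : measurable U -> nu U = mixture (P x) (hits_in B) K0 U by [].
have nuE U : measurable U -> nu U = mixture (P x) (hits_in B) K U.
  move=> mU; have HB : [set w | exists2 l, B l & hitting_time 0 w = l%:E] = hits_in B.
    apply/seteqP; split => w /=; first by move=> [r Br e]; rewrite /hits_in/= e ltry.
    by move=> [h1 h2]; exists (fine (hitting_time 0 w)) => //; rewrite fineK// ge0_fin_numE// hitting_ge0.
  have := cH U B mU mB; rewrite /= HB /mixture => <-.
  rewrite /nu/= /mixture/= -integral_indic//.
transitivity (\int[nu]_w f w)%E.
  rewrite (integral_mixture mH mK0 nuE0)//.
  by apply: eq_integral => w _; rewrite /K0 integral_dirac// diracT mul1e.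
by rewrite (integral_mixture mH mK nuE).
Qed.

Lemma hits_in_window_gt0 x l h : I x -> 0 < h -> h < l -> (0 < P x (hits_in `](l - h)%R, (l + h)%R[))%E.
Proof.
move=> Ix h0 hl; have x0 : 0 < x by case: Ix.
have x20 : 0 < x / 2 by rewrite divr_gt0.
have x2 : x / 2 < x by rewrite ltr_pdivrMr// ltr_pMr// ltr1n.
have lh : 0 <= l - h by rewrite subr_ge0 ltW.
have lh2 : l - h < l + h by move: h0; lra.
apply: lt_le_trans (extinction_window_gt0 x20 x2 Ix lh lh2) _.
apply: le_measure; rewrite ?inE.
- apply: measurableI; first by apply: measurableI; [exact: measurable_alive|exact: measurable_eval_gt].
  rewrite -[X in measurable X]setTI; apply: measurable_shift_path => //; exact: measurable_hitting_lt.
- by apply: measurable_hits_in; exact: measurable_itv.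
move=> w [[aw _] /= hw]; have aw' := aw; rewrite /alive/= in aw'.
have := hitting_lt_shift lh hw.
rewrite (_ : l - h + (l + h - (l - h)) = l + h); last by ring.
move=> hw'; have [h1 h2] := (hitting_lt_fine 0 (l + h) w).1 hw'.
split => //=; rewrite in_itv/= h2 andbT -lte_fin fineK//.
by rewrite ge0_fin_numE// hitting_ge0.
Qed.

(* Averages over the hitting times near l, using the continuity of Q at l. *)
Lemma conditioned_le x (Q : R.-pker (measurableTypeR R) ~> cpath R) (G : cpath R -> R) (K del l h0 : R) :
  I x -> 0 <= del -> conditioned_hitting P x Q -> 0 < l -> 0 < h0 ->
  continuous G -> measurable_fun setT G -> (forall w, 0 <= G w <= K) ->
  (forall h, 0 < h -> h < h0 -> (\int[P x]_(w in hits_in `](l - h)%R, (l + h)%R[) (G w)%:E <=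
     del%:E * P x (hits_in `](l - h)%R, (l + h)%R[))%E) ->
  \int[Q l]_w G w <= del.
Proof.
move=> Ix del0 cH l0 h00 cG mG GK hG; rewrite leNgt; apply/negP => lt.
pose q r := \int[Q r]_w G w.
have G0 w : 0 <= G w by case/andP: (GK w).
have Gn w : `|G w| <= K by rewrite ger0_norm//; case/andP: (GK w).
have cq : q r @[r --> l] --> q l.
  by have [_ h] := cH; apply: h => //; exists K.
(* If the integral under [Q l] exceeded [del], then by continuity those under [Q r] would exceed the
   midpoint [gam] for [r] near [l], and so would the average over a small window, which has positive
   probability. *)
pose gam := (q l + del) / 2.
have gq : gam < q l by rewrite /gam; move: lt; rewrite -/(q l); lra.
have dg : del < gam by rewrite /gam; move: lt; rewrite -/(q l); lra.
have : \forall r \near l, gam < q r by exact: (cvgr_gt _ cq).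
move=> /nbhs_ballP[r0 /= r00 hr].
pose h := Num.min (r0 / 2) (Num.min (h0 / 2) (l / 2)).
have h_gt0 : 0 < h by rewrite !lt_min !divr_gt0.
have hr0 : h < r0 by rewrite gt_min ltr_pdivrMr// ltr_pMr// ltr1n.
have hh0 : h < h0 by rewrite !gt_min [h0 / 2 < h0]ltr_pdivrMr// ltr_pMr// ltr1n orbT.
have hl : h < l by rewrite !gt_min [l / 2 < l]ltr_pdivrMr// ltr_pMr// ltr1n !orbT.
pose B : set R := `](l - h)%R, (l + h)%R[%classic.
have mB : measurable B by exact: measurable_itv.
have mH := measurable_hits_in mB.
have := hG h h_gt0 hh0; rewrite (conditioned_integral cH mB); last 2 first.
- by apply/measurable_EFinP.
- by move=> w; rewrite lee_fin.
apply/negP; rewrite -ltNge; have P0 := hits_in_window_gt0 Ix h_gt0 hl.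
rewrite -/B in P0 *.
apply: (@lt_le_trans _ _ (gam%:E * P x (hits_in B))%E).
  by rewrite lte_pmul2r ?lte_fin// law_fin_num.
rewrite -integral_cst//; apply: ge0_le_integral => //.
- by move=> w _; rewrite lee_fin ltW// (le_lt_trans _ dg).
- have mT := measurable_fine_time (proper_measurable (proper_hitting_time (0 : R))).
  have mq : measurable_fun setT (fun r : measurableTypeR R => \int[Q r]_w (G w)%:E)%E.
    apply: (@measurable_fun_integral_kernel _ _ _ _ _ (fun x => Q x)).
    + by move=> U mU; exact: measurable_kernel.
    + by move=> w; rewrite lee_fin.
    + by apply/measurable_EFinP.
  apply: measurable_funTS; exact: (measurableT_comp mq mT).
move=> w [hw1]; rewrite /B /= in_itv/= => /andP[w1 w2].
have := hr (fine (hitting_time 0 w)); rewrite /ball/= => /(_ _) hq.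
have {}hq : gam < q (fine (hitting_time 0 w)).
  apply: hq; rewrite ltr_distlC; move: w1 w2 hr0; move: (fine _) => f; rewrite !ltrBlDr => ? ? ?.
  by apply/andP; split; lra.
rewrite /q /Rintegral in hq.
have Qf : (\int[Q (fine (hitting_time 0 w))]_w' (G w')%:E)%E \is a fin_num.
  rewrite ge0_fin_numE; last by apply: integral_ge0 => w' _; rewrite lee_fin.
  apply: (@le_lt_trans _ _ (\int[Q (fine (hitting_time 0 w))]_w' (cst K%:E w'))%E); last first.
    by rewrite integral_cst// prob_kernel mule1 ltry.
  apply: ge0_le_integral => //.
  - by move=> w' _; rewrite lee_fin.
  - by apply/measurable_EFinP.
  - by move=> w' _; rewrite lee_fin; case/andP: (GK w').
by rewrite -(fineK Qf) lee_fin ltW.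
Qed.

(** [C] is chosen before [x], [Q], [n] and [c]: the bound has to survive the limit in [x] before [n]
    and [c] are chosen. *)
Lemma conditioned_weighted_ties (y u0 t l : R) : I y -> 0 < u0 -> 0 < t -> u0 + t < l ->
  exists2 C : R, 0 <= C & forall x (Q : R.-pker (measurableTypeR R) ~> cpath R) n (c : R),
    I x -> x < y -> conditioned_hitting P x Q -> 0 <= c ->
    \int[Q l]_w weighted_ties n y u0 t w <=
      c + area u0 t * (C * fine (P y [set w : cpath R | c < near_ties n 0 t w])).
Proof.
move=> Iy u00 t0 utl; have Ey := state_interiorW Iy.
(* After a restart at some time in $[0,u0]$, extinction within [h0] of [l] takes place at a
   remaining time between [r0] and [r1]. By the choice of [h0] one has [r0 = t + h0], later than the
   observation of ties up to [t]. *)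
pose h0 := (l - u0 - t) / 2; pose r0 := l - h0 - u0; pose r1 := l + h0.
have h00 : 0 < h0 by rewrite /h0; move: utl; lra.
have tr0 : t < r0 by rewrite /r0 /h0; move: utl; lra.
have r01 : r0 <= r1 by rewrite /r0 /r1; move: h00 u00; lra.
have l0 : 0 < l by move: utl u00 t0; lra.
have [C C0 hC] := harnack Iy t0 tr0 r01; exists C => // x Q n c Ix xy cH c0.
pose N := [set w : cpath R | c < near_ties n 0 t w].
have FN : natural_filtration t N by apply: near_ties_filtration; exact: ltW.
have mN := natural_filtration_measurable FN.
have A0 : 0 <= area u0 t :> R by rewrite fine_ge0.
have p0 : 0 <= fine (P y N) by rewrite fine_ge0.
apply: (conditioned_le (K := area u0 t) Ix _ cH l0 h00).
- by rewrite addr_ge0// !mulr_ge0.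
- exact: weighted_ties_continuous.
- exact: measurable_weighted_ties.
- by move=> w; rewrite weighted_ties_ge0 weighted_ties_le.
move=> h h_gt0 hh0; set B : set R := `](l - h)%R, (l + h)%R[%classic.
have mB : measurable B by exact: measurable_itv.
have mH := measurable_hits_in mB.
have Bu u : B u -> u0 < u.
  by rewrite /B/= in_itv/= => /andP[h1 _]; move: h1 hh0; rewrite /h0; move: t0 utl; lra.
pose Z := [set w : cpath R | y < w u0 /\ c < near_ties n u0 t w].
have mZ : measurable Z.
  apply: measurableI; first exact: measurable_eval_gt.
  by apply: measurable_lt_set => //; exact: measurable_near_ties.
have key : (P x (Z `&` hits_in B) <= C%:E * P y N * P x (hits_in B))%E.
  apply: ties_before_extinction => // s s0 su.
  apply: (@harnack_decoupling y t r0 r1 C N ((fun v : R => s + v) @^-1` B)) => //.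
  - exact: ltW.
  - have mf : measurable_fun setT (fun v : R => s + v) by exact: measurable_funD.
    by have := mf measurableT B mB; rewrite setTI.
  move=> v; rewrite /B/= in_itv/= => /andP[h1 h2].
  by rewrite /r0 /r1; apply/andP; split; move: h1 h2 hh0 s0 su; lra.
apply: (@le_trans _ _ (\int[P x]_(w in hits_in B) (c%:E + (area u0 t)%:E * (\1_Z w)%:E))%E).
  apply: ge0_le_integral => //.
  - by move=> w _; rewrite lee_fin weighted_ties_ge0.
  - by apply/measurable_EFinP; apply: measurable_funTS; exact: measurable_weighted_ties.
  - apply/measurable_EFinP; apply: measurable_funTS; apply: measurable_funD => //.
    by apply: measurable_funM => //; exact: measurable_indic.
  by move=> w _; rewrite -EFinM -EFinD lee_fin; exact: weighted_ties_split.
rewrite ge0_integralD//; last 2 first.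
- by move=> w _; rewrite -EFinM lee_fin mulr_ge0.
- apply/measurable_EFinP; apply: measurable_funTS.
  by apply: measurable_funM => //; exact: measurable_indic.
rewrite integral_cst// ge0_integralZl//; last first.
  by apply/measurable_EFinP; apply: measurable_funTS; exact: measurable_indic.
rewrite integral_indic// EFinD muleDl//; last by rewrite law_fin_num.
apply: leeD => //; rewrite EFinM -muleA; apply: lee_wpmul2l => //.
by rewrite EFinM fineK ?law_fin_num.
Qed.

(** Markov's inequality and dominated convergence, the ties being null almost surely under [P y]. *)
Lemma near_ties_cvg_null y t c : E y -> 0 <= t -> 0 < c ->
  fine (P y [set w : cpath R | c < near_ties n 0 t w]) @[n --> \oo] --> (0 : R).
Proof.
move=> Ey t0 c0; have A0 : 0 <= area 0 t :> R by rewrite fine_ge0.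
have bd n (w : cpath R) : `|near_ties n 0 t w| <= area 0 t.
  by rewrite ger0_norm ?near_ties_le// near_ties_ge0.
have h : \int[P y]_w near_ties n 0 t w @[n --> \oo] --> \int[P y]_w (fun=> 0 : R) (w : cpath R).
  apply: (@law_dominated_convergence _ setT (fun n => near_ties n 0 t) (fun=> 0) (area 0 t) 0) => //.
  - by move=> n; exact: measurable_near_ties.
  - by move=> w; rewrite normr0.
  have := ties_ae Ey t0; apply: filterS => w tw _; split => //.
  exact: near_ties_cvg0.
rewrite Rintegral_cst// mul0r in h.
apply: (@squeeze_cvgr _ _ _ _ (fun=> 0) (fun n => c^-1 * \int[P y]_w near_ties n 0 t w)).
- near=> n; rewrite fine_ge0//=; rewrite ler_pdivlMl//.
  have mN : measurable [set w : cpath R | c < near_ties n 0 t w].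
    by apply: measurable_lt_set => //; exact: measurable_near_ties.
  rewrite -lee_fin EFinM fineK ?law_fin_num// /Rintegral fineK; last first.
    apply: integrable_fin_num => //; apply: (@law_integrable _ _ _ (area 0 t)) => //.
    exact: measurable_near_ties.
  rewrite -[X in (_ * P y X)%E]setIT -[X in (_ * P y X)%E]setIC -integral_cst//; last exact: measurableI.
  rewrite setTI; apply: (@le_trans _ _ (\int[P y]_(w in [set w : cpath R | (c < near_ties n 0 t w)%R]) (near_ties n 0 t w)%:E)%E).
    apply: ge0_le_integral => //.
    + by move=> w _; rewrite lee_fin ltW.
    + by apply/measurable_EFinP; apply: measurable_funTS; exact: measurable_near_ties.
    + by move=> w /= cw; rewrite lee_fin ltW.
  apply: ge0_subset_integral => //.
  + by apply/measurable_EFinP; exact: measurable_near_ties.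
  + by move=> w _; rewrite lee_fin near_ties_ge0.
- exact: cvg_cst.
- by rewrite -[X in _ --> X](mulr0 c^-1); apply: cvgM => //; exact: cvg_cst.
Unshelve. all: by end_near. Qed.

(** The functional is bounded and continuous and looks at the path before [l] only, so stopping at
    [l] is invisible and the uniform bound passes to the weak limit. *)
Lemma bridge_weighted_ties (l : R) (mu : probability (cpath R) R) (y u0 t : R) :
  excursion_bridge_law b P l mu -> I y -> 0 < u0 -> 0 < t -> u0 + t < l ->
  exists2 C : R, 0 <= C & forall n (c : R), 0 <= c ->
    \int[mu]_w weighted_ties n y u0 t w <=
      c + area u0 t * (C * fine (P y [set w : cpath R | c < near_ties n 0 t w])).
Proof.
move=> [[Q [cH cvQ]] _] Iy u00 t0 utl.
have [C C0 hC] := conditioned_weighted_ties Iy u00 t0 utl; exists C => // n c c0.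
set del := (X in _ <= X).
have h := cvQ (weighted_ties n y u0 t) (@weighted_ties_continuous _ n y u0 t).
have bd : exists C, forall w : cpath R, `|weighted_ties n y u0 t w| <= C.
  by exists (area u0 t) => w; rewrite ger0_norm ?weighted_ties_ge0 ?weighted_ties_le.
apply: (ler_cvg_to (h bd) (cvg_cst _)).
near=> x; have x0 : 0 < x by [].
have xy : x < y by near: x; apply: nbhs_right_lt; case: Iy.
have Ix : I x by exact: state_space_lt (state_interiorW Iy) x0 xy.
rewrite /stopped_law /= /Rintegral.
rewrite ge0_integral_pushforward//; last 2 first.
- by apply/measurable_EFinP; exact: measurable_weighted_ties.
- by move=> w _; rewrite lee_fin weighted_ties_ge0.
- rewrite preimage_setT; apply: le_trans (hC x (Q x) n c Ix xy (cH x Ix) c0).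
  rewrite le_eqVlt; apply/orP; left; apply/eqP; apply: (f_equal fine); apply: eq_integral => w _.
  rewrite /= weighted_ties_stop//; move: utl u00 t0; lra.
- exact: measurable_stop_path.
Unshelve. all: by end_near. Qed.

Lemma bridge_ties (l : R) (mu : probability (cpath R) R) (y u0 t : R) :
  excursion_bridge_law b P l mu -> I y -> 0 < u0 -> 0 < t -> u0 + t < l ->
  \forall w \ae mu, y < (w : cpath R) u0 -> ties u0 t w = 0.
Proof.
move=> X_bridge Iy u00 t0 utl; have Ey := state_interiorW Iy.
have [C C0 hC] := bridge_weighted_ties X_bridge Iy u00 t0 utl.
have A0 : 0 <= area u0 t :> R by rewrite fine_ge0.
(* The factor [cutoff] is positive above [y], so it is enough that [F] has integral 0. *)
pose F (w : cpath R) : \bar R := ((cutoff y u0 w)%:E * ties u0 t w)%E.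
have mF : measurable_fun setT F.
  apply: emeasurable_funM; last exact: measurable_ties.
  by apply/measurable_EFinP; exact: measurable_cutoff.
have F0 w : (0 <= F w)%E.
  by rewrite mule_ge0// lee_fin; case/andP: (cutoff_itv y u0 w).
have iG n : mu.-integrable setT (EFin \o weighted_ties n y u0 t).
  apply: measurable_bounded_integrable => //.
  - by rewrite (le_lt_trans (probability_le1 _ _))// ltry.
  - exact: measurable_weighted_ties.
  exists (area u0 t); split; first exact: num_real.
  by move=> r Cr w _ /=; rewrite ger0_norm ?weighted_ties_ge0// (le_trans (weighted_ties_le _ _ _ _ _))// ltW.
have int0 : (\int[mu]_w F w = 0)%E.
  apply/eqP; rewrite eq_le integral_ge0// andbT.
  apply/lee_addgt0Pr => e e0; rewrite add0e.
  (* Half of [e] is the threshold; the other half bounds the remaining term, by taking [n] large for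
     this threshold. *)
  have e20 : 0 < e / 2 by rewrite divr_gt0.
  have hn := near_ties_cvg_null Ey (ltW t0) e20.
  have K0 : 0 < area u0 t * C + 1 by rewrite ltr_wpDl// mulr_ge0.
  have : \forall n \near \oo, fine (P y [set w : cpath R | e / 2 < near_ties n 0 t w]) < e / 2 / (area u0 t * C + 1).
    by apply: (cvgr_lt _ hn); exact: divr_gt0.
  move=> /filter_ex[n hn'].
  apply: (@le_trans _ _ (\int[mu]_w weighted_ties n y u0 t w)%:E).
    rewrite /Rintegral fineK; last exact: (integrable_fin_num measurableT (iG n)).
    apply: ge0_le_integral => //.
    - by apply/measurable_EFinP; exact: measurable_weighted_ties.
    - move=> w _; rewrite /F /weighted_ties EFinM; apply: lee_wpmul2l; last exact: ties_le.
      by rewrite lee_fin; case/andP: (cutoff_itv y u0 w).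
  rewrite lee_fin (le_trans (hC n _ (ltW e20)))//.
  rewrite [X in _ <= X]splitr lerD2l mulrA.
  have p0 : 0 <= fine (P y [set w : cpath R | e / 2 < near_ties n 0 t w]) by rewrite fine_ge0.
  move: hn'; rewrite ltr_pdivlMr// => hn'; apply: le_trans (ltW hn').
  by rewrite mulrC ler_wpM2l// lerDl.
have [+ _] := @ae_eq_integral_abs _ _ _ mu setT measurableT F mF.
rewrite (eq_integral F); last by move=> w _; rewrite gee0_abs.
move=> /(_ int0); apply: filterS => w /(_ Logic.I) /eqP + yw.
rewrite /F mule_eq0 eqe => /orP[/eqP h|/eqP//].
by have := cutoff_gt0 yw; rewrite h ltxx.
Qed.

Lemma bridge_level_null (l : R) (mu : probability (cpath R) R) :
  0 < l -> excursion_bridge_law b P l mu ->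
  \forall w \ae mu, forall c, leb (`[0, l] `&` [set s | (w : cpath R) s = c]) = 0.
Proof.
move=> l0 X_bridge; have [_ exc] := X_bridge.
have [z Iz] : exists z, I z.
  have := ss_b_gt0 Sm; case: b => [b'||] //= b0.
    by exists (b' / 2); split; rewrite ?divr_gt0// lte_fin ltr_pdivrMr// ltr_pMr// ltr1n.
  by exists 1; split => //; exact: ltry.
have z0 : 0 < z by case: Iz.
(* Countably many levels and time intervals, to collect the null sets. The denominator [i.+3] keeps
   [t i] positive, and twice [u i] leaves a gap in [u i + t i < l]. *)
pose y j := z / j.+2%:R; pose u i := l / i.+3%:R; pose t i := l - 2 * u i.
have Iy j : I (y j).
  apply: (state_space_lt (state_interiorW Iz)); first by rewrite divr_gt0.
  by rewrite ltr_pdivrMr// ltr_pMr// ltr1n.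
have u0 i : 0 < u i by rewrite divr_gt0.
have t0 i : 0 < t i.
  by rewrite /t /u subr_gt0 mulrA ltr_pdivrMr// mulrC ltr_pM2l// ltr_nat.
have ut i : u i + t i < l by rewrite /t; move: (u0 i); lra.
have all_ties : \forall w \ae mu, forall i j, y j < (w : cpath R) (u i) -> ties (u i) (t i) w = 0.
  apply/ae_foralln => i; apply/ae_foralln => j; exact: (bridge_ties X_bridge (Iy j) (u0 i) (t0 i) (ut i)).
have small e : 0 < e -> exists N, forall i, (N <= i)%N -> u i < e.
  move=> e0; exists (Num.truncn (l / e)) => i Ni; rewrite /u ltr_pdivrMr// mulrC -ltr_pdivrMr//.
  by apply: lt_le_trans (truncnS_gt _) _; rewrite ler_nat ltnS (leq_trans Ni)// -addn2 leq_addr.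
apply: filterS2 exc all_ties => w [[w0 [zeta [zeta0 wpos _]]] _] wt c.
have [N hN] := small _ zeta0.
apply: (@level_null_exhaustion _ _ _ _ (fun n => u (N + n)%N) (fun n => t (N + n)%N)).
  move=> s s0 sl; have d0 : 0 < Num.min s ((l - s) / 2) by rewrite lt_min s0 divr_gt0// subr_gt0.
  have [M hM] := small _ d0; exists M; have := hM (N + M)%N (leq_addl _ _).
  by rewrite lt_min /t => /andP[h1 h2]; apply/andP; split; move: (u (N + M)%N) h1 h2 => ?; lra.
move=> n; apply: level_null_ties.
(* An excursion is positive just after 0, so for late indices it is above one of the levels [y j] at
   the left end of the interval, and there are no ties on the interval. *)
have wu : 0 < w (u (N + n)%N) by apply: wpos; rewrite u0 hN// leq_addr.
have [j hj] : exists j, y j < w (u (N + n)%N).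
  exists (Num.truncn (z / w (u (N + n)%N))); rewrite /y ltr_pdivrMr// mulrC -ltr_pdivrMr//.
  by apply: lt_le_trans (truncnS_gt _) _; rewrite ler_nat.
exact: wt hj.
Qed.

End markov.

(** * Rank of an independent uniform time *)

Section rank_of_bridge.
Context {R : realType}.
Local Notation TR := (measurableTypeR R).
Local Notation leb := (@lebesgue_measure R).

Lemma uniform_probE (l : R) (l0 : 0 < l) (A : set R) : measurable A ->
  uniform_prob l0 A = ((l^-1)%:E * leb (`[0%R, l] `&` A))%E.
Proof.
move=> mA; rewrite /uniform_prob integral_uniform_pdf setIC.
rewrite -integral_cst; last exact: measurableI.
apply: eq_integral => x; rewrite inE => -[/=]; rewrite in_itv/= /uniform_pdf subr0 => -> _.
by [].
Qed.

(** Open half-lines form a pi-system generating the Borel sets. Values outside $[0,l]$ follow by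
    monotonicity from those at the two ends. *)
Lemma uniformly_distributed_cdf d (T : measurableType d) (Pr : probability T R) (l : R) (l0 : 0 < l)
    (Z : T -> R) : measurable_fun setT Z ->
  (forall x, 0 <= x <= l -> Pr [set w | Z w < x] = (x / l)%:E) ->
  uniformly_distributed Pr l0 Z.
Proof.
move=> mZ hZ; split => // A mA.
have h0 x : x <= 0 -> Pr [set w | Z w < x] = 0.
  move=> x0; have l00 : (0 : R) <= 0 <= l by rewrite lexx ltW.
  apply/eqP; rewrite eq_le measure_ge0 andbT -[X in (_ <= X)%E](_ : Pr [set w | Z w < 0] = 0); last by rewrite hZ// mul0r.
  apply: le_measure; rewrite ?inE; [exact: measurable_lt_set..|].
  by move=> w /= h; exact: lt_le_trans h x0.
have h1 x : l <= x -> Pr [set w | Z w < x] = 1%:E.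
  move=> lx; have ll : 0 <= l <= l by rewrite lexx ltW.
  apply/eqP; rewrite eq_le probability_le1 ?andTb; last exact: measurable_lt_set.
  rewrite -[X in (X <= _)%E](_ : Pr [set w | Z w < l] = 1%:E); last by rewrite hZ// divff// gt_eqF.
  apply: le_measure; rewrite ?inE; [exact: measurable_lt_set..|].
  by move=> w /= h; exact: lt_le_trans h lx.
have mZ' : measurable_fun setT (Z : T -> TR) by exact: mZ.
pose m1 : {measure set TR -> \bar R} := push_measure Pr mZ'.
pose m2 : {measure set TR -> \bar R} := uniform_prob l0.
rewrite -[LHS]/(m1 A) -[RHS]/(m2 A).
apply: (@measure_unique _ R TR (@RGenInftyO.G R : set (set TR)) (fun n => `]-oo, n%:R[%classic : set TR)
  _ _ _ _ m1 m2 _ _ A) => //.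
- exact: RGenInftyO.measurableE.
- move=> _ _ [x ->] [y ->]; exists (Num.min x y); apply/seteqP; split => z /=; rewrite !in_itv/= lt_min.
    by move=> [-> ->].
  by move=> /andP[].
- by move=> n; exists n%:R.
- apply/seteqP; split => // x _; exists (Num.truncn x).+1 => //=.
  by rewrite in_itv/= truncnS_gt.
- move=> _ [x ->]; have -> : m1 `]-oo, x[%classic = Pr [set w | Z w < x].
    by congr (Pr _); apply/seteqP; split => w /=; rewrite in_itv.
  rewrite -[RHS]/(uniform_prob l0 `]-oo, x[%classic) uniform_probE; last exact: measurable_itv.
  have [x0|x0] := leP x 0.
    rewrite h0// (_ : _ `&` _ = set0) ?measure0 ?mule0//; apply/seteqP; split => u //= [].
    by rewrite !in_itv/= => /andP[u0 _] ux; have := le_lt_trans u0 (lt_le_trans ux x0); rewrite ltxx.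
  have [lx|xl] := ltP l x.
    rewrite (h1 _ (ltW lx)) setIidl; last first.
      by move=> u; rewrite /= !in_itv/= => /andP[_ ul]; exact: le_lt_trans ul lx.
    by rewrite lebesgue_measure_itv/= lte_fin l0 sube0 -EFinM mulVf// gt_eqF.
  rewrite hZ; last by rewrite (ltW x0) xl.
  rewrite (_ : _ `&` _ = `[0, x[%classic).
    by rewrite lebesgue_measure_itv/= lte_fin x0 sube0 -EFinM mulrC.
  apply/seteqP; split => u /=; rewrite !in_itv/=; first by move=> [/andP[-> _] ->].
  by move=> /andP[-> ux]; rewrite ux (le_trans (ltW ux) xl).
move=> n; rewrite /m1 /push_measure /=; apply: (le_lt_trans (probability_le1 _ _)); rewrite ?ltry//;
  rewrite -[X in measurable X]setTI; exact: mZ.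
Qed.

Lemma joint_law_uniform d d1 (T : measurableType d) (T1 : measurableType d1) (Pr : probability T R)
    (X : {RV Pr >-> T1}) (U : {RV Pr >-> R}) (l : R) (l0 : 0 < l) (C : set (T1 * TR)) :
  uniformly_distributed Pr l0 U -> independent_RV X U -> measurable C ->
  Pr [set w | C (X w, U w)] = (\int[distribution Pr X]_x uniform_prob l0 [set u | C (x, u)])%E.
Proof.
move=> [mU unifU] XU mC.
have mXU : measurable_fun setT (fun w : T => (X w, U w) : T1 * TR) by exact: measurable_fun_pair.
pose m1 : probability T1 R := distribution Pr X.
pose m2 : probability TR R := uniform_prob l0.
pose m' : {measure set (T1 * TR) -> \bar R} := push_measure Pr mXU.
transitivity ((m1 \x m2)%E C).
  rewrite (@product_measure_unique _ _ _ _ _ m1 m2 m')// => A B mA mB.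
  have -> : m' (A `*` B) = Pr (X @^-1` A `&` U @^-1` B) by [].
  by rewrite (XU A B mA mB) (unifU B mB).
by apply: eq_integral => x _; rewrite /= xsectionE.
Qed.

(** Independence makes the joint law a product. For almost every value of [X] the section has
    probability [x / l] by [rank_lt], so the integral over the law of [X] is that of a constant. *)
Lemma rank_uniformly_distributed d d1 (T : measurableType d) (T1 : measurableType d1) (Pr : probability T R)
    (X : {RV Pr >-> T1}) (U : {RV Pr >-> R}) (l : R) (l0 : 0 < l) (f : T1 * TR -> R) :
  uniformly_distributed Pr l0 U -> independent_RV X U -> measurable_fun setT f ->
  (\forall x \ae distribution Pr X, forall c, leb (`[0%R, l] `&` [set s | f (x, s) = c]) = 0) ->
  (forall x, exists C, forall s, 0 <= s <= l -> `|f (x, s)| <= C) ->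
  uniformly_distributed Pr l0 (fun w => fine (rank l (fun s => f (X w, s)) (U w))).
Proof.
move=> unifU XU mf level bd; have [mU _] := unifU.
pose r (q : T1 * TR) := fine (rank l (fun s => f (q.1, s)) q.2).
have mr : measurable_fun setT r.
  by apply: measurableT_comp => //; exact: measurable_rank_comp.
have mXU : measurable_fun setT (fun w : T => (X w, U w) : T1 * TR) by exact: measurable_fun_pair.
apply: uniformly_distributed_cdf; first exact: (measurableT_comp mr mXU).
move=> x /andP[x0 xl].
have mC : measurable [set q | r q < x] by exact: measurable_lt_set.
rewrite -[LHS]/(Pr [set w | [set q | r q < x] (X w, U w)]) (joint_law_uniform unifU XU mC).
rewrite (ae_eq_integral (cst (x / l)%:E))//.
- pose m1 : probability T1 R := distribution Pr X.
  transitivity ((x / l)%:E * m1 setT)%E; first exact: integral_cst.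
  by rewrite probability_setT mule1.
- have := @measurable_fun_xsection _ _ _ _ R (uniform_prob l0) _ mC.
  by rewrite (_ : _ \o _ = (fun y => uniform_prob l0 [set u | r (y, u) < x]))//;
    apply/funext => y; rewrite /= xsectionE.
apply: filterS level => y hy _ /=.
have mg : measurable_fun setT (fun s : TR => f (y, s)).
  by apply: measurableT_comp => //; exact: measurable_fun_pair.
have mry : measurable [set u | r (y, u) < x].
  by apply: measurable_lt_set => //; apply: measurableT_comp mr _; exact: measurable_fun_pair.
rewrite uniform_probE// mulrC EFinM; congr (_ * _)%E.
have [C hC] := bd y.
have hC' u : `[0, l]%classic u -> `|f (y, u)| <= C by rewrite /= in_itv/=; exact: hC.
have xi : 0 <= x <= l by rewrite x0.
rewrite -(rank_lt (ltW l0) mg hy hC' xi).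
have fr u : rank l (fun s => f (y, s)) u \is a fin_num by exact: rank_fin_num.
by congr (leb _); apply/seteqP; split => u /= [Du]; rewrite /r /= -lte_fin fineK.
Qed.

End rank_of_bridge.

Theorem theorem3p11 (R : realType) (b : \bar R) (k : boundary)
    (S m : R -> R) (Sm : scale_and_speed b k S m)
    (P : R.-pker (measurableTypeR R) ~> cpath R)
    (P_diff : recurrent_diffusion b k P S m)
    (l : R) (l_gt0 : 0 < l)
    (d : measure_display) (Omega : measurableType d) (Pr : probability Omega R)
    (X : {RV Pr >-> cpath R})
    (X_bridge : excursion_bridge_law b P l (distribution Pr X))
    (U : {RV Pr >-> R}) (U_unif : uniformly_distributed Pr l_gt0 U)
    (XU_indep : independent_RV X U) :
  let Iplus := fun w : Omega => \int[lebesgue_measure]_(s in `[0, l])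
    \1_[set r | X w (U w) < X w r] s in
  let Iminus := fun w : Omega => \int[lebesgue_measure]_(s in `[0, l])
    \1_[set r | X w r < X w (U w)] s in
  uniformly_distributed Pr l_gt0 Iplus /\
  uniformly_distributed Pr l_gt0 Iminus.
Proof.
have level := bridge_level_null P_diff Sm l_gt0 X_bridge.
have bd (w : cpath R) : exists C, forall s, 0 <= s <= l -> `|w s| <= C.
  have /compact_bounded[C [_ hC]] : compact (w @` `[0, l]).
    apply: continuous_compact; last exact: segment_compact.
    by apply: continuous_subspaceT; exact: path_cont.
  exists (C + 1) => s sl; apply: (hC (C + 1)); first by rewrite ltrDl.
  by exists s => //=; rewrite in_itv.
have mev : measurable_fun setT (fun q : cpath R * measurableTypeR R => q.1 q.2).
  by apply: measurable_eval_comp; [exact: measurable_snd|exact: measurable_fst].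
move=> Iplus Iminus; split.
- have -> : Iplus = fun w => fine (rank l (fun s => (X w) s) (U w)).
    by apply/funext => w; exact: (Rintegral_rank l (measurable_path (X w))).
  exact: (@rank_uniformly_distributed R _ _ _ _ _ X U l l_gt0 (fun q => q.1 q.2)).
have -> : Iminus = fun w => fine (rank l (fun s => - (X w) s) (U w)).
  apply/funext => w; rewrite -Rintegral_rank; last exact: measurableT_comp (measurable_path (X w)).
  rewrite /Iminus (_ : mkset _ = [set r | - X w (U w) < - X w r])//.
  by apply/seteqP; split => r /=; rewrite ltrN2.
apply: (@rank_uniformly_distributed R _ _ _ _ _ X U l l_gt0 (fun q => - q.1 q.2)) => //.
- exact: measurableT_comp.
- apply: filterS level => w hw c; rewrite -(hw (- c)); congr (lebesgue_measure _).
  apply/seteqP; split => s /= [?]; first by move=> <-; rewrite opprK.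
  by move=> ->; rewrite opprK.
by move=> w; have [C hC] := bd w; exists C => s sl; rewrite normrN; exact: hC.
Qed.
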